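(* Let $U:\mathbb{R}^n\times\mathbb{R}^n\to\mathbb{R}$ be smooth and let $\rho:(0,\infty)\times\mathbb{R}^n\times\mathbb{R}^n\to[0,\infty)$ be a smooth non-negative solution of \[ \partial_t\rho=\Delta_v\rho-\langle\nabla_vU,\nabla_v\rho\rangle-\langle v,\nabla_x\rho\rangle \] satisfying, for some constants $c_0,k_0,\kappa\ge0$, \[ |\nabla\rho|\le c_0e^{-\frac12U}(|x|+|v|),\qquad \nabla^2\rho\ge-k_0e^{\kappa(|x|^2+|v|^2)}I,\qquad \nabla^2U\le k_0e^{\kappa(|x|^2+|v|^2)}I. \] Let $h=-\frac12\langle v,\nabla_xU\rangle+\frac12\Delta_vU-\frac14|\nabla_vU|^2$ and assume $\nabla^2h\ge-K$ for some constant symmetric non-negative definite $2n\times2n$ matrix $K$. Then for all $t>0$ and all $(x,v)$, \[ \nabla^2\log\rho-\tfrac12\nabla^2U\ \ge\ N(t), \] where $N$ is a solution of the matrix Riccati equation $\dot N=NC+C^TN+NDN-K$ satisfying $\lim_{t\to0}N(t)^{-1}=0$ (as provided by Lemma 3.1), with $C=\begin{pmatrix}O&-I\\O&O\end{pmatrix}$, $D=\begin{pmatrix}O&O\\O&2I\end{pmatrix}$.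
   Context: Coordinates on $\mathbb{R}^n\times\mathbb{R}^n$ are $(x,v)$; $\Delta_v=\sum_i\partial_{v_i}^2$; $\nabla_x,\nabla_v$ are partial gradients, $\nabla,\nabla^2$ the full gradient and Hessian in $(x,v)$, written as $2\times2$ block matrices of $n\times n$ blocks ordered $(x,v)$; $I,O$ are $n\times n$ identity and zero matrices (and $I$ also the $2n\times2n$ identity where appropriate); matrix inequalities are in the sense of quadratic forms. Lemma 3.1: for symmetric non-negative definite $K$ there exists a solution $N(t)$, $t>0$, of $\dot N=NC+C^TN+NDN-K$ with $\lim_{t\to0}N^{-1}=0$, $N\le0$, $\dot N\ge0$. *)

(* Defs.v *)
From Stdlib Require Import Reals Lra Lia List ClassicalEpsilon.
Open Scope R_scope.

(* Points of R^m are represented as z : nat -> R; only coordinates 0..m-1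
   are meaningful.  For R^n x R^n (m = 2n): x_i = z i, v_i = z (n+i). *)

Fixpoint sumR (m : nat) (f : nat -> R) : R :=
  match m with O => 0 | S k => sumR k f + f k end.

Definition upd (z : nat -> R) (i : nat) (s : R) : nat -> R :=
  fun j => if Nat.eq_dec j i then s else z j.

(* i-th partial derivative (the derivative when it exists; junk otherwise) *)
Definition partial (i : nat) (f : (nat -> R) -> R) (z : nat -> R) : R :=
  epsilon (inhabits 0)
    (fun l => derivable_pt_lim (fun s => f (upd z i s)) (z i) l).

Definition iter_partial (l : list nat) (f : (nat -> R) -> R) : (nat -> R) -> R :=
  fold_right (fun i g => partial i g) f l.

Definition cont_at (m : nat) (g : (nat -> R) -> R) (z : nat -> R) : Prop :=
  forall eps, 0 < eps -> exists del, 0 < del /\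
    forall w, (forall i, (i < m)%nat -> Rabs (w i - z i) < del) ->
              (forall i, (m <= i)%nat -> w i = z i) ->
              Rabs (g w - g z) < eps.

Definition smooth_on (m : nat) (Dom : (nat -> R) -> Prop)
  (f : (nat -> R) -> R) : Prop :=
  forall l : list nat, Forall (fun i => (i < m)%nat) l ->
  forall z, Dom z ->
    (forall i, (i < m)%nat -> exists d,
        derivable_pt_lim (fun s => iter_partial l f (upd z i s)) (z i) d)
    /\ cont_at m (iter_partial l f) z.

(* matrices: nat -> nat -> R, meaningful for indices < m *)
Definition mat := nat -> nat -> R.

Definition hess (f : (nat -> R) -> R) (z : nat -> R) : mat :=
  fun i j => partial i (partial j f) z.

Definition quad (m : nat) (A : mat) (xi : nat -> R) : R :=
  sumR m (fun i => sumR m (fun j => xi i * A i j * xi j)).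

Definition mmul (m : nat) (A B : mat) : mat :=
  fun i j => sumR m (fun k => A i k * B k j).

Definition mtr (A : mat) : mat := fun i j => A j i.

Definition idm : mat := fun i j => if Nat.eq_dec i j then 1 else 0.

(* C = [[O, -I],[O, O]],  D = [[O, O],[O, 2I]]  (blocks ordered (x,v)) *)
Definition Cmat (n : nat) : mat :=
  fun i j => if (Nat.ltb i n && Nat.eqb j (i + n))%bool then -1 else 0.
Definition Dmat (n : nat) : mat :=
  fun i j => if (Nat.leb n i && Nat.eqb i j)%bool then 2 else 0.

Definition riccati_rhs (n : nat) (N K : mat) : mat :=
  fun i j => mmul (2*n) N (Cmat n) i j + mmul (2*n) (mtr (Cmat n)) N i j
           + mmul (2*n) (mmul (2*n) N (Dmat n)) N i j - K i j.

Definition is_inverse (m : nat) (A B : mat) : Prop :=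
  forall i j, (i < m)%nat -> (j < m)%nat -> mmul m A B i j = idm i j.

Definition inv_tends_to_zero (m : nat) (N : R -> mat) : Prop :=
  exists Ninv : R -> mat,
    (exists del, 0 < del /\ forall t, 0 < t < del -> is_inverse m (N t) (Ninv t)) /\
    (forall eps, 0 < eps -> exists del, 0 < del /\
       forall t, 0 < t < del -> forall i j, (i < m)%nat -> (j < m)%nat ->
         Rabs (Ninv t i j) < eps).

Definition xnorm (n : nat) (z : nat -> R) : R := sqrt (sumR n (fun i => z i ^ 2)).
Definition vnorm (n : nat) (z : nat -> R) : R := sqrt (sumR n (fun i => z (n + i)%nat ^ 2)).
Definition gradnorm (m : nat) (f : (nat -> R) -> R) (z : nat -> R) : R :=
  sqrt (sumR m (fun i => partial i f z ^ 2)).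

Definition hfun (n : nat) (U : (nat -> R) -> R) (z : nat -> R) : R :=
  - / 2 * sumR n (fun i => z (n + i)%nat * partial i U z)
  + / 2 * sumR n (fun i => partial (n + i) (partial (n + i) U) z)
  - / 4 * sumR n (fun i => partial (n + i) U z ^ 2).

(* Main.v *)
(** The function u = exp(-U/2) is a positive stationary solution of
    g_t = Lap_v g - v . grad_x g + h g, and so is g = u (rho + e) in time, for every e > 0.  Log-convexity
    of g relative to N is the two-point inequality
      g(t,z+w) g(t,z-w) >= exp(N(t)(w,w)) g(t,z)^2,
    which is proved by a maximum principle for
      2 sqrt(g(t,z+w) g(t,z-w)) - 2 exp(N(t)(w,w)/2) g(t,z) + eps B(t,z),    B = exp(A(t)(1+|z|^2)).
    At a first zero one linearizes the square root as e^a g(t,z+w) + e^-a g(t,z-w) and differentiates twice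
    along v_k while moving a at the rate -(N w)_{v_k}; the Riccati equation and Hess h >= -K then cancel
    everything except the strictly positive contribution of B.  As N tends to -oo at t = 0, no initial
    information on rho is needed: the comparison is started at a time t0 > 0 with N(t - t0), and t0 -> 0.

    For B to be a supersolution one needs h <= C (1+|z|^2), and to control infinity u <= exp(C (1+|z|^2)).
    Neither is assumed; both follow from the existence of the positive solution u.  Truncated Gaussians
    carried along controlled paths x' = v are compactly supported subsolutions, and comparison with them
    gives a Harnack inequality for u.  It starts from a half ball on which u >= u(z0)/e (a consequence of the
    bound on Hess U), and bounds u by exp(C (1+|z|^2)).  Since h is semiconvex, a large value h(z0) persists
    in a half ball, and a straight path inside it would make u violate that growth bound. *)

From mathcomp Require ssreflect ssrfun ssrbool eqtype ssrnat fintype bigop ssralg matrix Rstruct.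
From Coquelicot Require Import Coquelicot.
From Stdlib Require Import Reals Lra Lia List ClassicalEpsilon FunctionalExtensionality.
Require Import Defs.
Open Scope R_scope.

(** The constant [e] keeps [g] positive where [rho] vanishes, so the square root can be linearized;
    constants solve the original linear equation, so nothing else changes. The two-point form needs
    derivatives of [g] up to order two only, whereas a maximum principle for the Hessian of log g
    would use order four. A first zero must be attained: [z] is confined because the barrier
    exponent exceeds the growth exponent of [g], and [w] because [N] is negative definite. Neither
    symmetry nor sign of [N] is given and [N] is singular at 0, so both are read off the inverse
    [J], which solves the regular equation [J' = J K J - C J - J C^T - D] with [J -> 0]. Gronwall on
    the skew part gives symmetry, a perturbed first-null-vector argument gives [J <= 0], and
    Cauchy-Schwarz between [w] and [N w] turns smallness of [J] into [N -> -oo]. The exponent [A(t)]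
    grows linearly while the supersolution property asks for [A <= 2 A0], which limits one
    comparison to a time [tau]. The inequality reached is free of [eps], so it restarts the
    comparison and all times are covered. *)

Module MatrixInverse.
Import ssreflect ssrfun ssrbool eqtype ssrnat fintype bigop ssralg matrix Rstruct.
Import GRing.Theory.
Local Open Scope ring_scope.

Lemma sumR_bigop m (f : nat -> R) : sumR m f = \sum_(k < m) f k.
Proof. by elim: m => [|m IH]; rewrite ?big_ord0 //= big_ord_recr IH. Qed.

(** One-sided inverses of square matrices are two-sided: the claim is transported to MathComp
    matrices, where it is [mulmx1C]. [is_inverse] only records [N J = I], while differentiating and
    estimating [J] also uses [J N = I]. *)
Lemma is_inverse_comm m (A B : mat) : is_inverse m A B -> is_inverse m B A.
Proof.
have key (X Y : mat) : is_inverse m X Y <->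
  (\matrix_(i < m, j < m) X i j) *m (\matrix_(i < m, j < m) Y i j) = 1%:M :> 'M[R]_m.
  split=> [H | /matrixP H i j /ltP Hi /ltP Hj].
    apply/matrixP=> i j; rewrite !mxE.
    have := H i j (elimT ltP (ltn_ord i)) (elimT ltP (ltn_ord j)).
    rewrite /mmul sumR_bigop /idm; under eq_bigr do rewrite -[Rmult _ _]/(_ * _ : R).
    move=> E; under eq_bigr do rewrite !mxE; rewrite E.
    by case: PeanoNat.Nat.eq_dec => /= [/val_inj->|/eqP/negbTE ne]; rewrite ?eqxx // -val_eqE ne.
  have := H (Ordinal Hi) (Ordinal Hj); rewrite !mxE /mmul sumR_bigop /idm.
  under eq_bigr do rewrite !mxE /=. move=> ->.
  by case: PeanoNat.Nat.eq_dec => /= [E|/eqP/negbTE ne]; rewrite -val_eqE /= ?E ?eqxx ?ne.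
by move=> /key/mulmx1C/key.
Qed.
End MatrixInverse.

(** * Finite sums, dot products and quadratic forms *)

Lemma sumR_ext m f g : (forall i, (i < m)%nat -> f i = g i) -> sumR m f = sumR m g.
Proof. induction m; simpl; intros H; auto. rewrite IHm, H; auto. Qed.

Lemma sumR_plus m f g : sumR m (fun i => f i + g i) = sumR m f + sumR m g.
Proof. induction m; simpl; [lra|]. rewrite IHm; lra. Qed.

Lemma sumR_minus m f g : sumR m (fun i => f i - g i) = sumR m f - sumR m g.
Proof. induction m; simpl; [lra|]. rewrite IHm; lra. Qed.

Lemma sumR_scal m c f : sumR m (fun i => c * f i) = c * sumR m f.
Proof. induction m; simpl; [lra|]. rewrite IHm; lra. Qed.

Lemma sumR_le m f g : (forall i, (i < m)%nat -> f i <= g i) -> sumR m f <= sumR m g.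
Proof.
induction m; simpl; intros H; [lra|].
apply Rplus_le_compat; [apply IHm; auto | apply H; lia].
Qed.

Lemma sumR_const m c : sumR m (fun _ => c) = INR m * c.
Proof. induction m; [simpl; lra|]. rewrite S_INR; simpl sumR. rewrite IHm; lra. Qed.

Lemma sumR_0 m f : (forall i, (i < m)%nat -> f i = 0) -> sumR m f = 0.
Proof. intros H. rewrite (sumR_ext m f (fun _ => 0) H), sumR_const; lra. Qed.

Lemma sumR_pos m f : (forall i, (i < m)%nat -> 0 <= f i) -> 0 <= sumR m f.
Proof. intros H. rewrite <- (sumR_0 m (fun _ => 0)); auto. apply sumR_le; auto. Qed.

Lemma sumR_swap m p f :
  sumR m (fun i => sumR p (fun j => f i j)) = sumR p (fun j => sumR m (fun i => f i j)).
Proof.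
induction m; simpl; [symmetry; apply sumR_0; auto|].
rewrite IHm, <- sumR_plus; auto.
Qed.

Lemma sumR_split n m f : sumR (n + m) f = sumR n f + sumR m (fun i => f (n + i)%nat).
Proof.
induction m; simpl; [rewrite Nat.add_0_r; lra|].
rewrite Nat.add_succ_r; simpl; rewrite IHm; lra.
Qed.

Lemma sumR_double n f : sumR (2 * n) f = sumR n f + sumR n (fun i => f (n + i)%nat).
Proof. replace (2 * n)%nat with (n + n)%nat by lia. apply sumR_split. Qed.

Lemma sumR_delta m j f : (j < m)%nat ->
  sumR m (fun i => if Nat.eq_dec i j then f i else 0) = f j.
Proof.
intros H. induction m; [lia|]; simpl.
destruct (Nat.eq_dec m j) as [->|Hn].
- rewrite sumR_0; [lra|]. intros i Hi. destruct (Nat.eq_dec i j); auto; lia.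
- rewrite IHm; [lra|lia].
Qed.

Lemma sumR_term m f i : (forall j, (j < m)%nat -> 0 <= f j) -> (i < m)%nat -> f i <= sumR m f.
Proof.
intros H Hi. rewrite <- (sumR_delta m i f Hi). apply sumR_le.
intros j Hj. destruct (Nat.eq_dec j i); [lra|auto].
Qed.

Lemma sumR_abs m f : Rabs (sumR m f) <= sumR m (fun i => Rabs (f i)).
Proof.
induction m; simpl; [rewrite Rabs_R0; lra|].
eapply Rle_trans; [apply Rabs_triang|lra].
Qed.

Lemma sumR_abs_le m f c : (forall i, (i < m)%nat -> Rabs (f i) <= c) -> Rabs (sumR m f) <= INR m * c.
Proof.
intros H. eapply Rle_trans; [apply sumR_abs|]. rewrite <- sumR_const. apply sumR_le; auto.
Qed.

Lemma sumR_lim m (f : nat -> nat -> R) (l : nat -> R) :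
  (forall i, (i < m)%nat -> is_lim_seq (fun k => f k i) (l i)) ->
  is_lim_seq (fun k => sumR m (f k)) (sumR m l).
Proof.
induction m; simpl; intros H; [apply is_lim_seq_const|].
apply (is_lim_seq_plus' _ _ (sumR m l) (l m)); auto.
Qed.

Lemma sumR_is_derive m (f : R -> nat -> R) (l : nat -> R) (x : R) :
  (forall i, (i < m)%nat -> is_derive (fun s => f s i) x (l i)) ->
  is_derive (fun s => sumR m (f s)) x (sumR m l).
Proof.
induction m; simpl; intros H; [apply @is_derive_const|].
apply (is_derive_plus (fun s => sumR m (f s)) (fun s => f s m)); auto.
Qed.

Definition dot m (a b : nat -> R) := sumR m (fun i => a i * b i).
Definition mv m (A : mat) (x : nat -> R) : nat -> R := fun i => sumR m (fun j => A i j * x j).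
Definition vadd (z w : nat -> R) (s : R) : nat -> R := fun i => z i + s * w i.

Lemma dot_comm m a b : dot m a b = dot m b a.
Proof. apply sumR_ext; intros; lra. Qed.

Lemma dot_self_ge0 m a : 0 <= dot m a a.
Proof. apply sumR_pos; intros; nra. Qed.

Lemma dot_ext m a a' b b' : (forall i, (i < m)%nat -> a i = a' i) ->
  (forall i, (i < m)%nat -> b i = b' i) -> dot m a b = dot m a' b'.
Proof. intros H H'. apply sumR_ext; intros i Hi. rewrite H, H'; auto. Qed.

Lemma dot_vadd_l m a b c s : dot m (vadd a b s) c = dot m a c + s * dot m b c.
Proof.
unfold dot, vadd. rewrite <- sumR_scal, <- sumR_plus. apply sumR_ext; intros; lra.
Qed.

Lemma dot_vadd_r m a b c s : dot m c (vadd a b s) = dot m c a + s * dot m c b.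
Proof. rewrite !(dot_comm m c). apply dot_vadd_l. Qed.

Lemma dot_scal_l m c a b : dot m (fun i => c * a i) b = c * dot m a b.
Proof. unfold dot. rewrite <- sumR_scal. apply sumR_ext; intros; lra. Qed.

Lemma coord_sq_le m a i : (i < m)%nat -> a i ^ 2 <= dot m a a.
Proof.
intros H. eapply Rle_trans; [|apply (sumR_term m (fun i => a i * a i) i)]; auto; intros; nra.
Qed.

Lemma dot_self_0 m a : dot m a a = 0 -> forall i, (i < m)%nat -> a i = 0.
Proof. intros H i Hi. generalize (coord_sq_le m a i Hi). rewrite H. nra. Qed.

Lemma quad_dot m A x : quad m A x = dot m x (mv m A x).
Proof.
unfold quad, dot, mv. apply sumR_ext; intros i _. rewrite <- sumR_scal.
apply sumR_ext; intros; lra.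
Qed.

Lemma quad_ext m A B x y : (forall i j, (i < m)%nat -> (j < m)%nat -> A i j = B i j) ->
  (forall i, (i < m)%nat -> x i = y i) -> quad m A x = quad m B y.
Proof.
intros H H'. apply sumR_ext; intros i Hi. apply sumR_ext; intros j Hj.
rewrite H, !H'; auto.
Qed.

Lemma quad_scal m A x c : quad m A (fun i => c * x i) = c ^ 2 * quad m A x.
Proof.
unfold quad. rewrite <- sumR_scal. apply sumR_ext; intros i _.
rewrite <- sumR_scal. apply sumR_ext; intros; ring.
Qed.

Lemma quad_null m A x : dot m x x = 0 -> quad m A x = 0.
Proof.
intros E. apply sumR_0; intros i Hi. apply sumR_0; intros j Hj.
rewrite (dot_self_0 m x E i Hi). ring.
Qed.

(** Both sides scale quadratically. This reduction lets the maximum principles for matrices run over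
    the unit sphere, where touching points stay bounded. *)
Lemma quad_le_of_unit m A (c : R) :
  (forall x, dot m x x = 1 -> quad m A x <= c) -> forall x, quad m A x <= c * dot m x x.
Proof.
intros H x. destruct (Req_dec (dot m x x) 0) as [E|E]; [rewrite (quad_null m A x E), E; lra|].
assert (P : 0 < dot m x x) by (generalize (dot_self_ge0 m x); lra).
assert (Hs := sqrt_lt_R0 _ P). assert (Hss := sqrt_sqrt _ (Rlt_le _ _ P)).
set (q := sqrt (dot m x x)) in *.
assert (G := H (fun i => / q * x i)). rewrite dot_scal_l, dot_comm, dot_scal_l, quad_scal, <- Hss in G.
assert (G' : (/ q) ^ 2 * quad m A x <= c) by (apply G; field; lra).
apply (Rmult_le_compat_l (q * q)) in G'; [|nra].
replace (q * q * ((/ q) ^ 2 * quad m A x)) with (quad m A x) in G' by (field; lra). rewrite <- Hss. lra.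
Qed.

Lemma quad_scal_mat m A x c : quad m (fun i j => c * A i j) x = c * quad m A x.
Proof.
unfold quad. rewrite <- sumR_scal. apply sumR_ext; intros i _.
rewrite <- sumR_scal. apply sumR_ext; intros; ring.
Qed.

Lemma quad_plus_mat m A B x : quad m (fun i j => A i j + B i j) x = quad m A x + quad m B x.
Proof.
unfold quad. rewrite <- sumR_plus. apply sumR_ext; intros i _.
rewrite <- sumR_plus. apply sumR_ext; intros; ring.
Qed.

Lemma dot_mv_sym m A x y : (forall i j, (i < m)%nat -> (j < m)%nat -> A i j = A j i) ->
  dot m x (mv m A y) = dot m y (mv m A x).
Proof.
intros H. unfold dot, mv.
transitivity (sumR m (fun i => sumR m (fun j => x i * (A i j * y j)))).
{ apply sumR_ext; intros; rewrite sumR_scal; auto. }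
rewrite sumR_swap. apply sumR_ext; intros j Hj. rewrite <- sumR_scal.
apply sumR_ext; intros i Hi. rewrite (H i j); auto. ring.
Qed.

Lemma mv_vadd m A x y s i : mv m A (vadd x y s) i = mv m A x i + s * mv m A y i.
Proof.
unfold mv, vadd. rewrite <- sumR_scal, <- sumR_plus. apply sumR_ext; intros; ring.
Qed.

Lemma quad_vadd m A x y s : (forall i j, (i < m)%nat -> (j < m)%nat -> A i j = A j i) ->
  quad m A (vadd x y s) = quad m A x + 2 * s * dot m y (mv m A x) + s ^ 2 * quad m A y.
Proof.
intros H. rewrite !quad_dot.
rewrite (dot_ext m (vadd x y s) (vadd x y s) _ (vadd (mv m A x) (mv m A y) s));
  [|auto|intros; apply mv_vadd].
rewrite dot_vadd_l, !dot_vadd_r, (dot_mv_sym m A x y H). ring.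
Qed.

Lemma dot_cauchy m a b : dot m a b ^ 2 <= dot m a a * dot m b b.
Proof.
assert (H : forall s, 0 <= dot m a a + 2 * s * dot m a b + s ^ 2 * dot m b b).
{ intros s. generalize (dot_self_ge0 m (vadd a b s)).
  rewrite dot_vadd_l, !dot_vadd_r, (dot_comm m b a). lra. }
destruct (Req_dec (dot m b b) 0) as [E|E].
- assert (F : dot m a b = 0).
  { apply sumR_0. intros i Hi. simpl. rewrite (dot_self_0 m b E i Hi). ring. }
  rewrite F, E; lra.
- generalize (dot_self_ge0 m b); intros P.
  specialize (H (- dot m a b / dot m b b)).
  replace (dot m a a + 2 * (- dot m a b / dot m b b) * dot m a b +
    (- dot m a b / dot m b b) ^ 2 * dot m b b)
    with ((dot m a a * dot m b b - dot m a b ^ 2) / dot m b b) in H by (field; auto).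
  apply Rnot_lt_le; intros C.
  assert (0 < / dot m b b) by (apply Rinv_0_lt_compat; lra).
  unfold Rdiv in H. nra.
Qed.

Lemma dot_sq_add_le m a b : dot m (vadd a b 1) (vadd a b 1) <= 2 * dot m a a + 2 * dot m b b.
Proof.
unfold dot. rewrite <- !sumR_scal, <- sumR_plus. apply sumR_le; intros i _. unfold vadd.
generalize (Rle_0_sqr (a i - b i)); unfold Rsqr; nra.
Qed.

Lemma upd_same z i : upd z i (z i) = z.
Proof.
apply functional_extensionality; intros j. unfold upd. destruct (Nat.eq_dec j i); congruence.
Qed.

Lemma upd_upd z i s r : upd (upd z i s) i r = upd z i r.
Proof.
apply functional_extensionality; intros j. unfold upd. destruct (Nat.eq_dec j i); auto.
Qed.

Lemma upd_eq z i s : upd z i s i = s.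
Proof. unfold upd. destruct (Nat.eq_dec i i); congruence. Qed.

Lemma upd_neq z i s j : j <> i -> upd z i s j = z j.
Proof. unfold upd. destruct (Nat.eq_dec j i); congruence. Qed.

Lemma upd_vadd z w c i s : vadd (upd z i s) w c = upd (vadd z w c) i (s + c * w i).
Proof.
apply functional_extensionality; intros j. unfold upd, vadd.
destruct (Nat.eq_dec j i); subst; auto.
Qed.

Lemma upd_vadd_r z w c i s : vadd z (upd w i s) c = upd (vadd z w c) i (z i + c * s).
Proof.
apply functional_extensionality; intros j. unfold upd, vadd.
destruct (Nat.eq_dec j i); subst; auto.
Qed.

(** * Compactness *)

Lemma inv_INR_lim : is_lim_seq (fun k => / (INR k + 1)) 0.
Proof.
replace (Finite 0) with (Rbar_inv p_infty) by auto.
apply is_lim_seq_inv; [|discriminate].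
generalize (proj1 (is_lim_seq_incr_1 INR p_infty) is_lim_seq_INR); intros H.
eapply is_lim_seq_ext; [|exact H]. intros k. exact (S_INR k).
Qed.

Lemma inv_succ_bounds k : 0 < / (INR k + 1) <= 1.
Proof.
generalize (pos_INR k); intros. split; [apply Rinv_0_lt_compat; lra|].
rewrite <- Rinv_1. apply Rinv_le_contravar; lra.
Qed.

Lemma lim_le (u v : nat -> R) (a b : R) :
  (forall k, u k <= v k) -> is_lim_seq u a -> is_lim_seq v b -> a <= b.
Proof. intros H Hu Hv. exact (is_lim_seq_le u v a b H Hu Hv). Qed.

Lemma lim_interval (u : nat -> R) (l s T : R) :
  (forall k, s <= u k <= T) -> is_lim_seq u l -> s <= l <= T.
Proof.
intros H L. split; [apply (lim_le (fun _ => s) u)|apply (lim_le u (fun _ => T))]; auto;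
  try apply is_lim_seq_const; intros k; apply H.
Qed.

Lemma lim_approach (t a : R) : is_lim_seq (fun k => t + a * / (INR k + 1)) t.
Proof.
replace (Finite t) with (Finite (t + a * 0)) by (f_equal; ring).
apply is_lim_seq_plus'; [apply is_lim_seq_const|].
apply is_lim_seq_mult'; [apply is_lim_seq_const|apply inv_INR_lim].
Qed.

(** The sample times [t + (s - t) / (k + 1)] start at [s] and increase to [t], so all of them lie
    where [f] is positive. *)
Lemma left_limit_nonneg (f : R -> R) (s t : R) : s < t -> (forall r, s <= r < t -> 0 < f r) ->
  is_lim_seq (fun k => f (t + (s - t) * / (INR k + 1))) (f t) -> 0 <= f t.
Proof.
intros Hst H L. apply (lim_le (fun _ => 0) (fun k => f (t + (s - t) * / (INR k + 1)))); auto.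
- intros k. left. apply H. generalize (inv_succ_bounds k). nra.
- apply is_lim_seq_const.
Qed.

Lemma lim_of_abs (x : nat -> R) (l : R) : (forall k, Rabs (x k - l) <= / (INR k + 1)) -> is_lim_seq x l.
Proof.
intros H.
apply (is_lim_seq_le_le (fun k => l - / (INR k + 1)) _ (fun k => l + / (INR k + 1))).
- intros k. specialize (H k). apply Rabs_le_between in H. lra.
- apply (is_lim_seq_ext (fun k => l + -1 * / (INR k + 1))); [intros; ring|apply lim_approach].
- apply (is_lim_seq_ext (fun k => l + 1 * / (INR k + 1))); [intros; ring|apply lim_approach].
Qed.

Lemma subseq_extract (P : nat -> nat -> Prop) :
  (forall k N, exists p, (N <= p)%nat /\ P k p) ->
  exists sg : nat -> nat, (forall k, (sg k < sg (S k))%nat) /\ forall k, P k (sg k).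
Proof.
intros H.
pose (f := fun k N => proj1_sig (constructive_indefinite_description _ (H k N))).
assert (Hf : forall k N, (N <= f k N)%nat /\ P k (f k N)).
{ intros k N. unfold f. apply proj2_sig. }
exists (nat_rect (fun _ => nat) (f O O) (fun k r => f (S k) (S r))).
split.
- intros k; simpl. apply Hf.
- intros [|k]; simpl; apply Hf.
Qed.

Lemma bounded_subseq_R (x : nat -> R) (b : R) : (forall k, Rabs (x k) <= b) ->
  exists (sg : nat -> nat) (l : R), (forall k, (sg k < sg (S k))%nat) /\
    is_lim_seq (fun k => x (sg k)) l.
Proof.
intros H.
destruct (Bolzano_Weierstrass x _ (compact_P3 (- b) b)) as [l Hl].
{ intros k. apply Rabs_le_between, H. }
destruct (subseq_extract (fun k p => Rabs (x p - l) < / (INR k + 1))) as [sg [Hs Hsg]].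
{ intros k N.
  assert (Hp := proj1 (inv_succ_bounds k)).
  destruct (Hl (fun y => Rabs (y - l) < / (INR k + 1)) N) as [p Hp'].
  - exists (mkposreal _ Hp). intros y Hy. exact Hy.
  - exists p; auto. }
exists sg, l; split; auto.
apply lim_of_abs. intros k. left. apply Hsg.
Qed.

Lemma bounded_subseq m (p : nat -> nat -> R) (b : R) :
  (forall k i, (i < m)%nat -> Rabs (p k i) <= b) ->
  exists (sg : nat -> nat) (l : nat -> R), (forall k, (sg k < sg (S k))%nat) /\
    forall i, (i < m)%nat -> is_lim_seq (fun k => p (sg k) i) (l i).
Proof.
induction m; intros H.
- exists (fun k => k), (fun _ => 0). split; [intros; lia|intros; lia].
- destruct IHm as [sg [l [Hs Hl]]]; [intros; apply H; lia|].
  destruct (bounded_subseq_R (fun k => p (sg k) m) b) as [sg' [l' [Hs' Hl']]].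
  { intros; apply H; lia. }
  exists (fun k => sg (sg' k)), (fun i => if Nat.eq_dec i m then l' else l i).
  split.
  + intros k. specialize (Hs' k).
    assert (Mono : forall a b, (a < b)%nat -> (sg a < sg b)%nat).
    { intros a c Hac. induction Hac; [apply Hs|]. specialize (Hs m0). lia. }
    apply Mono; auto.
  + intros i Hi. destruct (Nat.eq_dec i m) as [->|Hn]; auto.
    apply (is_lim_seq_subseq (fun k => p (sg k) i)); [apply eventually_subseq; auto|].
    apply Hl; lia.
Qed.

(** Common engine of the maximum principles below, for matrices, for Gaussians and for the convexity
    gap: if the bad set is closed and its points are bounded, the infimum of the bad times is
    attained. The infimum is obtained as a supremum of [- t], the form that [completeness] provides.
    Closedness concerns the first [m] coordinates only, so the limit point may be arbitrary in the
    others. *)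
Lemma first_bad m (Bad : R -> (nat -> R) -> Prop) (s T b : R) :
  (forall t p, s <= t <= T -> Bad t p -> forall i, (i < m)%nat -> Rabs (p i) <= b) ->
  (forall tk t (pk : nat -> nat -> R) (p : nat -> R),
     (forall k, s <= tk k <= T /\ Bad (tk k) (pk k)) -> is_lim_seq tk (Finite t) ->
     (forall i, (i < m)%nat -> is_lim_seq (fun k => pk k i) (p i)) -> Bad t p) ->
  (forall p, ~ Bad s p) ->
  forall t0 p0, s <= t0 <= T -> Bad t0 p0 ->
  exists t p, s < t <= T /\ Bad t p /\ forall t' p', s <= t' < t -> ~ Bad t' p'.
Proof.
intros Hb Hc Hs t0 p0 Ht0 Hbad.
destruct (completeness (fun x => s <= - x <= T /\ exists p, Bad (- x) p)) as [sup [Hup Hlub]].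
{ exists (- s). intros x [Hx _]. lra. }
{ exists (- t0). rewrite Ropp_involutive. split; auto. exists p0; auto. }
assert (Hseq : forall k : nat, exists tp : R * (nat -> R),
  s <= fst tp <= T /\ Bad (fst tp) (snd tp) /\ - sup <= fst tp < - sup + / (INR k + 1)).
{ intros k.
  assert (Hp := proj1 (inv_succ_bounds k)).
  destruct (classic (exists x, sup - / (INR k + 1) < x /\ s <= - x <= T /\ exists p, Bad (- x) p))
    as [[x [Hx [Hx1 [p Hp']]]]|Hn].
  - exists (- x, p); simpl. split; [lra|split; auto]. split; [|lra].
    specialize (Hup x). assert (x <= sup); [|lra]. apply Hup. split; auto. exists p; auto.
  - exfalso. assert (sup <= sup - / (INR k + 1)); [|lra].
    apply Hlub. intros x Hx. apply Rnot_lt_le; intros Hlt. apply Hn. exists x; auto. }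
destruct (choice _ Hseq) as [tp Htp].
destruct (bounded_subseq m (fun k => snd (tp k)) b) as [sg [l [Hsg Hl]]].
{ intros k i Hi. destruct (Htp k) as [? [? ?]]. eapply Hb; eauto. }
assert (Hlim : is_lim_seq (fun k => fst (tp (sg k))) (- sup)).
{ apply (is_lim_seq_subseq (fun k => fst (tp k))); [apply eventually_subseq; auto|].
  apply (is_lim_seq_le_le (fun _ => - sup) _ (fun k => - sup + / (INR k + 1))).
  - intros k. destruct (Htp k) as [_ [_ ?]]. lra.
  - apply is_lim_seq_const.
  - apply (is_lim_seq_ext (fun k => - sup + 1 * / (INR k + 1))); [intros; ring|apply lim_approach]. }
assert (HB : Bad (- sup) l).
{ apply (Hc (fun k => fst (tp (sg k))) _ (fun k => snd (tp (sg k)))); auto.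
  intros k. destruct (Htp (sg k)) as [? [? ?]]; auto. }
assert (Hst : s <= - sup <= T).
{ split.
  - assert (sup <= - s); [|lra]. apply Hlub. intros x [Hx _]; lra.
  - assert (- t0 <= sup); [|lra]. apply Hup. rewrite Ropp_involutive. split; auto. exists p0; auto. }
exists (- sup), l. repeat split; auto; try lra.
- destruct (proj1 Hst) as [?|E]; auto. exfalso. apply (Hs l). rewrite E; auto.
- intros t' p' Ht' HB'.
  assert (- t' <= sup); [|lra]. apply Hup. rewrite Ropp_involutive. split; [lra|]. exists p'; auto.
Qed.

(** * One-variable calculus *)

Lemma der_ext (f g : R -> R) (x l l' : R) : (forall s, f s = g s) -> l = l' -> is_derive f x l -> is_derive g x l'.
Proof. intros H -> H'. eapply is_derive_ext; eauto. Qed.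

Lemma der_plus (f g : R -> R) (x a b : R) : is_derive f x a -> is_derive g x b -> is_derive (fun s => f s + g s) x (a + b).
Proof. intros; apply @is_derive_plus; auto. Qed.

Lemma der_minus (f g : R -> R) (x a b : R) : is_derive f x a -> is_derive g x b -> is_derive (fun s => f s - g s) x (a - b).
Proof. intros; apply @is_derive_minus; auto. Qed.

Lemma der_mult (f g : R -> R) (x a b : R) : is_derive f x a -> is_derive g x b -> is_derive (fun s => f s * g s) x (a * g x + f x * b).
Proof. intros; apply @is_derive_mult; auto. intros; apply Rmult_comm. Qed.

Lemma der_scal (f : R -> R) (c x a : R) : is_derive f x a -> is_derive (fun s => c * f s) x (c * a).
Proof. intros; apply @is_derive_scal; auto. Qed.

Lemma der_comp (f g : R -> R) (x a b : R) : is_derive f (g x) a -> is_derive g x b -> is_derive (fun s => f (g s)) x (a * b).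
Proof. intros H H'. rewrite Rmult_comm. apply @is_derive_comp; auto. Qed.

Lemma der_exp (f : R -> R) (x a : R) : is_derive f x a -> is_derive (fun s => exp (f s)) x (exp (f x) * a).
Proof. intros. apply der_comp; auto. apply is_derive_exp. Qed.

Lemma der_const c x : is_derive (fun _ : R => c) x 0.
Proof. apply @is_derive_const. Qed.

Lemma der_id x : is_derive (fun s : R => s) x 1.
Proof. apply @is_derive_id. Qed.

Lemma der_cont (f : R -> R) (x a : R) : is_derive f x a -> continuity_pt f x.
Proof. intros H. apply derivable_continuous_pt. exists a. apply is_derive_Reals; auto. Qed.

Lemma der_eps (f : R -> R) (x a : R) : is_derive f x a -> forall eps, 0 < eps ->
  exists d, 0 < d /\ forall h, Rabs h < d -> h <> 0 -> Rabs ((f (x + h) - f x) / h - a) < eps.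
Proof.
intros H eps He. apply is_derive_Reals in H. destruct (H eps He) as [d Hd].
exists d; split; [apply cond_pos|]. intros; apply Hd; auto.
Qed.

(** One-sided on purpose: a first touching time compares only with earlier times. *)
Lemma left_min_deriv (f : R -> R) (x a d : R) : is_derive f x a -> 0 < d ->
  (forall s, x - d < s < x -> f x <= f s) -> a <= 0.
Proof.
intros H Hd Hf. apply Rnot_lt_le; intros Ha.
destruct (der_eps f x a H a Ha) as [e [He Hq]].
set (k := Rmin d e / 2).
assert (Hk : 0 < k < Rmin d e).
{ assert (0 < Rmin d e) by (apply Rmin_glb_lt; auto). unfold k; lra. }
assert (k < d) by (eapply Rlt_le_trans; [apply Hk|apply Rmin_l]).
assert (k < e) by (eapply Rlt_le_trans; [apply Hk|apply Rmin_r]).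
specialize (Hq (- k)). specialize (Hf (x - k)).
assert (Hq' : Rabs ((f (x + - k) - f x) / - k - a) < a).
{ apply Hq; [rewrite Rabs_Ropp, Rabs_right; lra|lra]. }
apply Rabs_lt_between in Hq'. replace (x + - k) with (x - k) in Hq' by lra.
assert (f x <= f (x - k)) by (apply Hf; lra).
replace ((f (x - k) - f x) / - k) with (- ((f (x - k) - f x) * / k)) in Hq' by (field; lra).
assert (0 < / k) by (apply Rinv_0_lt_compat; lra). nra.
Qed.

Lemma right_min_deriv (f : R -> R) (x a d : R) : is_derive f x a -> 0 < d ->
  (forall s, x < s < x + d -> f x <= f s) -> 0 <= a.
Proof.
intros H Hd Hf.
assert (H' : is_derive (fun s => f (- s)) (- x) (a * - 1)).
{ apply der_comp; [rewrite Ropp_involutive; auto|].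
  apply (der_ext (fun s => -1 * s) _ _ (-1 * 1)); [intros; lra|lra|]. apply der_scal, der_id. }
assert (a * -1 <= 0); [|lra].
apply (left_min_deriv _ _ _ d H' Hd). intros s Hs. rewrite Ropp_involutive. apply Hf; lra.
Qed.

Lemma min_deriv (f : R -> R) (x a d : R) : is_derive f x a -> 0 < d ->
  (forall s, x - d < s < x + d -> f x <= f s) -> a = 0.
Proof.
intros H Hd Hf. apply Rle_antisym.
- apply (left_min_deriv f x a d); auto. intros; apply Hf; lra.
- apply (right_min_deriv f x a d); auto. intros; apply Hf; lra.
Qed.

(** Since [f' x = 0], a negative second derivative would make [f'] negative just to the right of
    [x], and the mean value theorem would make [f] drop below [f x]. *)
Lemma min_deriv2 (f f' : R -> R) (x a d : R) : 0 < d ->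
  (forall s, x - d < s < x + d -> is_derive f s (f' s)) -> is_derive f' x a ->
  (forall s, x - d < s < x + d -> f x <= f s) -> 0 <= a.
Proof.
intros Hd H H' Hf.
assert (E : f' x = 0).
{ apply (min_deriv f x (f' x) d); auto. apply H; lra. }
apply Rnot_lt_le; intros Ha.
destruct (der_eps f' x a H' (- a)) as [e [He Hq]]; [lra|].
set (k := Rmin d e / 2).
assert (Hk : 0 < k < Rmin d e).
{ assert (0 < Rmin d e) by (apply Rmin_glb_lt; auto). unfold k; lra. }
assert (k < d) by (eapply Rlt_le_trans; [apply Hk|apply Rmin_l]).
assert (k < e) by (eapply Rlt_le_trans; [apply Hk|apply Rmin_r]).
destruct (MVT_cor2 f f' x (x + k)) as [c [Hc1 Hc2]]; [lra| |].
{ intros c Hc. apply is_derive_Reals, H; lra. }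
assert (f x <= f (x + k)) by (apply Hf; lra).
assert (Hq' : Rabs ((f' (x + (c - x)) - f' x) / (c - x) - a) < - a).
{ apply Hq; [rewrite Rabs_right; lra|lra]. }
apply Rabs_lt_between in Hq'. replace (x + (c - x)) with c in Hq' by lra.
rewrite E in Hq'. unfold Rdiv in Hq'.
assert (0 < / (c - x)) by (apply Rinv_0_lt_compat; lra).
assert (0 <= f' c) by nra. nra.
Qed.

(** * Partial derivatives and continuity in the first m coordinates *)

(** Derivatives are carried as explicit functions, so that calculations never meet the arbitrary
    value that [partial] takes where no derivative exists. *)
Definition Dp i (f f' : (nat -> R) -> R) := forall z, is_derive (fun s => f (upd z i s)) (z i) (f' z).

(** Convergence is required in the first [m] coordinates only. Constant sequences then show that [f]
    ignores all further coordinates, which is [scont_indep]. *)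
Definition scont m (f : (nat -> R) -> R) := forall (zk : nat -> nat -> R) (z : nat -> R),
  (forall i, (i < m)%nat -> is_lim_seq (fun k => zk k i) (z i)) ->
  is_lim_seq (fun k => f (zk k)) (f z).

Lemma Dp_at i f f' z s : Dp i f f' -> is_derive (fun s => f (upd z i s)) s (f' (upd z i s)).
Proof.
intros H. specialize (H (upd z i s)). rewrite upd_eq in H.
eapply is_derive_ext; [|exact H]. intros; simpl. rewrite upd_upd; auto.
Qed.

Lemma scont_indep m f z w : scont m f -> (forall i, (i < m)%nat -> z i = w i) -> f z = f w.
Proof.
intros H E. assert (L : is_lim_seq (fun _ => f z) (f w)).
{ apply (H (fun _ => z)). intros i Hi. rewrite E; auto. apply is_lim_seq_const. }
apply is_lim_seq_unique in L. rewrite Lim_seq_const in L. congruence.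
Qed.

Lemma scont_eps m f z eps : scont m f -> 0 < eps ->
  exists d, 0 < d /\ forall w, (forall i, (i < m)%nat -> Rabs (w i - z i) < d) -> Rabs (f w - f z) < eps.
Proof.
intros H He. apply NNPP; intros Hn.
assert (Hk : forall k : nat, exists w, (forall i, (i < m)%nat -> Rabs (w i - z i) < / (INR k + 1)) /\
  eps <= Rabs (f w - f z)).
{ intros k. apply NNPP; intros Hk. apply Hn. exists (/ (INR k + 1)). split.
  - apply inv_succ_bounds.
  - intros w Hw. apply Rnot_le_lt; intros Hle. apply Hk. exists w; auto. }
destruct (choice _ Hk) as [w Hw].
assert (L : is_lim_seq (fun k => f (w k)) (f z)).
{ apply H. intros i Hi. apply lim_of_abs. intros k. left. apply (Hw k); auto. }
apply is_lim_seq_spec in L. destruct (L (mkposreal _ He)) as [N HN].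
specialize (HN N (Nat.le_refl _)). simpl in HN. destruct (Hw N). lra.
Qed.

(** Chain rule from continuous partial derivatives: the increment is telescoped over coordinates,
    and each one-coordinate increment is handled by the mean value theorem and continuity of
    [f1 j]. *)
Lemma line_deriv m f f1 : (forall i, (i < m)%nat -> Dp i f (f1 i)) -> (forall i, (i < m)%nat -> scont m (f1 i)) ->
  scont m f -> forall z w s, is_derive (fun s => f (vadd z w s)) s (sumR m (fun i => w i * f1 i (vadd z w s))).
Proof.
intros HD HC H0 z w s0.
set (p := vadd z w s0).
(* [pj j r] has moved only the coordinates below [j]; it interpolates between the fixed point [p]
   and the point of the line at parameter [s0 + r]. *)
set (pj := fun j (r : R) i => if Nat.ltb i j then p i + r * w i else p i).
assert (Hj : forall j, (j <= m)%nat -> is_derive (fun r => f (pj j r)) 0 (sumR j (fun i => w i * f1 i p))).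
{ induction j; intros Hjm; simpl.
  - apply (der_ext (fun _ => f p) _ _ 0); [intros r; reflexivity|auto|apply der_const].
  - eapply (der_ext (fun r => f (pj j r) + (f (pj (S j) r) - f (pj j r)))); [intros; simpl; lra|reflexivity|].
    apply der_plus; [apply IHj; lia|].
    apply is_derive_Reals. intros eps He.
    destruct (scont_eps m (f1 j) p (eps / (Rabs (w j) + 1)) (HC j Hjm)) as [d [Hd Hf]].
    { apply Rdiv_lt_0_compat; auto. generalize (Rabs_pos (w j)); lra. }
    set (W := sumR m (fun i => Rabs (w i)) + 1).
    assert (HWi : forall i, (i < m)%nat -> Rabs (w i) < W).
    { intros i Hi. unfold W. generalize (sumR_term m (fun i => Rabs (w i)) i); intros G.
      assert (Rabs (w i) <= sumR m (fun i => Rabs (w i))); [|lra]. apply G; auto. intros; apply Rabs_pos. }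
    assert (HW : 0 < W). { unfold W. assert (0 <= sumR m (fun i => Rabs (w i))) by (apply sumR_pos; intros; apply Rabs_pos). lra. }
    assert (Hd' : 0 < d / W) by (apply Rdiv_lt_0_compat; auto).
    exists (mkposreal _ Hd'). intros h Hh Hhd; simpl in Hhd. rewrite Rplus_0_l.
    assert (E0 : pj (S j) 0 = pj j 0).
    { apply functional_extensionality; intros i. unfold pj. destruct (Nat.ltb i (S j)), (Nat.ltb i j); lra. }
    assert (Eh : forall r, pj (S j) r = upd (pj j r) j (p j + r * w j)).
    { intros r. apply functional_extensionality; intros i. unfold pj, upd.
      destruct (Nat.eq_dec i j) as [->|Hne].
      - replace (Nat.ltb j (S j)) with true by (symmetry; apply Nat.ltb_lt; lia). auto.
      - destruct (Nat.ltb i j) eqn:E1, (Nat.ltb i (S j)) eqn:E2; auto;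
        apply Nat.ltb_lt in E1 || apply Nat.ltb_ge in E1; apply Nat.ltb_lt in E2 || apply Nat.ltb_ge in E2; lia. }
    assert (Ej : pj j h = upd (pj j h) j (p j)).
    { rewrite <- (upd_same (pj j h) j) at 1. f_equal. unfold pj. rewrite Nat.ltb_irrefl; auto. }
    rewrite E0, Rminus_diag, Rminus_0_r, Eh.
    destruct (MVT_gen (fun s => f (upd (pj j h) j s)) (p j) (p j + h * w j) (fun s => f1 j (upd (pj j h) j s))) as [c [Hc1 Hc2]].
    { intros x _. apply Dp_at, HD; lia. }
    { intros x _. eapply der_cont. apply Dp_at, HD; lia. }
    rewrite Ej at 2. rewrite Hc2.
    replace ((f1 j (upd (pj j h) j c) * (p j + h * w j - p j)) / h - w j * f1 j p)
      with (w j * (f1 j (upd (pj j h) j c) - f1 j p)) by (field; auto).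
    rewrite Rabs_mult.
    assert (Hb : Rabs (f1 j (upd (pj j h) j c) - f1 j p) < eps / (Rabs (w j) + 1)).
    { apply Hf. intros i Hi.
      assert (Hhw : Rabs (h * w i) < d).
      { rewrite Rabs_mult. specialize (HWi i Hi).
        apply Rle_lt_trans with (Rabs h * W).
        - apply Rmult_le_compat_l; [apply Rabs_pos|lra].
        - replace d with (d / W * W) by (field; lra). apply Rmult_lt_compat_r; auto. }
      destruct (Nat.eq_dec i j) as [->|Hne].
      - rewrite upd_eq. eapply Rle_lt_trans; [|exact Hhw].
        revert Hc1. unfold Rmin, Rmax. destruct (Rle_dec (p j) (p j + h * w j)); unfold Rabs; destruct (Rcase_abs (c - p j)), (Rcase_abs (h * w j)); lra.
      - rewrite upd_neq; auto. unfold pj. destruct (Nat.ltb i j).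
        + replace (p i + h * w i - p i) with (h * w i) by lra; auto.
        + rewrite Rminus_diag, Rabs_R0; auto. }
    generalize (Rabs_pos (w j)); intros Hw0.
    apply Rle_lt_trans with (Rabs (w j) * (eps / (Rabs (w j) + 1))); [apply Rmult_le_compat_l; lra|].
    apply Rlt_le_trans with ((Rabs (w j) + 1) * (eps / (Rabs (w j) + 1))).
    + apply Rmult_lt_compat_r; [|lra]. apply Rdiv_lt_0_compat; lra.
    + right; field; lra. }
specialize (Hj m (Nat.le_refl _)).
assert (E : forall r, f (vadd z w r) = f (pj m (r - s0))).
{ intros r. apply (scont_indep m); auto. intros i Hi. unfold pj.
  apply Nat.ltb_lt in Hi. rewrite Hi. unfold p, vadd. ring. }
apply (der_ext (fun r => f (pj m (r - s0))) _ _ (sumR m (fun i => w i * f1 i p) * 1)); [intros; auto|unfold p; lra|].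
apply (der_comp (fun x => f (pj m x)) (fun r => r - s0)); [rewrite Rminus_diag; auto|].
apply (der_ext (fun r => r - s0) _ _ (1 - 0)); [auto|lra|]. apply der_minus; [apply der_id|apply der_const].
Qed.

Lemma Dp_ext i f f' g g' : Dp i f f' -> (forall z, f z = g z) -> (forall z, f' z = g' z) -> Dp i g g'.
Proof. intros H E E' z. apply (der_ext (fun s => f (upd z i s)) _ _ (f' z)); auto. Qed.

Lemma Dp_plus i f f' g g' : Dp i f f' -> Dp i g g' -> Dp i (fun z => f z + g z) (fun z => f' z + g' z).
Proof. intros H H' z. apply (der_plus (fun s => f (upd z i s)) (fun s => g (upd z i s))); auto. Qed.

Lemma Dp_minus i f f' g g' : Dp i f f' -> Dp i g g' -> Dp i (fun z => f z - g z) (fun z => f' z - g' z).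
Proof. intros H H' z. apply (der_minus (fun s => f (upd z i s)) (fun s => g (upd z i s))); auto. Qed.

Lemma Dp_mult i f f' g g' : Dp i f f' -> Dp i g g' -> Dp i (fun z => f z * g z) (fun z => f' z * g z + f z * g' z).
Proof.
intros H H' z.
apply (der_ext (fun s => f (upd z i s) * g (upd z i s)) _ _ (f' z * g (upd z i (z i)) + f (upd z i (z i)) * g' z)).
- auto.
- rewrite upd_same; auto.
- apply (der_mult (fun s => f (upd z i s)) (fun s => g (upd z i s))); auto.
Qed.

Lemma Dp_scal i c f f' : Dp i f f' -> Dp i (fun z => c * f z) (fun z => c * f' z).
Proof. intros H z. apply (der_scal (fun s => f (upd z i s))); auto. Qed.

Lemma Dp_const i c : Dp i (fun _ => c) (fun _ => 0).
Proof. intros z. apply der_const. Qed.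

Lemma Dp_exp i f f' : Dp i f f' -> Dp i (fun z => exp (f z)) (fun z => exp (f z) * f' z).
Proof.
intros H z. apply (der_ext (fun s => exp (f (upd z i s))) _ _ (exp (f (upd z i (z i))) * f' z)); auto.
- rewrite upd_same; auto.
- apply (der_exp (fun s => f (upd z i s))); auto.
Qed.

Lemma Dp_coord i j : Dp i (fun z => z j) (fun _ => if Nat.eq_dec j i then 1 else 0).
Proof.
intros z. unfold upd. destruct (Nat.eq_dec j i); [apply der_id|apply der_const].
Qed.

Lemma Dp_sumR i m (f f' : nat -> (nat -> R) -> R) : (forall j, (j < m)%nat -> Dp i (f j) (f' j)) ->
  Dp i (fun z => sumR m (fun j => f j z)) (fun z => sumR m (fun j => f' j z)).
Proof.
intros H z. apply (sumR_is_derive m (fun s j => f j (upd z i s))). intros j Hj. apply H; auto.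
Qed.

(** * The matrix Riccati equation *)

(** This is Cauchy-Schwarz for semidefinite forms, once applied to [s -> q(x + s y)]. *)
Lemma nonneg_quadratic_disc a b c : (forall s, 0 <= a + 2 * s * b + s ^ 2 * c) -> b ^ 2 <= a * c.
Proof.
intros H. assert (Ha : 0 <= a) by (specialize (H 0); lra).
destruct (Req_dec c 0) as [->|E].
- destruct (Req_dec b 0) as [->|Eb]; [lra|].
  specialize (H (- (a + 1) / (2 * b))).
  replace (a + 2 * (- (a + 1) / (2 * b)) * b + (- (a + 1) / (2 * b)) ^ 2 * 0) with (-1) in H by (field; auto). lra.
- specialize (H (- b / c)) as H1.
  replace (a + 2 * (- b / c) * b + (- b / c) ^ 2 * c) with ((a * c - b ^ 2) / c) in H1 by (field; auto).
  assert (0 < c).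
  { apply Rnot_le_lt; intros Hc.
    assert (Hc' : c < 0) by lra.
    (* Adding the bounds at [s] and [- s] removes the linear term. This [s] is at least 1 and has
       [s * - c > a], so [a + s ^ 2 * c] would be negative. *)
    set (s := (Rabs b + a + 1) / - c + 1).
    assert (Hs0 : 0 <= (Rabs b + a + 1) / - c).
    { apply Rmult_le_pos; [generalize (Rabs_pos b); lra|]. left; apply Rinv_0_lt_compat; lra. }
    assert (Hs : s * - c = Rabs b + a + 1 - c) by (unfold s; field; lra).
    assert (P1 := H s). assert (P2 := H (- s)).
    assert (a + s ^ 2 * c >= 0) by lra.
    assert (1 <= s) by (unfold s; lra). generalize (Rabs_pos b). nra. }
  assert (0 < / c) by (apply Rinv_0_lt_compat; auto). unfold Rdiv in H1.
  apply Rnot_lt_le; intros C. nra.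
Qed.

Lemma mmul_assoc m A B C i j : mmul m (mmul m A B) C i j = mmul m A (mmul m B C) i j.
Proof.
unfold mmul.
transitivity (sumR m (fun k => sumR m (fun l => A i l * B l k * C k j))).
{ apply sumR_ext; intros k _. rewrite Rmult_comm, <- sumR_scal. apply sumR_ext; intros; ring. }
rewrite sumR_swap. apply sumR_ext; intros l _. rewrite <- sumR_scal.
apply sumR_ext; intros; ring.
Qed.

Lemma mv_mmul m A B x i : mv m (mmul m A B) x i = mv m A (mv m B x) i.
Proof.
unfold mv, mmul.
transitivity (sumR m (fun k => sumR m (fun l => A i l * B l k * x k))).
{ apply sumR_ext; intros k _. rewrite Rmult_comm, <- sumR_scal. apply sumR_ext; intros; ring. }
rewrite sumR_swap. apply sumR_ext; intros l _. rewrite <- sumR_scal.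
apply sumR_ext; intros; ring.
Qed.

Lemma mv_idm m x i : (i < m)%nat -> mv m idm x i = x i.
Proof.
intros Hi. unfold mv, idm. rewrite <- (sumR_delta m i x Hi).
apply sumR_ext; intros j _. destruct (Nat.eq_dec i j), (Nat.eq_dec j i); subst; try lra; congruence.
Qed.

Lemma dot_mv_mtr m A x y : dot m x (mv m (mtr A) y) = dot m y (mv m A x).
Proof.
unfold dot, mv, mtr.
transitivity (sumR m (fun i => sumR m (fun j => x i * (A j i * y j)))).
{ apply sumR_ext; intros; rewrite sumR_scal; auto. }
rewrite sumR_swap. apply sumR_ext; intros j Hj. rewrite <- sumR_scal.
apply sumR_ext; intros i Hi. ring.
Qed.

Lemma mv_ext m A B x y i : (forall j, (j < m)%nat -> A i j = B i j) ->
  (forall j, (j < m)%nat -> x j = y j) -> mv m A x i = mv m B y i.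
Proof. intros H H'. apply sumR_ext; intros j Hj. rewrite H, H'; auto. Qed.

Lemma mv_Cmat_x n x i : (i < n)%nat -> mv (2 * n) (Cmat n) x i = - x (n + i)%nat.
Proof.
intros Hi. unfold mv, Cmat.
transitivity (sumR (2 * n) (fun j => if Nat.eq_dec j (n + i) then - x j else 0)).
- apply sumR_ext; intros j _. replace (Nat.ltb i n) with true by (symmetry; apply Nat.ltb_lt; auto).
  simpl. destruct (Nat.eqb_spec j (i + n)), (Nat.eq_dec j (n + i)); try lia; lra.
- apply (sumR_delta (2 * n) (n + i) (fun j => - x j)); lia.
Qed.

Lemma mv_Cmat_v n x i : mv (2 * n) (Cmat n) x (n + i) = 0.
Proof.
apply sumR_0; intros j _. unfold Cmat.
replace (Nat.ltb (n + i) n) with false by (symmetry; apply Nat.ltb_ge; lia). simpl; lra.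
Qed.

Lemma mv_Dmat_x n x i : (i < n)%nat -> mv (2 * n) (Dmat n) x i = 0.
Proof.
intros Hi. apply sumR_0; intros j _. unfold Dmat.
replace (Nat.leb n i) with false by (symmetry; apply Nat.leb_gt; lia). simpl; lra.
Qed.

Lemma mv_Dmat_v n x i : (i < n)%nat -> mv (2 * n) (Dmat n) x (n + i) = 2 * x (n + i)%nat.
Proof.
intros Hi. unfold mv, Dmat.
transitivity (sumR (2 * n) (fun j => if Nat.eq_dec j (n + i) then 2 * x j else 0)).
- apply sumR_ext; intros j _. replace (Nat.leb n (n + i)) with true by (symmetry; apply Nat.leb_le; lia).
  simpl. destruct (Nat.eqb_spec (n + i) j), (Nat.eq_dec j (n + i)); try lia; lra.
- apply (sumR_delta (2 * n) (n + i) (fun j => 2 * x j)); lia.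
Qed.

Lemma dot_mv_C n x y : dot (2 * n) x (mv (2 * n) (Cmat n) y) = - sumR n (fun k => x k * y (n + k)%nat).
Proof.
unfold dot. rewrite sumR_double.
rewrite (sumR_0 n (fun i => x (n + i)%nat * mv (2 * n) (Cmat n) y (n + i))).
- rewrite Rplus_0_r.
  replace (- sumR n (fun k => x k * y (n + k)%nat)) with (-1 * sumR n (fun k => x k * y (n + k)%nat)) by ring.
  rewrite <- sumR_scal. apply sumR_ext; intros i Hi. rewrite mv_Cmat_x; auto. ring.
- intros i _. rewrite mv_Cmat_v; ring.
Qed.

Lemma dot_mv_D n x y : dot (2 * n) x (mv (2 * n) (Dmat n) y) = sumR n (fun k => 2 * (x (n + k)%nat * y (n + k)%nat)).
Proof.
unfold dot. rewrite sumR_double.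
rewrite (sumR_0 n (fun i => x i * mv (2 * n) (Dmat n) y i)).
- rewrite Rplus_0_l. apply sumR_ext; intros i Hi. rewrite mv_Dmat_v; auto. ring.
- intros i Hi. rewrite mv_Dmat_x; auto; ring.
Qed.

(** By symmetry both terms with C equal the product of [N w] and [C w], which pairs the x-part of
    [N w] with the v-part of [w]; the term N D N sees only the v-part of [N w]. In this form the
    transport term and the moving tilt of the two-point argument can be matched with it. *)
Lemma quad_riccati n N K w : (forall i j, (i < 2 * n)%nat -> (j < 2 * n)%nat -> N i j = N j i) ->
  quad (2 * n) (riccati_rhs n N K) w =
  sumR n (fun k => 2 * mv (2 * n) N w (n + k)%nat ^ 2 - 2 * (w (n + k)%nat * mv (2 * n) N w k)) - quad (2 * n) K w.
Proof.
intros HN. set (m := (2 * n)%nat).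
assert (E : quad m (riccati_rhs n N K) w =
  dot m w (mv m (mmul m N (Cmat n)) w) + dot m w (mv m (mmul m (mtr (Cmat n)) N) w)
  + dot m w (mv m (mmul m (mmul m N (Dmat n)) N) w) - quad m K w).
{ rewrite !quad_dot. unfold dot. rewrite <- !sumR_plus, <- sumR_minus.
  apply sumR_ext; intros i _. rewrite <- !Rmult_plus_distr_l, <- Rmult_minus_distr_l. f_equal.
  unfold mv. rewrite <- !sumR_plus, <- sumR_minus. apply sumR_ext; intros j _.
  unfold riccati_rhs; fold m. ring. }
rewrite E.
assert (T1 : dot m w (mv m (mmul m N (Cmat n)) w) = dot m (mv m N w) (mv m (Cmat n) w)).
{ rewrite (dot_ext m w w _ (mv m N (mv m (Cmat n) w))); [|auto|intros; apply mv_mmul].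
  rewrite dot_mv_sym; auto. apply dot_comm. }
assert (T2 : dot m w (mv m (mmul m (mtr (Cmat n)) N) w) = dot m (mv m N w) (mv m (Cmat n) w)).
{ rewrite (dot_ext m w w _ (mv m (mtr (Cmat n)) (mv m N w))); [|auto|intros; apply mv_mmul].
  apply dot_mv_mtr. }
assert (T3 : dot m w (mv m (mmul m (mmul m N (Dmat n)) N) w) = dot m (mv m N w) (mv m (Dmat n) (mv m N w))).
{ rewrite (dot_ext m w w _ (mv m N (mv m (Dmat n) (mv m N w)))).
  - rewrite dot_mv_sym; auto. apply dot_comm.
  - auto.
  - intros i Hi. rewrite mv_mmul. apply mv_mmul. }
rewrite T1, T2, T3. unfold m. rewrite dot_mv_C, dot_mv_D.
rewrite sumR_minus, !sumR_scal.
assert (E1 : sumR n (fun k => mv (2 * n) N w k * w (n + k)%nat) = sumR n (fun i => w (n + i)%nat * mv (2 * n) N w i)).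
{ apply sumR_ext; intros; ring. }
assert (E2 : sumR n (fun i => mv (2 * n) N w (n + i)%nat * mv (2 * n) N w (n + i)%nat) = sumR n (fun i => mv (2 * n) N w (n + i)%nat ^ 2)).
{ apply sumR_ext; intros; ring. }
rewrite E1, E2. ring.
Qed.

(** A null vector of a shifted form, of [N] or of its inverse, is an eigenvector of [N]; there the
    Riccati right-hand side is explicit in the eigenvalue. *)
Lemma quad_riccati_eigen n N K w lam :
  (forall i j, (i < 2 * n)%nat -> (j < 2 * n)%nat -> N i j = N j i) ->
  (forall i, (i < 2 * n)%nat -> mv (2 * n) N w i = lam * w i) ->
  quad (2 * n) (riccati_rhs n N K) w =
  2 * lam ^ 2 * sumR n (fun k => w (n + k)%nat ^ 2) - 2 * lam * sumR n (fun k => w (n + k)%nat * w k) - quad (2 * n) K w.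
Proof.
intros HN E. rewrite quad_riccati; auto. f_equal.
rewrite sumR_minus, !sumR_scal.
rewrite (sumR_ext n (fun i => mv (2 * n) N w (n + i)%nat ^ 2) (fun i => lam ^ 2 * w (n + i)%nat ^ 2)).
2: { intros i Hi. rewrite E; [ring|lia]. }
rewrite (sumR_ext n (fun i => w (n + i)%nat * mv (2 * n) N w i) (fun i => lam * (w (n + i)%nat * w i))).
2: { intros i Hi. rewrite E; [ring|lia]. }
rewrite !sumR_scal. ring.
Qed.

Lemma dot_double n w : dot (2 * n) w w = sumR n (fun k => w k ^ 2) + sumR n (fun k => w (n + k)%nat ^ 2).
Proof. unfold dot. rewrite sumR_double. f_equal; apply sumR_ext; intros; ring. Qed.

Lemma cross_le n w : Rabs (2 * sumR n (fun k => w (n + k)%nat * w k)) <= dot (2 * n) w w.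
Proof.
rewrite dot_double, <- sumR_plus, <- sumR_scal.
eapply Rle_trans; [apply sumR_abs|]. apply sumR_le. intros k _.
generalize (pow2_ge_0 (w (n + k)%nat + w k)) (pow2_ge_0 (w (n + k)%nat - w k)). intros.
apply Rabs_le. split; nra.
Qed.

Lemma quad_le m A w c : (forall i j, (i < m)%nat -> (j < m)%nat -> Rabs (A i j) <= c) ->
  Rabs (quad m A w) <= INR m * c * dot m w w.
Proof.
intros H. destruct m as [|m]; [unfold quad, dot; simpl; rewrite Rabs_R0; lra|].
assert (Hc : 0 <= c) by (eapply Rle_trans; [apply Rabs_pos|apply (H O O); lia]).
unfold quad. eapply Rle_trans; [apply sumR_abs|].
apply Rle_trans with (sumR (S m) (fun i => sumR (S m) (fun j => c / 2 * (w i * w i + w j * w j)))).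
- apply sumR_le; intros i Hi. eapply Rle_trans; [apply sumR_abs|]. apply sumR_le; intros j Hj.
  rewrite !Rabs_mult. specialize (H i j Hi Hj).
  assert (Rabs (w i) * Rabs (w j) <= / 2 * (w i * w i + w j * w j)).
  { rewrite <- Rabs_mult. generalize (pow2_ge_0 (w i + w j)) (pow2_ge_0 (w i - w j)). intros.
    apply Rabs_le. split; nra. }
  assert (0 <= Rabs (w i) * Rabs (w j)) by (rewrite <- Rabs_mult; apply Rabs_pos).
  generalize (Rabs_pos (A i j)). nra.
- right. rewrite (sumR_ext (S m) _ (fun i => c / 2 * (INR (S m) * (w i * w i) + dot (S m) w w))).
  + rewrite sumR_scal, sumR_plus, sumR_scal, sumR_const. unfold dot. field.
  + intros i _. rewrite sumR_scal, sumR_plus, sumR_const. unfold dot. ring.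
Qed.

Lemma quad_idm m w : quad m idm w = dot m w w.
Proof. rewrite quad_dot. apply dot_ext; auto. intros; apply mv_idm; auto. Qed.

(* At the first time where X stops being positive definite, its null vectors lie in its kernel. *)
Lemma pos_def_preserved m (X X' : R -> mat) (s T : R) :
  (forall t i j, s <= t <= T -> (i < m)%nat -> (j < m)%nat -> is_derive (fun r => X r i j) t (X' t i j)) ->
  (forall t i j, s <= t <= T -> (i < m)%nat -> (j < m)%nat -> X t i j = X t j i) ->
  (forall w, dot m w w = 1 -> 0 < quad m (X s) w) ->
  (forall t w, s < t <= T -> dot m w w = 1 -> (forall i, (i < m)%nat -> mv m (X t) w i = 0) ->
     0 < quad m (X' t) w) ->
  forall t w, s <= t <= T -> dot m w w = 1 -> 0 < quad m (X t) w.
Proof.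
intros HD HS H0 HT t0 w0 Ht0 Hw0. apply Rnot_le_lt; intros Hbad.
assert (HL : forall tk t (pk : nat -> nat -> R) (p : nat -> R), s <= t <= T ->
  is_lim_seq tk t -> (forall i, (i < m)%nat -> is_lim_seq (fun k => pk k i) (p i)) ->
  is_lim_seq (fun k => quad m (X (tk k)) (pk k)) (quad m (X t) p)).
{ intros tk t pk p Ht L1 L2. apply sumR_lim; intros i Hi. apply sumR_lim; intros j Hj.
  apply is_lim_seq_mult'; auto. apply is_lim_seq_mult'; auto.
  apply (is_lim_seq_continuous (fun r => X r i j)); auto. eapply der_cont; apply HD; auto. }
destruct (first_bad m (fun t w => dot m w w = 1 /\ quad m (X t) w <= 0) s T 1) with (t0 := t0) (p0 := w0)
  as [t [w [Ht [[Hw Hq] Hbefore]]]]; auto.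
{ intros t p _ [Hp _] i Hi. generalize (coord_sq_le m p i Hi). rewrite Hp. intros.
  apply Rabs_le. split; nra. }
{ intros tk t pk p Hk L1 L2.
  assert (Ht : s <= t <= T) by (apply (lim_interval tk); auto; apply Hk).
  split.
  - assert (L : is_lim_seq (fun k => dot m (pk k) (pk k)) (dot m p p)).
    { apply sumR_lim; intros i Hi. apply is_lim_seq_mult'; auto. }
    apply (is_lim_seq_ext _ (fun _ => 1)) in L; [|intros k; apply Hk].
    apply is_lim_seq_unique in L. rewrite Lim_seq_const in L. congruence.
  - apply (lim_le (fun k => quad m (X (tk k)) (pk k)) (fun _ => 0)); auto.
    + intros k; apply Hk.
    + apply is_lim_seq_const. }
{ intros p [Hp Hp']. specialize (H0 p Hp). lra. }
assert (Hpos : forall v, 0 <= quad m (X t) v).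
{ intros v. assert (quad m (fun i j => -1 * X t i j) v <= 0); [|rewrite quad_scal_mat in *; lra].
  rewrite <- (Rmult_0_l (dot m v v)). apply quad_le_of_unit. clear v. intros v Hv. rewrite quad_scal_mat.
  assert (0 <= quad m (X t) v); [|lra].
  apply (left_limit_nonneg (fun r => quad m (X r) v) s t); [lra| |].
  - intros r Hr. apply Rnot_le_lt; intros Hle. apply (Hbefore r v); auto.
  - apply HL; [lra|apply lim_approach|intros; apply is_lim_seq_const]. }
assert (Hq0 : quad m (X t) w = 0) by (apply Rle_antisym; auto).
assert (Hker : forall i, (i < m)%nat -> mv m (X t) w i = 0).
{ intros i Hi. apply (dot_self_0 m); auto.
  (* Cauchy-Schwarz for the semidefinite form [X t] between [w] and [X t w]; the form vanishes at
     [w], so [X t w = 0]. *)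
  assert (D : (dot m (mv m (X t) w) (mv m (X t) w)) ^ 2 <= quad m (X t) w * quad m (X t) (mv m (X t) w)).
  { apply nonneg_quadratic_disc. intros r. rewrite <- quad_vadd; auto. intros; apply HS; auto; lra. }
  rewrite Hq0 in D. nra. }
specialize (HT t w Ht Hw Hker).
assert (quad m (X' t) w <= 0); [|lra].
apply (left_min_deriv (fun r => quad m (X r) w) t _ (t - s)); [|lra|].
- apply sumR_is_derive; intros i Hi. apply sumR_is_derive; intros j Hj.
  apply (der_ext (fun r => w i * w j * X r i j) _ _ (w i * w j * X' t i j)); [intros; ring|ring|].
  apply der_scal, HD; auto; lra.
- intros r Hr. rewrite Hq0. left. apply Rnot_le_lt; intros Hle. apply (Hbefore r w); auto; lra.
Qed.

(** Gronwall for the squared Frobenius norm [e]: [e * exp (- kap t)] is nonincreasing and tends to 0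
    at the left end. The initial condition is a limit along times decreasing to [a], because the
    equation is also used at the singular time 0. Linearity is expressed through an arbitrary common
    bound [S] of the entries. *)
Lemma linear_ode_zero m (Y Y' : R -> mat) (a b L : R) : 0 <= a -> 0 <= L ->
  (forall t i j, a < t < b -> (i < m)%nat -> (j < m)%nat -> is_derive (fun r => Y r i j) t (Y' t i j)) ->
  (forall t S, a < t < b -> (forall i j, (i < m)%nat -> (j < m)%nat -> Rabs (Y t i j) <= S) ->
     forall i j, (i < m)%nat -> (j < m)%nat -> Rabs (Y' t i j) <= L * S) ->
  (forall t, a < t -> forall i j, (i < m)%nat -> (j < m)%nat ->
     is_lim_seq (fun k => Y (a + (t - a) / 2 * / (INR k + 1)) i j) 0) ->
  forall t i j, a < t < b -> (i < m)%nat -> (j < m)%nat -> Y t i j = 0.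
Proof.
intros Ha HL HD HB H0 t0 i0 j0 Ht0 Hi0 Hj0.
set (e := fun t => sumR m (fun i => sumR m (fun j => Y t i j ^ 2))).
set (e' := fun t => sumR m (fun i => sumR m (fun j => 2 * (Y t i j * Y' t i j)))).
assert (De : forall t, a < t < b -> is_derive e t (e' t)).
{ intros t Ht. apply sumR_is_derive; intros i Hi. apply sumR_is_derive; intros j Hj.
  apply (der_ext (fun r => Y r i j * Y r i j) _ _ (Y' t i j * Y t i j + Y t i j * Y' t i j)); [intros; ring|ring|].
  apply der_mult; apply HD; auto. }
assert (Hrow : forall t i, (i < m)%nat -> sumR m (fun j => Y t i j ^ 2) <= e t).
{ intros t i Hi. apply (sumR_term m (fun i => sumR m (fun j => Y t i j ^ 2)) i); auto.
  intros k _. apply sumR_pos; intros; apply pow2_ge_0. }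
assert (Hent : forall t i j, (i < m)%nat -> (j < m)%nat -> Y t i j ^ 2 <= e t).
{ intros t i j Hi Hj. eapply Rle_trans; [|apply (Hrow t i Hi)].
  apply (sumR_term m (fun j => Y t i j ^ 2) j); auto. intros; apply pow2_ge_0. }
assert (Pe : forall t, 0 <= e t).
{ intros t. apply sumR_pos; intros; apply sumR_pos; intros; apply pow2_ge_0. }
(* Every entry is at most [sqrt (e t)], so each of the [m ^ 2] terms [2 Y Y'] is at most [2 L e]. *)
set (kap := INR m * (INR m * (2 * L))).
assert (Hkap : 0 <= kap).
{ unfold kap. generalize (pos_INR m); intros. repeat apply Rmult_le_pos; lra. }
assert (He' : forall t, a < t < b -> e' t <= kap * e t).
{ intros t Ht. unfold kap. rewrite !Rmult_assoc, <- !sumR_const. apply sumR_le; intros i Hi.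
  apply sumR_le; intros j Hj.
  assert (Hs : forall i j, (i < m)%nat -> (j < m)%nat -> Rabs (Y t i j) <= sqrt (e t)).
  { intros. rewrite <- sqrt_Rsqr_abs. apply sqrt_le_1_alt. unfold Rsqr. generalize (Hent t i1 j1 H H1). lra. }
  specialize (HB t (sqrt (e t)) Ht Hs i j Hi Hj). specialize (Hs i j Hi Hj).
  assert (Rabs (Y t i j * Y' t i j) <= sqrt (e t) * (L * sqrt (e t))).
  { rewrite Rabs_mult. apply Rmult_le_compat; auto; apply Rabs_pos. }
  generalize (sqrt_sqrt (e t) (Pe t)) (Rle_abs (Y t i j * Y' t i j)). nra. }
assert (Hmono : forall s, a < s < t0 -> e t0 * exp (- kap * t0) <= e s * exp (- kap * s)).
{ intros s Hs.
  destruct (MVT_cor2 (fun t => e t * exp (- kap * t)) (fun t => e' t * exp (- kap * t) + e t * (exp (- kap * t) * (- kap * 1))) s t0) as [c [Hc1 Hc2]]; [lra| |].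
  - intros c Hc. apply is_derive_Reals. apply (der_mult e (fun t => exp (- kap * t))); [apply De; lra|].
    apply (der_exp (fun t => - kap * t) c (- kap * 1)). apply (der_scal (fun t => t)), der_id.
  - assert (e' c * exp (- kap * c) + e c * (exp (- kap * c) * (- kap * 1)) <= 0).
    { specialize (He' c). generalize (exp_pos (- kap * c)). intros. assert (e' c <= kap * e c) by (apply He'; lra). nra. }
    nra. }
assert (Hz : e t0 * exp (- kap * t0) <= 0).
{ set (sk := fun k => a + (t0 - a) / 2 * / (INR k + 1)).
  assert (Le0 : is_lim_seq (fun k => e (sk k)) 0).
  { assert (Le : is_lim_seq (fun k => e (sk k)) (sumR m (fun _ => sumR m (fun _ => 0 * 0)))).
    { apply sumR_lim; intros i Hi. apply sumR_lim; intros j Hj.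
      apply (is_lim_seq_ext (fun k => Y (sk k) i j * Y (sk k) i j)); [intros; ring|].
      apply is_lim_seq_mult'; apply H0; auto; lra. }
    rewrite sumR_0 in Le; auto. intros i _. apply sumR_0. intros; ring. }
  apply (lim_le (fun _ => e t0 * exp (- kap * t0)) (fun k => e (sk k))); auto; [|apply is_lim_seq_const].
  intros k. assert (B := inv_succ_bounds k). assert (Hs : a < sk k < t0) by (unfold sk; nra).
  eapply Rle_trans; [apply (Hmono _ Hs)|]. rewrite <- (Rmult_1_r (e (sk k))) at 2.
  apply Rmult_le_compat_l; auto. rewrite <- exp_0.
  assert (E : - kap * sk k <= 0) by nra. destruct E as [E|E]; [left; apply exp_increasing; auto|rewrite E; lra]. }
assert (e t0 <= 0).
{ generalize (exp_pos (- kap * t0)). nra. }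
specialize (Hent t0 i0 j0 Hi0 Hj0). nra.
Qed.

(** At a zero of [g] the product rule asks only for continuity of [f]. It is applied with [f] an
    entry of the inverse, whose differentiability is what is being proved. *)
Lemma der_mult_vanishing (f g : R -> R) (x b : R) :
  continuity_pt f x -> is_derive g x b -> g x = 0 -> is_derive (fun s => f s * g s) x (f x * b).
Proof.
intros Hf Hg Hx. apply is_derive_Reals.
assert (L : limit1_in (fun h => f (x + h) * ((g (x + h) - g x) / h)) (fun h => h <> 0) (f x * b) 0).
{ apply (limit_mul (fun h => f (x + h)) (fun h => (g (x + h) - g x) / h)).
  - intros eps He. destruct (Hf eps He) as [d [Hd H]]. exists d; split; auto.
    intros h [Hh1 Hh2]. simpl in *. unfold Rdist in *. apply H. split.
    + split; [exact I|lra].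
    + replace (x + h - x) with (h - 0) by lra; auto.
  - intros eps He. destruct (der_eps g x b Hg eps He) as [d [Hd H]]. exists d; split; auto.
    intros h [Hh1 Hh2]. simpl in *. unfold Rdist in *. apply H; auto.
    replace h with (h - 0) by lra; auto. }
intros eps He. destruct (L eps He) as [d [Hd H]]. exists (mkposreal d Hd). intros h Hh1 Hh2.
simpl in *. unfold Rdist in H. rewrite Hx in *.
replace ((f (x + h) * g (x + h) - f x * 0) / h) with (f (x + h) * ((g (x + h) - 0) / h)) by (field; auto).
apply H. split; auto. replace (h - 0) with h by lra; auto.
Qed.

(** One degree lower than the preceding lemma: a bounded factor times a continuous factor that
    vanishes. *)
Lemma cont_bounded_vanishing (f g : R -> R) (x c : R) : 0 < c ->
  (exists d, 0 < d /\ forall s, Rabs (s - x) < d -> Rabs (f s) <= c) ->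
  continuity_pt g x -> g x = 0 -> continuity_pt (fun s => f s * g s) x.
Proof.
intros Hc [d [Hd Hf]] Hg Hx eps He.
destruct (Hg (eps / c)) as [d' [Hd' H]]; [apply Rdiv_lt_0_compat; auto|].
exists (Rmin d d'). split; [apply Rmin_glb_lt; auto|].
intros s [Hs1 Hs2]. simpl in *. unfold Rdist in *.
assert (Rabs (s - x) < d) by (eapply Rlt_le_trans; [exact Hs2|apply Rmin_l]).
assert (Hg' : Rabs (g s - g x) < eps / c).
{ apply H. split; auto. eapply Rlt_le_trans; [exact Hs2|apply Rmin_r]. }
rewrite Hx in *. rewrite Rmult_0_r, Rminus_0_r, Rabs_mult in *.
apply Rle_lt_trans with (c * Rabs (g s)).
- apply Rmult_le_compat_r; [apply Rabs_pos|auto].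
- replace eps with (c * (eps / c)) by (field; lra). apply Rmult_lt_compat_l; auto.
Qed.

Lemma cont_sumR m (f : R -> nat -> R) x : (forall i, (i < m)%nat -> continuity_pt (fun s => f s i) x) ->
  continuity_pt (fun s => sumR m (f s)) x.
Proof.
induction m; simpl; intros H.
- apply continuity_pt_const. intros ? ?; auto.
- apply (continuity_pt_plus (fun s => sumR m (f s)) (fun s => f s m)); auto.
Qed.

(** Resolvent identity [J(s) = J(t) - J(s) (N(s) - N(t)) J(t)]. The middle factor vanishes at
    [s = t], so boundedness of [J] gives its continuity, and continuity gives the derivative. *)
Lemma inverse_deriv m (N N' J : R -> mat) (d : R) :
  (forall t, 0 < t < d -> is_inverse m (N t) (J t)) ->
  (forall t i j, 0 < t < d -> (i < m)%nat -> (j < m)%nat -> Rabs (J t i j) <= 1) ->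
  (forall t i j, 0 < t < d -> (i < m)%nat -> (j < m)%nat -> is_derive (fun s => N s i j) t (N' t i j)) ->
  forall t i j, 0 < t < d -> (i < m)%nat -> (j < m)%nat ->
  is_derive (fun s => J s i j) t (- mmul m (mmul m (J t) (N' t)) (J t) i j).
Proof.
intros HJ Hb HN t i0 j0 Ht Hi0 Hj0.
set (ad := Rmin t (d - t)).
assert (Had : 0 < ad) by (apply Rmin_glb_lt; lra).
assert (Hnear : forall s, Rabs (s - t) < ad -> 0 < s < d).
{ intros s Hs. assert (ad <= t) by apply Rmin_l. assert (ad <= d - t) by apply Rmin_r.
  apply Rabs_lt_between in Hs. lra. }
assert (Eq : forall s i j, 0 < s < d -> (i < m)%nat -> (j < m)%nat ->
  J t i j + -1 * sumR m (fun k => sumR m (fun l => J t l j * (J s i k * (N s k l - N t k l)))) = J s i j).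
{ intros s i j Hs Hi Hj.
  assert (E1 : sumR m (fun k => sumR m (fun l => J t l j * (J s i k * N s k l))) = J t i j).
  { rewrite sumR_swap.
    rewrite (sumR_ext m _ (fun l => if Nat.eq_dec l i then J t l j else 0)).
    - apply (sumR_delta m i (fun l => J t l j)); auto.
    - intros l Hl. rewrite sumR_scal.
      generalize (MatrixInverse.is_inverse_comm m _ _ (HJ s Hs) i l Hi Hl).
      unfold mmul; intros ->. unfold idm. destruct (Nat.eq_dec i l), (Nat.eq_dec l i); subst; try lra; congruence. }
  assert (E2 : sumR m (fun k => sumR m (fun l => J t l j * (J s i k * N t k l))) = J s i j).
  { rewrite (sumR_ext m _ (fun k => if Nat.eq_dec k j then J s i k else 0)).
    - apply (sumR_delta m j (fun k => J s i k)); auto.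
    - intros k Hk. rewrite (sumR_ext m _ (fun l => J s i k * (N t k l * J t l j))) by (intros; ring).
      rewrite sumR_scal. generalize (HJ t Ht k j Hk Hj). unfold mmul; intros ->.
      unfold idm. destruct (Nat.eq_dec k j); lra. }
  rewrite (sumR_ext m _ (fun k => sumR m (fun l => J t l j * (J s i k * N s k l)) - sumR m (fun l => J t l j * (J s i k * N t k l)))).
  - rewrite sumR_minus, E1, E2. ring.
  - intros k _. rewrite <- sumR_minus. apply sumR_ext; intros; ring. }
assert (Ndiff : forall k l, (k < m)%nat -> (l < m)%nat -> is_derive (fun s => N s k l - N t k l) t (N' t k l)).
{ intros k l Hk Hl. apply (der_ext (fun s => N s k l - N t k l) _ _ (N' t k l - 0)); [auto|ring|].
  apply (der_minus (fun s => N s k l)); [apply HN; auto|apply der_const]. }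
assert (JC : forall i j, (i < m)%nat -> (j < m)%nat -> continuity_pt (fun s => J s i j) t).
{ intros i j Hi Hj.
  apply (continuity_pt_ext_loc (fun s => J t i j + -1 * sumR m (fun k => sumR m (fun l => J t l j * (J s i k * (N s k l - N t k l)))))).
  - exists (mkposreal ad Had). intros s Hs. apply Eq; auto.
  - apply (continuity_pt_plus (fun _ => J t i j) (fun s => -1 * sumR m (fun k => sumR m (fun l => J t l j * (J s i k * (N s k l - N t k l)))))).
    + apply continuity_pt_const. intros ? ?; auto.
    + apply (continuity_pt_scal (fun s => sumR m (fun k => sumR m (fun l => J t l j * (J s i k * (N s k l - N t k l)))))).
      apply cont_sumR; intros k Hk. apply cont_sumR; intros l Hl.
      apply (continuity_pt_scal (fun s => J s i k * (N s k l - N t k l))).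
      apply (cont_bounded_vanishing (fun s => J s i k) (fun s => N s k l - N t k l) t 1); [lra| | |ring].
      * exists ad; split; auto.
      * eapply der_cont; apply Ndiff; auto. }
apply (is_derive_ext_loc (fun s => J t i0 j0 + -1 * sumR m (fun k => sumR m (fun l => J t l j0 * (J s i0 k * (N s k l - N t k l)))))).
{ exists (mkposreal ad Had). intros s Hs. apply Eq; auto. }
apply (der_ext (fun s => J t i0 j0 + -1 * sumR m (fun k => sumR m (fun l => J t l j0 * (J s i0 k * (N s k l - N t k l))))) _ _
  (0 + -1 * sumR m (fun k => sumR m (fun l => J t l j0 * (J t i0 k * N' t k l))))); [auto| |].
- replace (mmul m (mmul m (J t) (N' t)) (J t) i0 j0) with (sumR m (fun k => sumR m (fun l => J t l j0 * (J t i0 k * N' t k l)))); [ring|].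
  rewrite sumR_swap. unfold mmul. apply sumR_ext; intros l _. rewrite sumR_scal. ring.
- apply der_plus; [apply der_const|]. apply der_scal.
  apply sumR_is_derive; intros k Hk. apply sumR_is_derive; intros l Hl. apply der_scal.
  apply (der_mult_vanishing (fun s => J s i0 k) (fun s => N s k l - N t k l)); auto. ring.
Qed.

Lemma meq_mmul m A A' B B' i j : (i < m)%nat -> (j < m)%nat ->
  (forall k, (k < m)%nat -> A i k = A' i k) -> (forall k, (k < m)%nat -> B k j = B' k j) -> mmul m A B i j = mmul m A' B' i j.
Proof. intros Hi Hj HA HB. apply sumR_ext; intros k Hk. rewrite HA, HB; auto. Qed.

Lemma mmul_idm_l m A i j : (i < m)%nat -> mmul m idm A i j = A i j.
Proof. intros Hi. apply (mv_idm m (fun k => A k j) i Hi). Qed.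

Lemma mmul_idm_r m A i j : (j < m)%nat -> mmul m A idm i j = A i j.
Proof.
intros Hj. unfold mmul, idm. rewrite <- (sumR_delta m j (fun k => A i k) Hj).
apply sumR_ext; intros k _. destruct (Nat.eq_dec k j); lra.
Qed.

Lemma mmul_sum4_r m A B C D E i j :
  mmul m A (fun i j => B i j + C i j + D i j - E i j) i j = mmul m A B i j + mmul m A C i j + mmul m A D i j - mmul m A E i j.
Proof. unfold mmul. rewrite <- !sumR_plus, <- sumR_minus. apply sumR_ext; intros; ring. Qed.

Lemma mmul_sum4_l m A B C D E i j :
  mmul m (fun i j => B i j + C i j + D i j - E i j) A i j = mmul m B A i j + mmul m C A i j + mmul m D A i j - mmul m E A i j.
Proof. unfold mmul. rewrite <- !sumR_plus, <- sumR_minus. apply sumR_ext; intros; ring. Qed.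

(** Conjugation by [J] exchanges the roles of the coefficients: N D N becomes the constant D, and K
    becomes the quadratic term. The equation of the inverse is thus regular at time 0, where [N]
    itself blows up. *)
Lemma inverse_riccati n N J K i j : is_inverse (2 * n) N J -> (i < 2 * n)%nat -> (j < 2 * n)%nat ->
  mmul (2 * n) (mmul (2 * n) J (riccati_rhs n N K)) J i j =
  mmul (2 * n) (Cmat n) J i j + mmul (2 * n) J (mtr (Cmat n)) i j + Dmat n i j
  - mmul (2 * n) J (mmul (2 * n) K J) i j.
Proof.
intros H Hi Hj. set (m := (2 * n)%nat) in *.
assert (H' := MatrixInverse.is_inverse_comm m _ _ H).
assert (CL : forall X k l, (k < m)%nat -> (l < m)%nat -> mmul m J (mmul m N X) k l = X k l).
{ intros X k l Hk Hl. rewrite <- mmul_assoc.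
  rewrite (meq_mmul m _ idm X X); auto. apply mmul_idm_l; auto. }
assert (CR : forall X k l, (k < m)%nat -> (l < m)%nat -> mmul m (mmul m X N) J k l = X k l).
{ intros X k l Hk Hl. rewrite mmul_assoc.
  rewrite (meq_mmul m X X _ idm); auto. apply mmul_idm_r; auto. }
rewrite mmul_assoc.
rewrite (meq_mmul m J J (mmul m (riccati_rhs n N K) J)
  (fun i j => mmul m N (mmul m (Cmat n) J) i j + mtr (Cmat n) i j + mmul m N (Dmat n) i j - mmul m K J i j)); auto.
- rewrite mmul_sum4_r, !CL; auto; ring.
- intros k Hk. unfold riccati_rhs. fold m. rewrite mmul_sum4_l, !CR, mmul_assoc; auto.
Qed.

Lemma derivs_bounded m (N N' : R -> mat) (a b : R) : a <= b ->
  (forall t i j, a <= t <= b -> (i < m)%nat -> (j < m)%nat -> is_derive (fun s => N s i j) t (N' t i j)) ->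
  exists c, 0 <= c /\ forall t i j, a <= t <= b -> (i < m)%nat -> (j < m)%nat -> Rabs (N t i j) <= c.
Proof.
intros Hab H.
assert (H1 : forall i j, exists c, 0 <= c /\ ((i < m)%nat -> (j < m)%nat -> forall t, a <= t <= b -> Rabs (N t i j) <= c)).
{ intros i j. destruct (Nat.le_gt_cases m i); [exists 0; split; [lra|lia]|].
  destruct (Nat.le_gt_cases m j); [exists 0; split; [lra|lia]|].
  destruct (continuity_ab_maj (fun t => Rabs (N t i j)) a b Hab) as [x [Hx Hx']].
  - intros c Hc. apply (continuity_pt_comp (fun t => N t i j) Rabs); [|apply Rcontinuity_abs].
    eapply der_cont. apply H; auto.
  - exists (Rabs (N x i j)). split; [apply Rabs_pos|auto]. }
destruct (choice _ (fun i => choice _ (H1 i))) as [c Hc].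
exists (sumR m (fun i => sumR m (c i))). split.
- apply sumR_pos; intros i _; apply sumR_pos; intros j _. apply Hc.
- intros t i j Ht Hi Hj. eapply Rle_trans; [apply (Hc i j); auto|].
  eapply Rle_trans; [apply (sumR_term m (c i) j); auto; intros; apply Hc|].
  apply (sumR_term m (fun i => sumR m (c i)) i); auto. intros; apply sumR_pos; intros; apply Hc.
Qed.

Lemma Cmat_abs n i j : Rabs (Cmat n i j) <= 1.
Proof.
unfold Cmat. destruct (_ && _)%bool; [rewrite Rabs_left|rewrite Rabs_R0]; lra.
Qed.

Lemma Dmat_abs n i j : Rabs (Dmat n i j) <= 2.
Proof.
unfold Dmat. destruct (_ && _)%bool; [rewrite Rabs_right|rewrite Rabs_R0]; lra.
Qed.

Lemma Dmat_sym n i j : Dmat n i j = Dmat n j i.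
Proof.
destruct (Nat.eq_dec i j) as [->|E]; auto. unfold Dmat.
rewrite (proj2 (Nat.eqb_neq i j)), (proj2 (Nat.eqb_neq j i)) by auto.
destruct (Nat.leb n i), (Nat.leb n j); auto.
Qed.

Lemma sumR_prod_abs m (A B : nat -> R) a b : (forall k, (k < m)%nat -> Rabs (A k) <= a) ->
  (forall k, (k < m)%nat -> Rabs (B k) <= b) -> Rabs (sumR m (fun k => A k * B k)) <= INR m * (a * b).
Proof.
intros HA HB. apply sumR_abs_le. intros k Hk. rewrite Rabs_mult.
apply Rmult_le_compat; auto; apply Rabs_pos.
Qed.

(* The skew part of X M X for symmetric M is linear in the skew part of X. *)
Lemma skew_triple m (X M : mat) (b c S : R) : 0 <= b -> 0 <= c ->
  (forall i j, (i < m)%nat -> (j < m)%nat -> M i j = M j i) ->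
  (forall i j, (i < m)%nat -> (j < m)%nat -> Rabs (M i j) <= c) ->
  (forall i j, (i < m)%nat -> (j < m)%nat -> Rabs (X i j) <= b) ->
  (forall i j, (i < m)%nat -> (j < m)%nat -> Rabs (X i j - X j i) <= S) ->
  forall i j, (i < m)%nat -> (j < m)%nat ->
  Rabs (mmul m X (mmul m M X) i j - mmul m X (mmul m M X) j i) <= INR m * (INR m * (c * (2 * b * S))).
Proof.
intros Hb Hc HM HMc HX HS i j Hi Hj.
assert (E : mmul m X (mmul m M X) i j - mmul m X (mmul m M X) j i =
  sumR m (fun k => sumR m (fun l => M k l * (X i k * (X l j - X j l) + X j l * (X i k - X k i))))).
{ unfold mmul.
  rewrite (sumR_ext m (fun k => X i k * _) (fun k => sumR m (fun l => M k l * (X i k * X l j)))).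
  2: { intros k _. rewrite <- sumR_scal. apply sumR_ext; intros; ring. }
  rewrite (sumR_ext m (fun k => X j k * _) (fun k => sumR m (fun l => M k l * (X j k * X l i)))).
  2: { intros k _. rewrite <- sumR_scal. apply sumR_ext; intros; ring. }
  rewrite (sumR_swap m m (fun k l => M k l * (X j k * X l i))).
  rewrite <- sumR_minus. apply sumR_ext; intros k Hk. rewrite <- sumR_minus. apply sumR_ext; intros l Hl.
  rewrite (HM l k); auto. ring. }
rewrite E. apply sumR_abs_le; intros k Hk. apply sumR_abs_le; intros l Hl.
rewrite Rabs_mult. apply Rmult_le_compat; auto; try apply Rabs_pos.
eapply Rle_trans; [apply Rabs_triang|]. rewrite !Rabs_mult.
assert (Rabs (X i k) * Rabs (X l j - X j l) <= b * S) by (apply Rmult_le_compat; auto; apply Rabs_pos).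
assert (Rabs (X j l) * Rabs (X i k - X k i) <= b * S) by (apply Rmult_le_compat; auto; apply Rabs_pos).
lra.
Qed.

Definition riccati_solution n K (N : R -> mat) :=
  forall t i j, 0 < t -> (i < 2 * n)%nat -> (j < 2 * n)%nat ->
    is_derive (fun s => N s i j) t (riccati_rhs n (N t) K i j).

Definition symmetric m (A : mat) := forall i j, (i < m)%nat -> (j < m)%nat -> A i j = A j i.

Lemma mat_bounded m (K : mat) : exists c, 0 <= c /\ forall i j, (i < m)%nat -> (j < m)%nat -> Rabs (K i j) <= c.
Proof.
destruct (derivs_bounded m (fun _ => K) (fun _ _ _ => 0) 0 1) as [c [Hc H]]; [lra| |].
- intros. apply der_const.
- exists c; split; auto. intros; apply (H 0); auto; lra.
Qed.

Lemma inv_tends_bounded m N : inv_tends_to_zero m N -> exists J d, 0 < d /\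
  (forall t, 0 < t < d -> is_inverse m (N t) (J t)) /\
  (forall t i j, 0 < t < d -> (i < m)%nat -> (j < m)%nat -> Rabs (J t i j) <= 1) /\
  (forall eps, 0 < eps -> exists del, 0 < del /\
     forall t i j, 0 < t < del -> (i < m)%nat -> (j < m)%nat -> Rabs (J t i j) < eps).
Proof.
intros [J [[d1 [Hd1 H1]] H2]]. destruct (H2 1 Rlt_0_1) as [d2 [Hd2 H3]].
exists J, (Rmin d1 d2).
assert (A1 := Rmin_l d1 d2). assert (A2 := Rmin_r d1 d2).
split; [apply Rmin_glb_lt; auto|]. split; [intros; apply H1; lra|].
split; [intros; left; apply H3; auto; lra|].
intros eps He. destruct (H2 eps He) as [d [Hd H]]. exists d; auto.
Qed.

(** For symmetric D and K, the skew part of [J] satisfies a linear equation with bounded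
    coefficients, since [skew_triple] bounds the skew part of [J K J] by that of [J]. It tends to 0
    with [J], so Gronwall makes it vanish. *)
Lemma inverse_symmetric_near_0 n K N J d : symmetric (2 * n) K -> riccati_solution n K N ->
  (forall t, 0 < t < d -> is_inverse (2 * n) (N t) (J t)) ->
  (forall t i j, 0 < t < d -> (i < 2 * n)%nat -> (j < 2 * n)%nat -> Rabs (J t i j) <= 1) ->
  (forall eps, 0 < eps -> exists del, 0 < del /\
     forall t i j, 0 < t < del -> (i < 2 * n)%nat -> (j < 2 * n)%nat -> Rabs (J t i j) < eps) ->
  forall t, 0 < t < d -> symmetric (2 * n) (J t).
Proof.
intros HK HN HJ Hb H0. set (m := (2 * n)%nat) in *.
destruct (mat_bounded m K) as [c [Hc HKc]].
set (P := fun t => mmul m (mmul m (J t) (riccati_rhs n (N t) K)) (J t)).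
assert (Hz : forall t i j, 0 < t < d -> (i < m)%nat -> (j < m)%nat -> J t i j - J t j i = 0).
{ apply (linear_ode_zero m (fun t i j => J t i j - J t j i) (fun t i j => - P t i j - - P t j i) 0 d (INR m + INR m + INR m * (INR m * (c * 2)))).
- lra.
- generalize (pos_INR m); intros. repeat apply Rplus_le_le_0_compat; auto. repeat apply Rmult_le_pos; lra.
- intros t i j Ht Hi Hj. apply (der_minus (fun r => J r i j) (fun r => J r j i));
  apply (inverse_deriv m N (fun t => riccati_rhs n (N t) K) J d); auto; intros; apply HN; auto; lra.
- intros t S Ht HS i j Hi Hj. unfold P, m. rewrite !inverse_riccati; auto. fold m.
  set (JK := mmul m (J t) (mmul m K (J t))).
  replace (_ - - _) with (- (mmul m (Cmat n) (J t) i j - mmul m (J t) (mtr (Cmat n)) j i)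
    + - (mmul m (J t) (mtr (Cmat n)) i j - mmul m (Cmat n) (J t) j i) + (JK i j - JK j i)) by (rewrite (Dmat_sym n j i); ring).
  assert (B1 : forall i j, (i < m)%nat -> (j < m)%nat ->
    Rabs (mmul m (Cmat n) (J t) i j - mmul m (J t) (mtr (Cmat n)) j i) <= INR m * (1 * S)).
  { intros k l Hk Hl. unfold mmul. rewrite <- sumR_minus.
    rewrite (sumR_ext m _ (fun p => Cmat n k p * (J t p l - J t l p))) by (intros; unfold mtr; ring).
    apply sumR_prod_abs; [intros; apply Cmat_abs|auto]. }
  assert (B3 : Rabs (JK i j - JK j i) <= INR m * (INR m * (c * (2 * 1 * S)))).
  { apply skew_triple; auto; lra. }
  eapply Rle_trans; [apply Rabs_triang|]. eapply Rle_trans; [apply Rplus_le_compat_r, Rabs_triang|].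
  rewrite !Rabs_Ropp. generalize (B1 i j Hi Hj) (B1 j i Hj Hi). rewrite (Rabs_minus_sym (mmul m (Cmat n) (J t) j i)).
  lra.
- intros t Ht i j Hi Hj.
  assert (LJ : forall i j, (i < m)%nat -> (j < m)%nat -> is_lim_seq (fun k => J (0 + (t - 0) / 2 * / (INR k + 1)) i j) 0).
  { clear i j Hi Hj. intros i j Hi Hj. apply is_lim_seq_spec. intros eps.
    destruct (H0 eps (cond_pos eps)) as [del [Hdel H]].
    assert (L := lim_approach 0 ((t - 0) / 2)). apply is_lim_seq_spec in L.
    destruct (L (mkposreal del Hdel)) as [k0 Hk0]. exists k0. intros k Hk.
    specialize (Hk0 k Hk). simpl in Hk0. rewrite Rminus_0_r. apply H; auto.
    assert (B := inv_succ_bounds k). rewrite Rabs_right in Hk0; nra. }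
  replace (Finite 0) with (Finite (0 - 0)) by (f_equal; ring). apply is_lim_seq_minus'; auto. }
intros t Ht i j Hi Hj. specialize (Hz t i j Ht Hi Hj). lra.
Qed.

(** With [J] symmetric, [N^T J] is the transpose of [J N = I], hence
    [N = (N^T J) N = N^T (J N) = N^T]. *)
Lemma inverse_symmetric m N J : is_inverse m N J -> symmetric m J -> symmetric m N.
Proof.
intros H HJ i j Hi Hj. assert (H' := MatrixInverse.is_inverse_comm m _ _ H).
rewrite <- (mmul_idm_l m N i j Hi).
rewrite (meq_mmul m idm (mmul m (mtr N) J) N N); auto.
- rewrite mmul_assoc. rewrite (meq_mmul m (mtr N) (mtr N) _ idm); auto. rewrite mmul_idm_r; auto.
- intros k Hk. transitivity (mmul m J N k i).
  + rewrite H'; auto. unfold idm. destruct (Nat.eq_dec i k), (Nat.eq_dec k i); congruence.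
  + unfold mmul, mtr. apply sumR_ext; intros l Hl. rewrite (HJ l k); auto. ring.
Qed.

(** The same Gronwall argument for the skew part of [N] itself, away from 0, where [N] is bounded on
    compact time intervals. *)
Lemma riccati_symmetric_from n K N a : 0 < a -> symmetric (2 * n) K -> riccati_solution n K N ->
  symmetric (2 * n) (N a) -> forall t, a < t -> symmetric (2 * n) (N t).
Proof.
intros Ha HK HN Hsa t0 Ht0. set (m := (2 * n)%nat) in *.
destruct (derivs_bounded m N (fun t => riccati_rhs n (N t) K) a (t0 + 1)) as [b [Hb HB]]; [lra| |].
{ intros; apply HN; auto; lra. }
assert (Hz : forall t i j, a < t < t0 + 1 -> (i < m)%nat -> (j < m)%nat -> N t i j - N t j i = 0).
{ apply (linear_ode_zero m (fun t i j => N t i j - N t j i)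
   (fun t i j => riccati_rhs n (N t) K i j - riccati_rhs n (N t) K j i) a (t0 + 1) (INR m + INR m + INR m * (INR m * (2 * (2 * b))))).
- lra.
- generalize (pos_INR m); intros. repeat apply Rplus_le_le_0_compat; auto. repeat apply Rmult_le_pos; lra.
- intros t i j Ht Hi Hj. apply (der_minus (fun r => N r i j) (fun r => N r j i)); apply HN; auto; lra.
- intros t S Ht HS i j Hi Hj. unfold riccati_rhs. fold m. rewrite !mmul_assoc, (HK i j); auto.
  set (ND := mmul m (N t) (mmul m (Dmat n) (N t))).
  replace (_ - (_ + _ + _ - _)) with ((mmul m (N t) (Cmat n) i j - mmul m (mtr (Cmat n)) (N t) j i)
    + - (mmul m (N t) (Cmat n) j i - mmul m (mtr (Cmat n)) (N t) i j) + (ND i j - ND j i)) by ring.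
  assert (B1 : forall i j, (i < m)%nat -> (j < m)%nat ->
    Rabs (mmul m (N t) (Cmat n) i j - mmul m (mtr (Cmat n)) (N t) j i) <= INR m * (1 * S)).
  { intros k l Hk Hl. unfold mmul. rewrite <- sumR_minus.
    rewrite (sumR_ext m _ (fun p => Cmat n p l * (N t k p - N t p k))) by (intros; unfold mtr; ring).
    apply sumR_prod_abs; [intros; apply Cmat_abs|auto]. }
  assert (B3 : Rabs (ND i j - ND j i) <= INR m * (INR m * (2 * (2 * b * S)))).
  { apply skew_triple; auto; try lra.
    - intros; apply Dmat_sym.
    - intros; apply Dmat_abs.
    - intros; apply HB; auto; lra. }
  eapply Rle_trans; [apply Rabs_triang|]. eapply Rle_trans; [apply Rplus_le_compat_r, Rabs_triang|].
  rewrite !Rabs_Ropp. generalize (B1 i j Hi Hj) (B1 j i Hj Hi). lra.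
- intros t Ht i j Hi Hj.
  replace (Finite 0) with (Finite (N a i j - N a j i)) by (rewrite (Hsa i j); auto; f_equal; ring).
  apply (is_lim_seq_continuous (fun r => N r i j - N r j i) (fun k => a + (t - a) / 2 * / (INR k + 1))).
  + eapply der_cont. apply (der_minus (fun r => N r i j) (fun r => N r j i)); apply HN; auto.
  + apply lim_approach. }
intros i j Hi Hj. generalize (Hz t0 i j). intros Hz'. assert (N t0 i j - N t0 j i = 0) by (apply Hz'; auto; lra). lra.
Qed.

Lemma riccati_symmetric n K N : symmetric (2 * n) K -> riccati_solution n K N ->
  inv_tends_to_zero (2 * n) N -> forall t, 0 < t -> symmetric (2 * n) (N t).
Proof.
intros HK HN Hinv t Ht. destruct (inv_tends_bounded _ _ Hinv) as [J [d [Hd [HJ [Hb H0]]]]].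
assert (Hs := inverse_symmetric_near_0 n K N J d HK HN HJ Hb H0).
set (a := Rmin d t / 2).
assert (A0 : 0 < Rmin d t) by (apply Rmin_glb_lt; auto).
assert (A1 := Rmin_l d t). assert (A2 := Rmin_r d t).
apply (riccati_symmetric_from n K N a); auto; unfold a; try lra.
apply (inverse_symmetric _ _ (J (Rmin d t / 2))); [apply HJ|apply Hs]; lra.
Qed.

Lemma quad_shift m A e x : quad m (fun i j => -1 * A i j + e * idm i j) x = - quad m A x + e * dot m x x.
Proof.
rewrite (quad_plus_mat m (fun i j => -1 * A i j) (fun i j => e * idm i j)), !quad_scal_mat, quad_idm. ring.
Qed.

Lemma mv_shift m A e x i : (i < m)%nat ->
  mv m (fun i j => -1 * A i j + e * idm i j) x i = - mv m A x i + e * x i.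
Proof.
intros Hi. replace (e * x i) with (e * mv m idm x i) by (rewrite mv_idm; auto). unfold mv.
replace (- sumR m (fun j => A i j * x j)) with (-1 * sumR m (fun j => A i j * x j)) by ring.
rewrite <- !sumR_scal, <- sumR_plus. apply sumR_ext; intros; ring.
Qed.

Lemma symmetric_shift m A e : symmetric m A -> symmetric m (fun i j => -1 * A i j + e * idm i j).
Proof.
intros H i j Hi Hj. rewrite (H i j Hi Hj). f_equal. f_equal. unfold idm.
destruct (Nat.eq_dec i j), (Nat.eq_dec j i); congruence.
Qed.

Lemma dot_mmul3 m X M w : symmetric m X ->
  quad m (mmul m (mmul m X M) X) w = quad m M (mv m X w).
Proof.
intros HX. rewrite !quad_dot.
rewrite (dot_ext m w w _ (mv m X (mv m M (mv m X w)))).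
- rewrite dot_mv_sym; auto. apply dot_comm.
- auto.
- intros i Hi. rewrite !mv_mmul. auto.
Qed.

(** [J] starts at 0 with derivative [- D], which is only semidefinite, so the sign is not immediate.
    The form [- J + mu I] with [mu = eta exp (kap t)] is kept positive instead. At a null vector
    [v], [J v = mu v] and [N v = v / mu]; the conjugated Riccati term becomes [2 |v_v|^2] plus
    errors of order [mu], and these are beaten by [mu' = kap mu]. *)
Lemma inverse_nonpos_near_0 n K N J d : symmetric (2 * n) K -> riccati_solution n K N ->
  0 < d -> (forall t, 0 < t < d -> is_inverse (2 * n) (N t) (J t)) ->
  (forall t i j, 0 < t < d -> (i < 2 * n)%nat -> (j < 2 * n)%nat -> Rabs (J t i j) <= 1) ->
  (forall eps, 0 < eps -> exists del, 0 < del /\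
     forall t i j, 0 < t < del -> (i < 2 * n)%nat -> (j < 2 * n)%nat -> Rabs (J t i j) < eps) ->
  forall t w, 0 < t < d -> quad (2 * n) (J t) w <= 0.
Proof.
intros HK HN Hd0 HJ Hb H0 t0.
assert (HJs := inverse_symmetric_near_0 n K N J d HK HN HJ Hb H0).
set (m := (2 * n)%nat) in *.
destruct (mat_bounded m K) as [c [Hc HKc]].
(* [INR m * c] dominates K on unit vectors, 1 dominates the cross term from C, and the remaining 1
   makes the inequality strict. *)
set (kap := INR m * c + 2).
assert (Hm := pos_INR m).
assert (Hkap : 0 < kap) by (unfold kap; nra).
assert (Hunit : forall w, 0 < t0 < d -> dot m w w = 1 -> quad m (J t0) w <= 0).
{ intros w Ht0 Hw. apply Rnot_lt_le; intros Hpos.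
  (* At time [t0] the perturbation [eta * exp (kap * t0)] is then below 1 and below the value of the
     form assumed positive. *)
  set (eta := Rmin 1 (quad m (J t0) w) / 2 * exp (- kap * t0)).
  assert (Hmn : 0 < Rmin 1 (quad m (J t0) w)) by (apply Rmin_glb_lt; lra).
  assert (He : 0 < eta) by (apply Rmult_lt_0_compat; [lra|apply exp_pos]).
  assert (Het : eta * exp (kap * t0) = Rmin 1 (quad m (J t0) w) / 2).
  { unfold eta. rewrite Rmult_assoc, <- exp_plus. replace (- kap * t0 + kap * t0) with 0 by ring. rewrite exp_0; ring. }
  (* Entries this small make the form of [J s] smaller than [eta] on unit vectors, so the perturbed
     form is positive at the starting time [s]. *)
  destruct (H0 (eta / (INR m + 1))) as [del [Hdel H1]]; [apply Rdiv_lt_0_compat; lra|].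
  set (s := Rmin del t0 / 2).
  assert (A0 : 0 < Rmin del t0) by (apply Rmin_glb_lt; lra).
  assert (A1 := Rmin_l del t0). assert (A2 := Rmin_r del t0).
  assert (Hs : 0 < s < t0) by (unfold s; lra).
  set (X := fun t i j => -1 * J t i j + eta * exp (kap * t) * idm i j).
  set (P := fun t => mmul m (mmul m (J t) (riccati_rhs n (N t) K)) (J t)).
  set (X' := fun t i j => -1 * (-1 * P t i j) + kap * (eta * exp (kap * t)) * idm i j).
  assert (Hfin : 0 < quad m (X t0) w).
  { apply (pos_def_preserved m X X' s t0); auto; try lra.
    - intros t i j Ht Hi Hj. unfold X, X'.
      apply (der_ext (fun r => -1 * J r i j + eta * idm i j * exp (kap * r)) _ _ (-1 * - P t i j + eta * idm i j * (exp (kap * t) * (kap * 1)))); [intros; ring|ring|].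
      apply der_plus.
      + apply der_scal. apply (inverse_deriv m N (fun t => riccati_rhs n (N t) K) J d); auto; try lra.
        intros; apply HN; auto; lra.
      + apply der_scal, (der_exp (fun t => kap * t)), der_scal, der_id.
    - intros t i j Ht. apply symmetric_shift, HJs. lra.
    - intros v Hv. unfold X. rewrite quad_shift, Hv.
      assert (B : Rabs (quad m (J s) v) <= INR m * (eta / (INR m + 1)) * dot m v v).
      { apply quad_le. intros; left; apply H1; auto; unfold s; lra. }
      rewrite Hv in B. apply Rabs_le_between in B.
      assert (1 < exp (kap * s)) by (rewrite <- exp_0; apply exp_increasing; apply Rmult_lt_0_compat; lra).
      assert (INR m * (eta / (INR m + 1)) < eta).
      { apply (Rmult_lt_reg_r (INR m + 1)); [lra|]. replace (INR m * (eta / (INR m + 1)) * (INR m + 1)) with (INR m * eta) by (field; lra). nra. }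
      nra.
    - intros t v Ht Hv Hker.
      set (mu := eta * exp (kap * t)).
      assert (Hmu0 : 0 < mu) by (apply Rmult_lt_0_compat; auto; apply exp_pos).
      assert (Hmu1 : mu <= 1).
      { apply Rle_trans with (eta * exp (kap * t0)).
        - apply Rmult_le_compat_l; [lra|]. destruct (proj2 Ht) as [L|E]; [left; apply exp_increasing; apply Rmult_lt_compat_l; auto|right; rewrite E; auto].
        - rewrite Het. assert (Rmin 1 (quad m (J t0) w) <= 1) by apply Rmin_l. lra. }
      assert (HJv : forall i, (i < m)%nat -> mv m (J t) v i = mu * v i).
      { intros i Hi. specialize (Hker i Hi). unfold X in Hker. rewrite mv_shift in Hker; auto. fold mu in Hker. lra. }
      assert (HNv : forall i, (i < m)%nat -> mv m (N t) v i = / mu * v i).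
      { intros i Hi. assert (E : mv m (N t) (mv m (J t) v) i = v i).
        { rewrite <- mv_mmul. rewrite (mv_ext m _ idm v v); auto; [apply mv_idm; auto|]. intros; apply HJ; auto; lra. }
        rewrite (mv_ext m (N t) (N t) _ (fun j => mu * v j)) in E; auto.
        assert (E' : mv m (N t) (fun j => mu * v j) i = mu * mv m (N t) v i).
        { unfold mv. rewrite <- sumR_scal. apply sumR_ext; intros; ring. }
        rewrite E' in E. rewrite <- E. field. lra. }
      unfold X'. rewrite quad_shift, quad_scal_mat, Hv. unfold P. rewrite dot_mmul3; [|apply HJs; lra].
      rewrite (quad_ext m _ (riccati_rhs n (N t) K) _ (fun i => mu * v i)); auto. rewrite quad_scal.
      unfold m. rewrite (quad_riccati_eigen n (N t) K v (/ mu)); auto.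
      2: { apply (inverse_symmetric _ _ (J t)); [apply HJ; lra|apply HJs; lra]. }
      fold mu. fold m.
      assert (B : Rabs (quad m K v) <= INR m * c * dot m v v) by (apply quad_le; auto).
      rewrite Hv in B. apply Rabs_le_between in B.
      generalize (cross_le n v). fold m. rewrite Hv. intros B2. apply Rabs_le_between in B2.
      set (cr := sumR n (fun k => v (n + k)%nat * v k)) in *.
      assert (P2 : 0 <= sumR n (fun k => v (n + k)%nat ^ 2)) by (apply sumR_pos; intros; apply pow2_ge_0).
      replace (mu ^ 2 * (2 * (/ mu) ^ 2 * sumR n (fun k => v (n + k)%nat ^ 2) - 2 * / mu * cr - quad m K v))
        with (2 * sumR n (fun k => v (n + k)%nat ^ 2) - mu * (2 * cr) - mu ^ 2 * quad m K v) by (field; lra).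
      unfold kap. fold kap.
      assert (mu * (2 * cr) <= mu * 1) by (apply Rmult_le_compat_l; lra).
      assert (mu ^ 2 * quad m K v <= mu * (INR m * c)).
      { apply Rle_trans with (mu ^ 2 * (INR m * c)); [apply Rmult_le_compat_l; [apply pow2_ge_0|lra]|].
        apply Rmult_le_compat_r; [nra|]. simpl. nra. }
      change (kap) with (INR m * c + 2). nra. }
  unfold X in Hfin. rewrite quad_shift, Hw, Het in Hfin.
  assert (Rmin 1 (quad m (J t0) w) <= quad m (J t0) w) by apply Rmin_r. lra. }
intros w Ht. rewrite <- (Rmult_0_l (dot m w w)). apply quad_le_of_unit. auto.
Qed.

(** Cauchy-Schwarz for the semidefinite form [- J], between [N w] and [w], reads
    [|w|^4 <= (- N(w,w)) (- J(w,w))]. As [J] is small near 0, [- N(w,w)] is at least a large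
    multiple of [|w|^2]. *)
Lemma riccati_neg_near_0 n K N : symmetric (2 * n) K -> riccati_solution n K N ->
  inv_tends_to_zero (2 * n) N -> forall M, exists d, 0 < d /\
  forall t w, 0 < t < d -> quad (2 * n) (N t) w <= - M * dot (2 * n) w w.
Proof.
intros HK HN Hinv M. destruct (inv_tends_bounded _ _ Hinv) as [J [d [Hd [HJ [Hb H0]]]]].
assert (HJs := inverse_symmetric_near_0 n K N J d HK HN HJ Hb H0).
assert (HJn := inverse_nonpos_near_0 n K N J d HK HN Hd HJ Hb H0).
set (m := (2 * n)%nat) in *.
set (M' := Rabs M + 1). assert (HM : 0 < M' /\ M <= M').
{ unfold M'. generalize (Rabs_pos M) (Rle_abs M). lra. }
assert (Hm := pos_INR m).
assert (Hmm : 0 < M' * (INR m + 1)) by (apply Rmult_lt_0_compat; lra).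
destruct (H0 (/ (M' * (INR m + 1)))) as [del [Hdel H1]]; [apply Rinv_0_lt_compat; auto|].
exists (Rmin d del). assert (A1 := Rmin_l d del). assert (A2 := Rmin_r d del).
split; [apply Rmin_glb_lt; auto|]. intros t w Ht.
set (eta := mv m (N t) w).
assert (E : forall i, (i < m)%nat -> mv m (J t) eta i = w i).
{ intros i Hi. unfold eta. rewrite <- mv_mmul. rewrite (mv_ext m _ idm w w); auto; [apply mv_idm; auto|].
  intros j Hj. apply MatrixInverse.is_inverse_comm; auto. apply HJ; lra. }
assert (Q1 : quad m (N t) w = quad m (J t) eta).
{ rewrite !quad_dot. fold eta. rewrite dot_comm. apply dot_ext; auto. intros; symmetry; auto. }
assert (D : (- dot m w (mv m (J t) eta)) ^ 2 <= (- quad m (J t) eta) * (- quad m (J t) w)).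
{ apply nonneg_quadratic_disc. intros s. generalize (HJn t (vadd eta w s)).
  rewrite quad_vadd; [|apply HJs; lra]. intros G. assert (Ht' : 0 < t < d) by lra. specialize (G Ht'). lra. }
rewrite (dot_ext m w w (mv m (J t) eta) w) in D; auto.
assert (B : Rabs (quad m (J t) w) <= INR m * / (M' * (INR m + 1)) * dot m w w).
{ apply quad_le. intros; left; apply H1; auto; lra. }
assert (B' : INR m * / (M' * (INR m + 1)) * dot m w w <= / M' * dot m w w).
{ apply Rmult_le_compat_r; [apply dot_self_ge0|]. apply (Rmult_le_reg_r (M' * (INR m + 1))); auto.
  rewrite Rmult_assoc, Rinv_l by lra. replace (/ M' * (M' * (INR m + 1))) with (INR m + 1) by (field; lra). lra. }
apply Rabs_le_between in B. rewrite <- Q1 in D.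
assert (W := dot_self_ge0 m w).
assert (N0 : quad m (N t) w <= 0) by (rewrite Q1; apply HJn; lra).
assert (D2 : dot m w w ^ 2 <= - quad m (N t) w * (/ M' * dot m w w)).
{ apply Rle_trans with (- quad m (N t) w * - quad m (J t) w); [lra|]. apply Rmult_le_compat_l; lra. }
destruct W as [W|W]; [|rewrite <- W; lra].
assert (D3 : M' * dot m w w <= - quad m (N t) w).
{ apply (Rmult_le_reg_r (/ M' * dot m w w)).
  - apply Rmult_lt_0_compat; auto. apply Rinv_0_lt_compat; lra.
  - replace (M' * dot m w w * (/ M' * dot m w w)) with (dot m w w ^ 2) by (field; lra). auto. }
assert (M * dot m w w <= M' * dot m w w) by (apply Rmult_le_compat_r; lra). lra.
Qed.

(** Negativity near 0 is propagated by keeping [- N - mu(t) I] positive definite for a decaying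
    [mu]; non-negativity of K gives its term the favourable sign. The resulting uniform [eta] is
    what bounds [w] in the two-point argument. *)
Lemma riccati_negative n K N : symmetric (2 * n) K -> (forall w, 0 <= quad (2 * n) K w) -> riccati_solution n K N ->
  inv_tends_to_zero (2 * n) N -> forall s T, 0 < s -> exists eta, 0 < eta /\
  forall t w, s <= t <= T -> quad (2 * n) (N t) w <= - eta * dot (2 * n) w w.
Proof.
intros HK HKp HN Hinv s T Hs.
assert (HNs := riccati_symmetric n K N HK HN Hinv).
destruct (riccati_neg_near_0 n K N HK HN Hinv 2) as [d [Hd H2]].
set (m := (2 * n)%nat) in *.
set (a := Rmin s (d / 2)).
assert (A0 : 0 < a) by (apply Rmin_glb_lt; lra). assert (A1 := Rmin_l s (d / 2)). assert (A2 := Rmin_r s (d / 2)).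
fold a in A1, A2.
(* At a unit null vector [N w = - mu w], and since [mu <= 1] the D term costs at most [2 mu] and the
   C term at most [mu]; rate 4 exceeds the total. At time [a] one has [N <= -2] and [mu = 1]. *)
set (mu := fun t => exp (- 4 * (t - a))).
destruct (Rle_lt_dec s T) as [HsT|HsT]; [|exists 1; split; [lra|intros; lra]].
assert (Hfin : forall t w, a <= t <= T -> dot m w w = 1 -> 0 < quad m (fun i j => -1 * N t i j + - mu t * idm i j) w).
{ apply (pos_def_preserved m (fun t i j => -1 * N t i j + - mu t * idm i j)
    (fun t i j => -1 * riccati_rhs n (N t) K i j + 4 * mu t * idm i j)).
  - intros t i j Ht Hi Hj.
    apply (der_ext (fun r => -1 * N r i j - idm i j * mu r) _ _ (-1 * riccati_rhs n (N t) K i j - idm i j * (mu t * (- 4 * (1 - 0))))); [intros; ring|ring|].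
    apply der_minus; [apply der_scal, HN; auto; lra|]. apply der_scal. unfold mu.
    apply (der_exp (fun r => -4 * (r - a))), (der_scal (fun r => r - a)), der_minus; [apply der_id|apply der_const].
  - intros t i j Ht. apply symmetric_shift, HNs. lra.
  - intros w Hw. rewrite quad_shift, Hw. unfold mu. replace (-4 * (a - a)) with 0 by ring. rewrite exp_0.
    specialize (H2 a w). rewrite Hw in H2. assert (quad m (N a) w <= -2 * 1) by (apply H2; lra). lra.
  - intros t w Ht Hw Hker. rewrite quad_shift, Hw.
    assert (Hmu0 : 0 < mu t) by apply exp_pos.
    assert (Hmu1 : mu t <= 1). { unfold mu. rewrite <- exp_0. left; apply exp_increasing. lra. }
    unfold m. rewrite (quad_riccati_eigen n (N t) K w (- mu t)); [|apply HNs; lra|].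
    + fold m. specialize (HKp w).
      generalize (cross_le n w). fold m. rewrite Hw. intros B2. apply Rabs_le_between in B2.
      set (cr := sumR n (fun k => w (n + k)%nat * w k)) in *.
      generalize (dot_double n w). fold m. rewrite Hw. intros DD.
      assert (0 <= sumR n (fun k => w k ^ 2)) by (apply sumR_pos; intros; apply pow2_ge_0).
      set (vv := sumR n (fun k => w (n + k)%nat ^ 2)) in *.
      assert (0 <= vv) by (apply sumR_pos; intros; apply pow2_ge_0).
      assert (mu t ^ 2 * vv <= mu t * 1).
      { replace (mu t ^ 2 * vv) with (mu t * (mu t * vv)) by ring. apply Rmult_le_compat_l; [lra|]. nra. }
      assert (mu t * (2 * cr) >= mu t * - 1) by (apply Rmult_ge_compat_l; lra). nra.
    + intros i Hi. specialize (Hker i Hi). rewrite mv_shift in Hker; auto. fold m. lra. }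
exists (mu T). split; [apply exp_pos|].
intros t w Ht.
assert (Hmono : mu T <= mu t).
{ unfold mu. destruct (Req_dec t T) as [->|Hne]; [lra|]. left; apply exp_increasing. lra. }
apply quad_le_of_unit. intros v Hv. specialize (Hfin t v ltac:(lra) Hv).
rewrite quad_shift, Hv in Hfin. lra.
Qed.

(** * Moving Gaussians and the Harnack inequality *)

Definition kinetic_stationary n (u : (nat -> R) -> R) (ux uv uvv : nat -> (nat -> R) -> R) (h : (nat -> R) -> R) :=
  (forall z, 0 < u z) /\ scont (2 * n) u /\
  (forall i, (i < n)%nat -> Dp i u (ux i) /\ Dp (n + i) u (uv i) /\ Dp (n + i) (uv i) (uvv i)) /\
  forall z, sumR n (fun i => uvv i z) - sumR n (fun i => z (n + i)%nat * ux i z) + h z * u z = 0.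

(** Exponent of a kinetic Gaussian of width parameter [c]: lengths in X and V scale as [c ^ (-3/2)]
    and [c ^ (-1/2)], as in the Kolmogorov kernel with [c] an inverse time. [qfx], [qfv] and [qfc]
    are its derivatives in X, V and [c]. *)
Definition qf c X V := c ^ 3 / 8 * X ^ 2 - c ^ 2 / 4 * (X * V) + c / 2 * V ^ 2.
Definition qfx c X V := c ^ 3 / 4 * X - c ^ 2 / 4 * V.
Definition qfv c X V := - c ^ 2 / 4 * X + c * V.
Definition qfc c X V := 3 * c ^ 2 / 8 * X ^ 2 - c / 2 * (X * V) + V ^ 2 / 2.
Definition qsum n c (b z : nat -> R) := sumR n (fun i => qf c (z i - b i) (z (n + i)%nat - b (n + i)%nat)).

Definition Qx n c (b z : nat -> R) i := qfx c (z i - b i) (z (n + i)%nat - b (n + i)%nat).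
Definition Qv n c (b z : nat -> R) i := qfv c (z i - b i) (z (n + i)%nat - b (n + i)%nat).
Definition Qc n c (b z : nat -> R) i := qfc c (z i - b i) (z (n + i)%nat - b (n + i)%nat).

Lemma qf_lower c X V : 0 <= c -> 2 <= c -> c / 16 * (X ^ 2 + V ^ 2) <= qf c X V.
Proof.
intros Hc Hc2. unfold qf.
assert (0 <= c / 16 * (c * X - 2 * V) ^ 2 * 1) by (apply Rmult_le_pos; [apply Rmult_le_pos; [lra|apply pow2_ge_0]|lra]).
assert (0 <= c * (c ^ 2 - 4) * X ^ 2) by (apply Rmult_le_pos; [apply Rmult_le_pos; nra|apply pow2_ge_0]).
assert (0 <= c * V ^ 2) by (apply Rmult_le_pos; [lra|apply pow2_ge_0]).
assert (0 <= c * X ^ 2) by (apply Rmult_le_pos; [lra|apply pow2_ge_0]).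
assert (0 <= c * (c * X - 2 * V) ^ 2) by (apply Rmult_le_pos; [lra|apply pow2_ge_0]).
nra.
Qed.

(* Q = 2 qf is chosen so that (1/2)(Q y)_v^2 + y_v (Q y)_x has no cross term. *)
Lemma qf_dissipation c c' s ab X V : 3 <= c -> 16 * s <= c ^ 2 -> - c ^ 2 / 40 <= c' <= 0 ->
  - c - ab ^ 2 / 2 + s * (X ^ 2 + V ^ 2) + c / 32 * qf c X V <=
  qfv c X V ^ 2 - c + V * qfx c X V + c' * qfc c X V - qfv c X V * ab.
Proof.
intros Hc Hs Hc'.
assert (E : / 2 * qfv c X V ^ 2 + V * qfx c X V = c ^ 4 / 32 * X ^ 2 + c ^ 2 / 4 * V ^ 2) by (unfold qfv, qfx; field).
assert (A : qfv c X V ^ 2 - qfv c X V * ab >= / 2 * qfv c X V ^ 2 - ab ^ 2 / 2) by (generalize (pow2_ge_0 (qfv c X V - ab)); nra).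
assert (X2 := pow2_ge_0 X). assert (V2 := pow2_ge_0 V).
assert (Q0 : 0 <= qfc c X V).
{ unfold qfc. replace (3 * c ^ 2 / 8 * X ^ 2 - c / 2 * (X * V) + V ^ 2 / 2) with ((V - c / 2 * X) ^ 2 / 2 + (c * X) ^ 2 / 4) by field.
  generalize (pow2_ge_0 (V - c / 2 * X)) (pow2_ge_0 (c * X)). lra. }
assert (Q1 : qfc c X V <= 5 / 8 * c ^ 2 * X ^ 2 + 3 / 4 * V ^ 2).
{ unfold qfc. generalize (pow2_ge_0 (V + c * X)). nra. }
assert (B : c' * qfc c X V >= - c ^ 2 / 40 * (5 / 8 * c ^ 2 * X ^ 2 + 3 / 4 * V ^ 2)).
{ assert (c' * qfc c X V >= - c ^ 2 / 40 * qfc c X V) by (apply Rmult_ge_compat_r; lra).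
  assert (c ^ 2 / 40 * qfc c X V <= c ^ 2 / 40 * (5 / 8 * c ^ 2 * X ^ 2 + 3 / 4 * V ^ 2)) by (apply Rmult_le_compat_l; auto; generalize (pow2_ge_0 c); lra).
  lra. }
assert (Q2 : qf c X V <= c ^ 3 / 4 * X ^ 2 + 5 * c / 8 * V ^ 2).
{ unfold qf. assert (0 <= c * (c * X + V) ^ 2) by (apply Rmult_le_pos; [lra|apply pow2_ge_0]). nra. }
assert (B2 : c / 32 * qf c X V <= c / 32 * (c ^ 3 / 4 * X ^ 2 + 5 * c / 8 * V ^ 2)) by (apply Rmult_le_compat_l; lra).
assert (S1 : s * X ^ 2 <= c ^ 4 / 128 * X ^ 2).
{ apply Rmult_le_compat_r; auto. assert (9 <= c ^ 2) by nra. nra. }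
assert (S2 : s * V ^ 2 <= c ^ 2 / 16 * V ^ 2) by (apply Rmult_le_compat_r; lra).
assert (P1 : 0 <= c ^ 4 * X ^ 2) by (apply Rmult_le_pos; auto; replace (c ^ 4) with ((c ^ 2) ^ 2) by ring; apply pow2_ge_0).
assert (P2 : 0 <= c ^ 2 * V ^ 2) by (apply Rmult_le_pos; auto; apply pow2_ge_0).
nra.
Qed.

Lemma Dp_qsum_x n c b i : (i < n)%nat -> Dp i (qsum n c b) (fun z => Qx n c b z i).
Proof.
intros Hi.
apply (Dp_ext i (qsum n c b) (fun z => sumR n (fun j => if Nat.eq_dec j i then Qx n c b z j else 0)) _ _); auto.
- apply Dp_sumR. intros j Hj z. unfold upd. destruct (Nat.eq_dec (n + j) i); [lia|].
  destruct (Nat.eq_dec j i) as [->|]; [|apply der_const].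
  unfold qf, Qx, qfx. auto_derive; auto. field.
- intros z. apply sumR_delta; auto.
Qed.

Lemma Dp_qsum_v n c b i : (i < n)%nat -> Dp (n + i) (qsum n c b) (fun z => Qv n c b z i).
Proof.
intros Hi.
apply (Dp_ext (n + i) (qsum n c b) (fun z => sumR n (fun j => if Nat.eq_dec j i then Qv n c b z j else 0)) _ _); auto.
- apply Dp_sumR. intros j Hj z. unfold upd. destruct (Nat.eq_dec j (n + i)); [lia|].
  destruct (Nat.eq_dec j i) as [->|].
  + destruct (Nat.eq_dec (n + i) (n + i)); [|lia]. unfold qf, Qv, qfv. auto_derive; auto. field.
  + destruct (Nat.eq_dec (n + j) (n + i)); [lia|]. apply der_const.
- intros z. apply sumR_delta; auto.
Qed.

Lemma Dp_Qv n c b i : (i < n)%nat -> Dp (n + i) (fun z => Qv n c b z i) (fun _ => c).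
Proof.
intros Hi z. unfold Qv, upd. destruct (Nat.eq_dec i (n + i)); [lia|].
destruct (Nat.eq_dec (n + i) (n + i)); [|lia]. unfold qfv. auto_derive; auto. field.
Qed.

Lemma der_qsum_t n (c : R -> R) (c' : R) (b : R -> nat -> R) (b' z : nat -> R) t :
  is_derive c t c' -> (forall i, (i < 2 * n)%nat -> is_derive (fun s => b s i) t (b' i)) ->
  is_derive (fun s => qsum n (c s) (b s) z) t
   (sumR n (fun i => c' * Qc n (c t) (b t) z i - Qx n (c t) (b t) z i * b' i - Qv n (c t) (b t) z i * b' (n + i)%nat)).
Proof.
intros Hc Hb. apply (sumR_is_derive n (fun s i => qf (c s) (z i - b s i) (z (n + i)%nat - b s (n + i)%nat))).
intros i Hi. assert (H1 := Hb i ltac:(lia)). assert (H2 := Hb (n + i)%nat ltac:(lia)). unfold Qc, Qx, Qv.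
set (bx := fun s => b s i) in *. set (bv := fun s => b s (n + i)%nat) in *.
change (b t i) with (bx t). change (b t (n + i)%nat) with (bv t).
change (is_derive bx t (b' i)) in H1. change (is_derive bv t (b' (n + i)%nat)) in H2.
apply (der_ext (fun s => qf (c s) (z i - bx s) (z (n + i)%nat - bv s)) _ _
  (c' * qfc (c t) (z i - bx t) (z (n + i)%nat - bv t) - qfx (c t) (z i - bx t) (z (n + i)%nat - bv t) * b' i
   - qfv (c t) (z i - bx t) (z (n + i)%nat - bv t) * b' (n + i)%nat)); auto.
clearbody bx bv. unfold qf. auto_derive.
- repeat split; first [exact (ex_intro _ _ Hc) | exact (ex_intro _ _ H1) | exact (ex_intro _ _ H2)].
- assert (E1 : Derive c t = c') by (apply is_derive_unique; exact Hc).
  assert (E2 : Derive bx t = b' i) by (apply is_derive_unique; exact H1).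
  assert (E3 : Derive bv t = b' (n + i)%nat) by (apply is_derive_unique; exact H2).
  change (fun x : R => c x) with c; change (fun x : R => bx x) with bx; change (fun x : R => bv x) with bv.
  rewrite E1, E2, E3. unfold qfc, qfx, qfv. field.
Qed.

(** Subtracting the floor [d] makes the bump positive only on a bounded set, so comparison with the
    positive function [u] needs no information at infinity. *)
Definition bump n a d c b (z : nat -> R) := a * (exp (-1 * qsum n c b z) - d).
Definition bump_v n a c b i (z : nat -> R) := a * (exp (-1 * qsum n c b z) * (-1 * Qv n c b z i)).

Lemma Dp_bump n a d c b i f : Dp i (qsum n c b) f ->
  Dp i (bump n a d c b) (fun z => a * (exp (-1 * qsum n c b z) * (-1 * f z))).
Proof.
intros H. apply (Dp_ext _ _ _ _ _ (Dp_scal _ a _ _ (Dp_minus _ _ _ _ _ (Dp_exp _ _ _ (Dp_scal _ (-1) _ _ H)) (Dp_const _ d)))).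
- auto.
- intros z. ring.
Qed.

Lemma Dp_bump_vv n a c b i : (i < n)%nat ->
  Dp (n + i) (bump_v n a c b i) (fun z => a * exp (-1 * qsum n c b z) * (Qv n c b z i ^ 2 - c)).
Proof.
intros Hi. apply (Dp_ext _ _ _ _ _ (Dp_scal _ a _ _
  (Dp_mult _ _ _ _ _ (Dp_exp _ _ _ (Dp_scal _ (-1) _ _ (Dp_qsum_v n c b i Hi))) (Dp_scal _ (-1) _ _ (Dp_Qv n c b i Hi))))).
- auto.
- intros z. ring.
Qed.

(** The second summand solves [x' = - x ^ 2 / 40], the fastest widening that [qf_dissipation]
    tolerates. Its integral is [40 ln (1 + c0 t / 40)], so a very narrow initial bump costs only a
    logarithm of [c0]. *)
Definition decay_rate c1 c0 t := c1 + c0 / (1 + c0 * t / 40).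

Lemma decay_rate_deriv c1 c0 t : 0 < c0 -> 0 <= t ->
  is_derive (decay_rate c1 c0) t (- (c0 / (1 + c0 * t / 40)) ^ 2 / 40).
Proof.
intros Hc Ht. assert (0 <= c0 * t) by nra. unfold decay_rate. auto_derive; [lra|field; lra].
Qed.

Lemma dot_double_pair n y : dot (2 * n) y y = sumR n (fun i => y i ^ 2 + y (n + i)%nat ^ 2).
Proof. rewrite dot_double, <- sumR_plus; auto. Qed.

(** At a touching point one is left with [E (1 + q / 32) <= (n + 2) d], where [E = exp (- q) > d].
    If [q >= 32 (n + 1)] the left side exceeds [(n + 2) d]; otherwise
    [E > exp (- 32 (n + 1)) = (n + 2) d]. This floor makes both cases contradictory. *)
Definition bump_floor n := exp (- (32 * (INR n + 1))) / (INR n + 2).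

Lemma bump_floor_pos n : 0 < bump_floor n.
Proof. generalize (pos_INR n); intros. apply Rdiv_lt_0_compat; [apply exp_pos|lra]. Qed.

Lemma exp_le a b : a <= b -> exp a <= exp b.
Proof. intros [H| ->]; [left; apply exp_increasing; auto|lra]. Qed.

Lemma bump_floor_lt_half n : bump_floor n <= / 2.
Proof.
generalize (pos_INR n); intros. unfold bump_floor, Rdiv.
assert (exp (- (32 * (INR n + 1))) <= exp 0) by (apply exp_le; lra). rewrite exp_0 in *.
assert (/ (INR n + 2) <= / 2) by (apply Rinv_le_contravar; lra).
assert (0 < / (INR n + 2)) by (apply Rinv_0_lt_compat; lra).
assert (0 < exp (- (32 * (INR n + 1)))) by apply exp_pos.
rewrite <- (Rmult_1_l (/ 2)). apply Rmult_le_compat; lra.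
Qed.

Lemma qsum_lower n c b z : 2 <= c ->
  c / 16 * dot (2 * n) (vadd z b (-1)) (vadd z b (-1)) <= qsum n c b z.
Proof.
intros Hc. rewrite dot_double_pair, <- sumR_scal. apply sumR_le; intros i Hi.
unfold vadd. eapply Rle_trans; [|apply qf_lower; lra]. right. f_equal. ring.
Qed.

Lemma qsum_nonneg n c b z : 2 <= c -> 0 <= qsum n c b z.
Proof.
intros Hc. eapply Rle_trans; [|apply qsum_lower; auto]. apply Rmult_le_pos; [lra|apply dot_self_ge0].
Qed.

Lemma bump_pos n a d c b z : 0 < a -> 0 < d -> 0 < bump n a d c b z ->
  d < exp (-1 * qsum n c b z) /\ qsum n c b z < - ln d.
Proof.
intros Ha Hd H. unfold bump in H.
assert (E : d < exp (-1 * qsum n c b z)) by (apply Rnot_le_lt; intros Hle; nra).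
split; auto. apply ln_increasing in E; auto. rewrite ln_exp in E. lra.
Qed.

(** At a touching point the x-derivatives agree and the second v-derivatives are ordered, so the
    stationary equation for [u] yields an inequality for the bump. The last hypothesis is the sign
    of the time derivative at a first touching, with the positive amplitude [a] divided out. *)
Lemma bump_no_touching n u ux uv uvv h a c c' c1 s m0 (b b' z : nat -> R) :
  kinetic_stationary n u ux uv uvv h -> 0 < a -> 3 <= c1 -> 0 <= s -> 16 * s <= c1 ^ 2 -> c1 <= c ->
  - c ^ 2 / 40 <= c' <= 0 -> (forall i, (i < n)%nat -> b' i = b (n + i)%nat) ->
  sumR n (fun i => b' (n + i)%nat ^ 2) <= 2 * c1 ->
  m0 - s * dot (2 * n) (vadd z b (-1)) (vadd z b (-1)) <= h z ->
  (forall y, bump n a (bump_floor n) c b y <= u y) -> u z = bump n a (bump_floor n) c b z ->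
  let E := exp (-1 * qsum n c b z) in
  0 <= (m0 - (INR n + 2) * c) * (E - bump_floor n)
    + E * (-1 * sumR n (fun i => c' * Qc n c b z i - Qx n c b z i * b' i - Qv n c b z i * b' (n + i)%nat)) ->
  False.
Proof.
intros (Hu & _ & HD & HPDE) Ha Hc1 Hs Hs16 Hcc Hc' Hbx Hab Hhz Hge Heq E Htime.
assert (Hn := pos_INR n). set (del := bump_floor n) in *.
assert (Hdel : 0 < del) by apply bump_floor_pos.
destruct (bump_pos n a del c b z Ha Hdel) as [Q2 _]; [rewrite <- Heq; auto|].
change (exp (-1 * qsum n c b z)) with E in Q2.
assert (HE : 0 < E) by apply exp_pos.
set (W := bump n a del c b) in *.
assert (Hmin : forall i y, u (upd z i (z i)) - W (upd z i (z i)) <= u (upd z i y) - W (upd z i y)).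
{ intros i y. rewrite upd_same, Heq. specialize (Hge (upd z i y)). lra. }
assert (Hx : forall i, (i < n)%nat -> ux i z = - (a * E * Qx n c b z i)).
{ intros i Hi.
  assert (M := min_deriv _ _ _ 1 (Dp_minus _ _ _ _ _ (proj1 (HD i Hi)) (Dp_bump n a del c b i _ (Dp_qsum_x n c b i Hi)) z) Rlt_0_1 (fun y _ => Hmin i y)).
  cbv beta in M. fold E in M. lra. }
assert (Hvv : forall i, (i < n)%nat -> a * E * (Qv n c b z i ^ 2 - c) <= uvv i z).
{ intros i Hi. destruct (HD i Hi) as (_ & D1 & D2).
  assert (M := min_deriv2 _ _ _ _ 1 Rlt_0_1
    (fun s _ => Dp_at _ _ _ z s (Dp_minus _ _ _ _ _ D1 (Dp_bump n a del c b _ _ (Dp_qsum_v n c b i Hi))))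
    (Dp_minus _ _ _ _ _ D2 (Dp_bump_vv n a c b i Hi) z) (fun y _ => Hmin (n + i)%nat y)).
  cbv beta in M. fold E in M. lra. }
set (q' := sumR n _) in Htime.
set (Sg := sumR n (fun i => Qv n c b z i ^ 2 - c + z (n + i)%nat * Qx n c b z i)).
set (Y := dot (2 * n) (vadd z b (-1)) (vadd z b (-1))) in *. set (q := qsum n c b z) in *.
assert (Hpde : E * Sg + h z * (E - del) <= 0).
{ apply Rnot_lt_le; intros Hpos. specialize (HPDE z).
  assert (Hle : a * E * Sg <= sumR n (fun i => uvv i z) - sumR n (fun i => z (n + i)%nat * ux i z)).
  { unfold Sg. rewrite <- sumR_scal, <- sumR_minus. apply sumR_le; intros i Hi. rewrite Hx; auto. specialize (Hvv i Hi). nra. }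
  assert (0 < a * (E * Sg + h z * (E - del))) by (apply Rmult_lt_0_compat; auto).
  rewrite Heq in HPDE. unfold W, bump in HPDE. fold q E in HPDE. nra. }
(* [qf_dissipation] summed over the pairs of coordinates. Because the centre moves with its own
   velocity, transport and centre motion combine into the relative velocity [V] times [qfx]. *)
assert (Hsum : - INR n * c - c1 + s * Y + c / 32 * q <= Sg + q').
{ apply Rle_trans with (INR n * - c - / 2 * sumR n (fun i => b' (n + i)%nat ^ 2) + s * Y + c / 32 * q); [lra|].
  unfold Y, q, qsum, Sg, q'. rewrite dot_double_pair, <- sumR_const, <- !sumR_scal, <- sumR_minus, <- !sumR_plus.
  apply sumR_le; intros i Hi.
  set (X := z i - b i). set (V := z (n + i)%nat - b (n + i)%nat).
  assert (L := qf_dissipation c c' s (b' (n + i)%nat) X V ltac:(lra) ltac:(nra) Hc').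
  rewrite (Hbx i Hi). unfold Qv, Qx, Qc, vadd. fold X V.
  replace (z i + -1 * b i) with X by (unfold X; ring). replace (z (n + i)%nat + -1 * b (n + i)%nat) with V by (unfold V; ring).
  replace (z (n + i)%nat) with (V + b (n + i)%nat) by (unfold V; ring). lra. }
assert (HY : 0 <= Y) by apply dot_self_ge0.
assert (Hq0 : 0 <= q) by (apply qsum_nonneg; lra).
assert (K1 := Rmult_le_compat_l E _ _ (Rlt_le _ _ HE) Hsum).
assert (K2 : (m0 - s * Y) * (E - del) <= h z * (E - del)) by (apply Rmult_le_compat_r; lra).
assert (K3 : 0 <= s * Y * del) by (apply (Rmult_le_pos (s * Y) del); [apply (Rmult_le_pos s Y); lra|lra]).
(* The amplitude rate [(n + 2) c] pays [n c] for the v-Laplacian and at most [c] for the control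
   cost [c1]; the last [c] is the gain on the left. *)
assert (K4 : E * (c + c / 32 * q) <= (INR n + 2) * c * del).
{ assert (E * (c - c1) >= 0) by (apply Rle_ge, Rmult_le_pos; lra). nra. }
assert (K5 : E * (1 + q / 32) <= (INR n + 2) * del).
{ apply (Rmult_le_reg_r c); [lra|]. eapply Rle_trans; [|eapply Rle_trans; [exact K4|]]; right; field. }
assert (K6 : q < 32 * (INR n + 1)).
{ apply Rnot_le_lt; intros Hle. assert (del * (1 + q / 32) < E * (1 + q / 32)) by (apply Rmult_lt_compat_r; lra).
  assert ((INR n + 2) * del <= del * (1 + q / 32)) by (rewrite (Rmult_comm _ del); apply Rmult_le_compat_l; lra). lra. }
assert (K7 : exp (- (32 * (INR n + 1))) < E) by (apply exp_increasing; lra).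
assert (K8 : (INR n + 2) * del = exp (- (32 * (INR n + 1)))) by (unfold del, bump_floor; field; lra).
assert (0 <= E * (q / 32)) by (apply Rmult_le_pos; lra). lra.
Qed.

Lemma lim_exp f (l : R) : is_lim_seq f l -> is_lim_seq (fun k => exp (f k)) (exp l).
Proof. apply is_lim_seq_continuous, derivable_continuous_pt, derivable_pt_exp. Qed.

Lemma lim_pow f (l : R) k : is_lim_seq f l -> is_lim_seq (fun j => f j ^ k) (l ^ k).
Proof. intros H. induction k; simpl; [apply is_lim_seq_const|]. apply is_lim_seq_mult'; auto. Qed.

Lemma lim_bump n d (ak ck : nat -> R) (bk zk : nat -> nat -> R) (a c : R) (b z : nat -> R) :
  is_lim_seq ak a -> is_lim_seq ck c -> (forall i, (i < 2 * n)%nat -> is_lim_seq (fun k => bk k i) (b i)) ->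
  (forall i, (i < 2 * n)%nat -> is_lim_seq (fun k => zk k i) (z i)) ->
  is_lim_seq (fun k => bump n (ak k) d (ck k) (bk k) (zk k)) (bump n a d c b z).
Proof.
intros La Lc Lb Lz. apply is_lim_seq_mult'; auto. apply is_lim_seq_minus'; [|apply is_lim_seq_const].
apply lim_exp, is_lim_seq_mult'; [apply is_lim_seq_const|]. apply sumR_lim. intros i Hi. unfold qf.
assert (L : forall j, (j < 2 * n)%nat -> is_lim_seq (fun k => zk k j - bk k j) (z j - b j)) by (intros; apply is_lim_seq_minus'; auto).
assert (L1 := L i ltac:(lia)). assert (L2 := L (n + i)%nat ltac:(lia)).
apply is_lim_seq_plus'; [apply is_lim_seq_minus'|]; repeat apply is_lim_seq_mult'; auto using lim_pow; apply is_lim_seq_const.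
Qed.

(* The truncated moving Gaussian exp(r) (exp(-q) - bump_floor) is a strict subsolution where it is
   positive, so u, which dominates it at time 0, is never touched by it. *)
Lemma gaussian_propagation n u ux uv uvv h (zb ab : R -> nat -> R) T m0 s c1 c0 mu :
  kinetic_stationary n u ux uv uvv h -> 0 < T -> 0 < c0 -> 3 <= c1 -> 0 <= s -> 16 * s <= c1 ^ 2 -> 0 < mu ->
  (forall t i, 0 <= t <= T -> (i < n)%nat -> is_derive (fun r => zb r i) t (zb t (n + i)%nat)) ->
  (forall t i, 0 <= t <= T -> (i < n)%nat -> is_derive (fun r => zb r (n + i)%nat) t (ab t i)) ->
  (forall t, 0 <= t <= T -> sumR n (fun i => ab t i ^ 2) <= 2 * c1) ->
  (forall t y, 0 <= t <= T -> m0 - s * dot (2 * n) y y <= h (vadd (zb t) y 1)) ->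
  (forall y, c0 * dot (2 * n) y y <= - 16 * ln (bump_floor n) -> mu <= u (vadd (zb 0) y 1)) ->
  mu / 4 * exp (m0 * T - (INR n + 2) * (c1 * T + 40 * ln (1 + c0 * T / 40))) <= u (zb T).
Proof.
intros Hst HT Hc0 Hc1 Hs Hs16 Hmu Hzx Hzv Hab Hh H0. assert (Hst' := Hst). destruct Hst as (Hu & Hcu & _).
assert (Hn := pos_INR n). set (del := bump_floor n) in *.
assert (Hdel : 0 < del) by apply bump_floor_pos.
assert (Hdel2 : del <= / 2) by apply bump_floor_lt_half.
set (c := decay_rate c1 c0). set (c' := fun t => - (c0 / (1 + c0 * t / 40)) ^ 2 / 40).
assert (Hc : forall t, 0 <= t -> is_derive c t (c' t)) by (intros; apply decay_rate_deriv; auto).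
assert (Hcc : forall t, 0 <= t -> c1 <= c t /\ - c t ^ 2 / 40 <= c' t <= 0).
{ intros t Ht. unfold c, decay_rate, c'.
  assert (Hx : 0 < c0 / (1 + c0 * t / 40)) by (apply Rdiv_lt_0_compat; auto; assert (0 <= c0 * t) by nra; lra).
  set (x := c0 / (1 + c0 * t / 40)) in *. generalize (pow2_ge_0 x). repeat split; nra. }
(* Primitive of [m0 - (n + 2) c(t)]: growth by the potential minus the cost of carrying the bump. *)
set (r := fun t => m0 * t - (INR n + 2) * (c1 * t + 40 * ln (1 + c0 * t / 40))).
assert (Hr : forall t, 0 <= t -> is_derive r t (m0 - (INR n + 2) * c t)).
{ intros t Ht. assert (0 <= c0 * t) by nra. unfold r, c, decay_rate. auto_derive; [lra|field; lra]. }
set (a := fun t => mu / 2 * exp (r t)).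
assert (Ha : forall t, 0 < a t) by (intros t; apply Rmult_lt_0_compat; [lra|apply exp_pos]).
set (W := fun t => bump n (a t) del (c t) (zb t)).
set (b' := fun t i => if Nat.ltb i n then zb t (n + i)%nat else ab t (i - n)%nat).
assert (Hbx : forall t i, (i < n)%nat -> b' t i = zb t (n + i)%nat) by (intros t i Hi; unfold b'; rewrite (proj2 (Nat.ltb_lt i n) Hi); auto).
assert (Hbv : forall t i, b' t (n + i)%nat = ab t i).
{ intros t i. unfold b'. rewrite (proj2 (Nat.ltb_ge (n + i) n)) by lia. f_equal. lia. }
assert (Hzb : forall t i, 0 <= t <= T -> (i < 2 * n)%nat -> is_derive (fun r => zb r i) t (b' t i)).
{ intros t i Ht Hi. destruct (Nat.lt_ge_cases i n) as [L|L]; [rewrite Hbx; auto|].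
  assert (G := Hzv t (i - n)%nat Ht ltac:(lia)). rewrite <- Hbv in G. replace (n + (i - n))%nat with i in G by lia. exact G. }
(* Where the initial bump is positive, [q < - ln del]; [qsum_lower] then places the point in the
   ball on which [u >= mu], while the bump is at most [mu / 2]. *)
assert (HW0 : forall z, W 0 z < u z).
{ intros z. destruct (Rle_lt_dec (W 0 z) 0) as [L|L]; [specialize (Hu z); lra|].
  destruct (bump_pos _ _ _ _ _ _ (Ha 0) Hdel L) as [Q2 Q1]. destruct (Hcc 0 (Rle_refl 0)) as [C1 _].
  assert (Ql := qsum_lower n (c 0) (zb 0) z ltac:(lra)). assert (Qn := qsum_nonneg n (c 0) (zb 0) z ltac:(lra)).
  set (y := vadd z (zb 0) (-1)) in *.
  assert (Hz : mu <= u z).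
  { replace z with (vadd (zb 0) y 1) by (apply functional_extensionality; intros i; unfold y, vadd; ring).
    apply H0. assert (Ec : c 0 = c1 + c0) by (unfold c, decay_rate; replace (1 + c0 * 0 / 40) with 1 by field; field).
    set (q0 := qsum n (c 0) (zb 0) z) in *. rewrite Ec in Ql.
    assert (0 <= c1 * dot (2 * n) y y) by (apply Rmult_le_pos; [lra|apply dot_self_ge0]). fold del. lra. }
  unfold W, bump, a in *. replace (r 0) with 0 in * by (unfold r; replace (1 + c0 * 0 / 40) with 1 by field; rewrite ln_1; ring).
  rewrite exp_0 in *. assert (exp (-1 * qsum n (c 0) (zb 0) z) <= 1) by (rewrite <- exp_0; apply exp_le; lra). nra. }
assert (HWlim : forall tk t (pk : nat -> nat -> R) (p : nat -> R), 0 <= t <= T -> is_lim_seq tk t ->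
   (forall i, (i < 2 * n)%nat -> is_lim_seq (fun k => pk k i) (p i)) -> is_lim_seq (fun k => W (tk k) (pk k)) (W t p)).
{ intros tk t pk p Ht L1 L2. apply lim_bump; auto.
  - apply is_lim_seq_mult'; [apply is_lim_seq_const|]. apply lim_exp, is_lim_seq_continuous; auto. eapply der_cont; apply Hr; lra.
  - apply is_lim_seq_continuous; auto. eapply der_cont; apply Hc; lra.
  - intros i Hi. apply (is_lim_seq_continuous (fun s => zb s i)); auto. eapply der_cont; apply Hzb; auto. }
assert (Hlt : forall t z, 0 <= t <= T -> W t z < u z).
{ intros t0 z0 Ht0. apply Rnot_le_lt; intros Hbad.
  destruct (derivs_bounded (2 * n) (fun t i _ => zb t i) (fun t i _ => b' t i) 0 T) as [B [HB HzB]]; [lra|intros; apply Hzb; auto|].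
  (* Bad points have [3 / 16 |z - zb|^2 <= q < - ln del], and [|x| <= 1 + x ^ 2] turns this into a
     bound on coordinates; [B] bounds the path. *)
  destruct (first_bad (2 * n) (fun t z => u z <= W t z) 0 T (B + (1 + - 16 / 3 * ln del))) with (t0 := t0) (p0 := z0)
    as [t [z [Ht [Htouch Hbefore]]]]; auto.
  - intros t p Ht Hp i Hi. destruct (Hcc t ltac:(lra)) as [C1 _].
    destruct (bump_pos n (a t) del (c t) (zb t) p) as [_ Q1]; auto; [specialize (Hu p); unfold W in Hp; lra|].
    assert (Ql := qsum_lower n (c t) (zb t) p ltac:(lra)).
    assert (G := coord_sq_le (2 * n) (vadd p (zb t) (-1)) i Hi).
    set (D := dot (2 * n) (vadd p (zb t) (-1)) (vadd p (zb t) (-1))) in *.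
    assert (0 <= D) by apply dot_self_ge0.
    assert (3 / 16 * D <= c t / 16 * D) by (apply Rmult_le_compat_r; lra).
    replace (p i) with (zb t i + vadd p (zb t) (-1) i) by (unfold vadd; ring).
    eapply Rle_trans; [apply Rabs_triang|]. apply Rplus_le_compat; [apply (HzB t i i); auto|].
    set (x := vadd p (zb t) (-1) i) in *. apply Rabs_le. split; nra.
  - intros tk t pk p Hk L1 L2.
    assert (Ht : 0 <= t <= T) by (apply (lim_interval tk); auto; apply Hk).
    apply (lim_le (fun k => u (pk k)) (fun k => W (tk k) (pk k))); auto. intros k; apply Hk.
  - intros p Hp. specialize (HW0 p). lra.
  - assert (Hbef : forall r p, 0 <= r < t -> 0 < u p - W r p).
    { intros r' p Hr'. apply Rlt_Rminus, Rnot_le_lt; intros Hle. apply (Hbefore r' p); auto. }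
    assert (Hge : forall p, W t p <= u p).
    { intros p. apply Rminus_le_0. apply (left_limit_nonneg (fun r => u p - W r p) 0 t); [lra|intros; apply Hbef; auto|].
      apply is_lim_seq_minus'; [apply is_lim_seq_const|]. apply HWlim; [lra|apply lim_approach|intros; apply is_lim_seq_const]. }
    assert (Heq : u z = W t z) by (apply Rle_antisym; auto).
    apply (bump_no_touching n u ux uv uvv h (a t) (c t) (c' t) c1 s m0 (zb t) (b' t) z Hst'); auto; try apply Hcc; try lra.
    + rewrite (sumR_ext n _ (fun i => ab t i ^ 2)); [apply Hab; lra|]. intros i _. rewrite Hbv; auto.
    + assert (G := Hh t (vadd z (zb t) (-1)) ltac:(lra)).
      replace (vadd (zb t) (vadd z (zb t) (-1)) 1) with z in G by (apply functional_extensionality; intros i; unfold vadd; ring). exact G.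
    + fold del. set (E := exp (-1 * qsum n (c t) (zb t) z)). set (q' := sumR n _).
      assert (Hq : is_derive (fun s => qsum n (c s) (zb s) z) t q') by (apply der_qsum_t; [apply Hc; lra|intros; apply Hzb; auto; lra]).
      assert (M : - (mu / 2 * (exp (r t) * (m0 - (INR n + 2) * c t)) * (E - del) + a t * (E * (-1 * q') - 0)) <= 0).
      { apply (left_min_deriv (fun s => u z - W s z) t _ t); [|lra|intros y Hy; rewrite Heq, Rminus_diag; left; rewrite <- Heq; apply Hbef; lra].
        apply (der_ext (fun s => u z - W s z) _ _ (0 - (mu / 2 * (exp (r t) * (m0 - (INR n + 2) * c t)) * (E - del) + a t * (E * (-1 * q') - 0)))); [auto|ring|].
        apply der_minus; [apply der_const|]. apply (der_mult a (fun s => exp (-1 * qsum n (c s) (zb s) z) - del)).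
        - apply der_scal, (der_exp r), Hr; lra.
        - apply der_minus; [|apply der_const]. apply (der_exp (fun s => -1 * qsum n (c s) (zb s) z)), der_scal; auto. }
      apply Rnot_lt_le; intros Hneg. specialize (Ha t). unfold a in *. nra. }
(* At the centre [q = 0] and [1 - del >= 1 / 2], which turns the amplitude factor [mu / 2] into
   [mu / 4]. *)
specialize (Hlt T (zb T) ltac:(lra)). unfold W, bump in Hlt.
assert (Qz : qsum n (c T) (zb T) (zb T) = 0).
{ apply sumR_0; intros i _. unfold qf. rewrite !Rminus_diag. ring. }
rewrite Qz, Rmult_0_r, exp_0 in Hlt. unfold a, r in Hlt. set (ex := exp _) in *. assert (0 < ex) by apply exp_pos.
assert (mu * ex * (/ 2 - del) >= 0) by (apply Rle_ge, Rmult_le_pos; [apply Rmult_le_pos|]; lra). nra.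
Qed.

(** * Harnack inequality, and quadratic upper bounds for [h] and [ln u] *)

Definition locally_semiconvex m (f : (nat -> R) -> R) (k1 k2 : R) :=
  forall z, exists p, forall y, dot m y y <= 1 ->
    f z + dot m p y - k1 * exp (k2 * dot m z z) * dot m y y <= f (vadd z y 1).

Definition semiconvex m (f : (nat -> R) -> R) (k : R) :=
  forall z, exists p, forall y, f z + dot m p y - k * dot m y y <= f (vadd z y 1).

Lemma vadd_vadd z a b : vadd (vadd z a 1) b 1 = vadd z (vadd a b 1) 1.
Proof. apply functional_extensionality; intros i. unfold vadd. ring. Qed.

Lemma vadd_0 z : vadd (fun _ => 0) z 1 = z.
Proof. apply functional_extensionality; intros i. unfold vadd. ring. Qed.

Lemma dot_0_0 m : dot m (fun _ => 0) (fun _ => 0) = 0.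
Proof. apply sumR_0; intros; ring. Qed.

Lemma semiconvex_lower m f k : 0 <= k -> semiconvex m f k ->
  exists c, 0 <= c /\ forall z, - c * (1 + dot m z z) <= f z.
Proof.
intros Hk H. destruct (H (fun _ => 0)) as [p Hp].
exists (Rabs (f (fun _ => 0)) + dot m p p + 1 + k).
assert (Pp := dot_self_ge0 m p). split; [generalize (Rabs_pos (f (fun _ => 0))); lra|].
intros z. specialize (Hp z). rewrite vadd_0 in Hp.
assert (Pz := dot_self_ge0 m z).
assert (G := dot_self_ge0 m (vadd p z 1)). rewrite dot_vadd_l, !dot_vadd_r, (dot_comm m z p) in G.
assert (A := Rabs_maj2 (f (fun _ => 0))).
assert (0 <= Rabs (f (fun _ => 0)) * dot m z z) by (apply Rmult_le_pos; auto; apply Rabs_pos).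
assert (0 <= dot m p p * dot m z z) by (apply Rmult_le_pos; auto).
nra.
Qed.

(** The centre is moved by [r] in the direction of [p]. On the shifted ball the first-order term has
    the good sign, so lower bounds there need no control on the size of the gradient [p]. *)
Lemma half_space_ball m p r : 0 <= r -> exists y1, dot m y1 y1 <= r ^ 2 /\
  forall y, dot m y y <= r ^ 2 -> 0 <= dot m p (vadd y1 y 1).
Proof.
intros Hr. assert (P := dot_self_ge0 m p).
destruct (Req_dec (dot m p p) 0) as [E|E].
- exists (fun _ => 0). rewrite dot_0_0. split; [apply pow2_ge_0|]. intros y _.
  right. symmetry. apply sumR_0. intros i Hi. rewrite (dot_self_0 m p E i Hi). ring.
- assert (Hs : 0 < sqrt (dot m p p)) by (apply sqrt_lt_R0; lra).
  assert (Hss := sqrt_sqrt (dot m p p) P). set (q := sqrt (dot m p p)) in *.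
  exists (fun i => r / q * p i). split.
  + rewrite dot_scal_l, dot_comm, dot_scal_l, <- Hss. right; field; lra.
  + intros y Hy. rewrite dot_vadd_r, (dot_comm m p), dot_scal_l, <- Hss.
    replace (r / q * (q * q)) with (r * q) by (field; lra).
    assert (C := dot_cauchy m p y). rewrite <- Hss in C.
    assert (C2 : dot m p y ^ 2 <= (q * r) ^ 2).
    { eapply Rle_trans; [exact C|]. replace ((q * r) ^ 2) with (q * q * r ^ 2) by ring. apply Rmult_le_compat_l; nra. }
    assert (0 <= q * r) by nra.
    apply Rnot_lt_le; intros Hlt. nra.
Qed.

(** Cubic Hermite interpolation: it joins any two phase points in unit time by a path with [x' = v].
    [herm1] and [herm2] are its velocity and acceleration, the latter being the control. *)
Definition herm x1 v1 x2 v2 t :=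
  (1 - 3 * t ^ 2 + 2 * t ^ 3) * x1 + (t - 2 * t ^ 2 + t ^ 3) * v1 + (3 * t ^ 2 - 2 * t ^ 3) * x2 + (t ^ 3 - t ^ 2) * v2.
Definition herm1 x1 v1 x2 v2 t :=
  (- 6 * t + 6 * t ^ 2) * x1 + (1 - 4 * t + 3 * t ^ 2) * v1 + (6 * t - 6 * t ^ 2) * x2 + (3 * t ^ 2 - 2 * t) * v2.
Definition herm2 x1 v1 x2 v2 t :=
  (- 6 + 12 * t) * x1 + (6 * t - 4) * v1 + (6 - 12 * t) * x2 + (6 * t - 2) * v2.

Lemma lincomb4_sq a b c d M x1 v1 x2 v2 : - M <= a <= M -> - M <= b <= M -> - M <= c <= M -> - M <= d <= M ->
  (a * x1 + b * v1 + c * x2 + d * v2) ^ 2 <= 4 * M ^ 2 * (x1 ^ 2 + v1 ^ 2 + x2 ^ 2 + v2 ^ 2).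
Proof.
intros Ha Hb Hc Hd.
assert (S : forall a x, - M <= a <= M -> (a * x) ^ 2 <= M ^ 2 * x ^ 2).
{ intros e x He. replace ((e * x) ^ 2) with (e ^ 2 * x ^ 2) by ring. apply Rmult_le_compat_r; [apply pow2_ge_0|nra]. }
assert (S1 := S a x1 Ha). assert (S2 := S b v1 Hb). assert (S3 := S c x2 Hc). assert (S4 := S d v2 Hd).
set (A := a * x1) in *. set (B := b * v1) in *. set (C := c * x2) in *. set (D := d * v2) in *.
assert (T : (A + B + C + D) ^ 2 <= 4 * (A ^ 2 + B ^ 2 + C ^ 2 + D ^ 2)).
{ generalize (pow2_ge_0 (A - B)) (pow2_ge_0 (A - C)) (pow2_ge_0 (A - D)) (pow2_ge_0 (B - C)) (pow2_ge_0 (B - D)) (pow2_ge_0 (C - D)). intros. lra. }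
lra.
Qed.

(** On the unit interval the coefficients are at most 1, 3/2 and 6 for position, velocity and
    acceleration; [lincomb4_sq] gives 4 + 9 = 13 and 4 * 36 = 144. *)
Lemma herm_bounds x1 v1 x2 v2 t : 0 <= t <= 1 ->
  herm x1 v1 x2 v2 t ^ 2 + herm1 x1 v1 x2 v2 t ^ 2 <= 13 * (x1 ^ 2 + v1 ^ 2 + x2 ^ 2 + v2 ^ 2) /\
  herm2 x1 v1 x2 v2 t ^ 2 <= 144 * (x1 ^ 2 + v1 ^ 2 + x2 ^ 2 + v2 ^ 2).
Proof.
intros Ht.
assert (T2 : 0 <= t ^ 2 <= t) by nra.
assert (T3 : 0 <= t * t ^ 2) by (apply Rmult_le_pos; lra).
assert (B0 := lincomb4_sq (1 - 3 * t ^ 2 + 2 * t ^ 3) (t - 2 * t ^ 2 + t ^ 3) (3 * t ^ 2 - 2 * t ^ 3) (t ^ 3 - t ^ 2) 1 x1 v1 x2 v2).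
assert (B1 := lincomb4_sq (- 6 * t + 6 * t ^ 2) (1 - 4 * t + 3 * t ^ 2) (6 * t - 6 * t ^ 2) (3 * t ^ 2 - 2 * t) (3 / 2) x1 v1 x2 v2).
assert (B2 := lincomb4_sq (- 6 + 12 * t) (6 * t - 4) (6 - 12 * t) (6 * t - 2) 6 x1 v1 x2 v2).
unfold herm, herm1, herm2.
assert (U : 0 <= t * (1 - t) ^ 2) by (apply Rmult_le_pos; [lra|apply pow2_ge_0]).
assert (U2 : 0 <= (1 - t) * t ^ 2) by (apply Rmult_le_pos; lra).
assert (U3 : 0 <= (1 - t) ^ 2 * (1 + 2 * t)) by (apply Rmult_le_pos; [apply pow2_ge_0|lra]).
assert (U4 := pow2_ge_0 (1 - 2 * t)).
assert (U5 := pow2_ge_0 (1 - 3 * t)).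
assert (U6 := pow2_ge_0 (2 - 3 * t)).
split; [|lra].
assert (U7 : 0 <= t ^ 2 * (3 - 2 * t)) by (apply Rmult_le_pos; lra).
assert (B0' : ((1 - 3 * t ^ 2 + 2 * t ^ 3) * x1 + (t - 2 * t ^ 2 + t ^ 3) * v1 + (3 * t ^ 2 - 2 * t ^ 3) * x2 + (t ^ 3 - t ^ 2) * v2) ^ 2 <= 4 * 1 ^ 2 * (x1 ^ 2 + v1 ^ 2 + x2 ^ 2 + v2 ^ 2)).
{ apply B0; split; lra. }
assert (B1' : ((- 6 * t + 6 * t ^ 2) * x1 + (1 - 4 * t + 3 * t ^ 2) * v1 + (6 * t - 6 * t ^ 2) * x2 + (3 * t ^ 2 - 2 * t) * v2) ^ 2 <= 4 * (3 / 2) ^ 2 * (x1 ^ 2 + v1 ^ 2 + x2 ^ 2 + v2 ^ 2)).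
{ apply B1; split; lra. }
lra.
Qed.

Lemma log_floor_pos n : 0 < - ln (bump_floor n).
Proof.
assert (H := bump_floor_lt_half n). assert (P := bump_floor_pos n).
assert (ln (bump_floor n) < ln 1) by (apply ln_increasing; lra). rewrite ln_1 in *. lra.
Qed.

Lemma ln_mu_exp mu E : 0 < mu -> ln (mu / 4 * exp E) = ln mu - ln 4 + E.
Proof.
intros H. unfold Rdiv. assert (0 < mu * / 4) by (apply Rmult_lt_0_compat; lra).
rewrite ln_mult, ln_mult, ln_Rinv, ln_exp; try lra. apply exp_pos.
Qed.

(** The starting ball has a radius exponentially small in [|z0|^2], so the initial concentration
    [c0] is exponentially large; as it enters only through a logarithm, its cost is quadratic in
    [|z0|], like the potential, the control and the length of the Hermite path. *)
Lemma harnack n u ux uv uvv h k1 k2 kap : kinetic_stationary n u ux uv uvv h ->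
  0 <= k1 -> 0 <= k2 -> locally_semiconvex (2 * n) (fun z => ln (u z)) k1 k2 ->
  0 <= kap -> (forall z, - kap * (1 + dot (2 * n) z z) <= h z) ->
  exists c, 0 <= c /\ forall z0 z, ln (u z0) - c * (1 + dot (2 * n) z0 z0 + dot (2 * n) z z) <= ln (u z).
Proof.
intros Hst Hk1 Hk2 Hsemi Hkap Hh.
assert (Hst0 := Hst). destruct Hst as (Hu & Hcu & _).
set (m := (2 * n)%nat) in *.
assert (Hn := pos_INR n).
set (l := - ln (bump_floor n)). assert (Hl : 0 < l) by apply log_floor_pos.
set (L0 := ln (1 + 8 / 5 * l * (k1 + 1))).
assert (HA : 0 <= 8 / 5 * l * (k1 + 1)) by (apply Rmult_le_pos; lra).
assert (HL0 : 0 <= L0). { unfold L0. rewrite <- ln_1. apply ln_le; lra. }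
assert (H4 : 0 < ln 4) by (rewrite <- ln_1; apply ln_increasing; lra).
set (c := 1 + ln 4 + 53 * kap + (INR n + 2) * (147 + 32 * kap + 40 * (L0 + k2))).
assert (Hc : 0 <= c).
{ unfold c. assert (0 <= (INR n + 2) * (147 + 32 * kap + 40 * (L0 + k2))) by (apply Rmult_le_pos; lra). lra. }
exists c. split; auto. intros z0 z.
set (D0 := dot m z0 z0). set (Dz := dot m z z).
assert (P0 : 0 <= D0) by apply dot_self_ge0. assert (Pz : 0 <= Dz) by apply dot_self_ge0.
destruct (Hsemi z0) as [p Hp]. fold D0 in Hp.
(* Points of the shifted ball are within [2 sqrt r2] of [z0], and with this [r2] the semiconvexity
   defect of [ln u] there is at most 1. *)
set (r2 := exp (- (k2 * D0)) / (4 * (k1 + 1))).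
assert (Hr2 : 0 < r2) by (apply Rdiv_lt_0_compat; [apply exp_pos|lra]).
assert (Hk2D : 0 <= k2 * D0) by (apply Rmult_le_pos; auto).
assert (Hr2' : r2 <= / 4).
{ unfold r2. apply (Rmult_le_reg_r (4 * (k1 + 1))); [lra|]. unfold Rdiv. rewrite Rmult_assoc, Rinv_l, Rmult_1_r by lra.
  assert (exp (- (k2 * D0)) <= exp 0) by (apply exp_le; lra). rewrite exp_0 in *. lra. }
assert (Hr2k : k1 * exp (k2 * D0) * (4 * r2) <= 1).
{ unfold r2. rewrite exp_Ropp. assert (0 < exp (k2 * D0)) by apply exp_pos.
  replace (k1 * exp (k2 * D0) * (4 * (/ exp (k2 * D0) / (4 * (k1 + 1))))) with (k1 / (k1 + 1)) by (field; lra).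
  apply (Rmult_le_reg_r (k1 + 1)); [lra|]. unfold Rdiv. rewrite Rmult_assoc, Rinv_l; lra. }
destruct (half_space_ball m p (sqrt r2) (sqrt_pos r2)) as [y1 [Hy1 Hy]].
replace (sqrt r2 ^ 2) with r2 in * by (simpl; rewrite Rmult_1_r, sqrt_sqrt; lra).
set (z1 := vadd z0 y1 1).
set (zb := fun t j => if Nat.ltb j n then herm (z1 j) (z1 (n + j)%nat) (z j) (z (n + j)%nat) t
  else herm1 (z1 (j - n)%nat) (z1 j) (z (j - n)%nat) (z j) t).
set (ab := fun t j => herm2 (z1 j) (z1 (n + j)%nat) (z j) (z (n + j)%nat) t).
assert (Zx : forall t j, (j < n)%nat -> zb t j = herm (z1 j) (z1 (n + j)%nat) (z j) (z (n + j)%nat) t).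
{ intros t j Hj. unfold zb. rewrite (proj2 (Nat.ltb_lt j n) Hj); auto. }
assert (Zv : forall t j, zb t (n + j)%nat = herm1 (z1 j) (z1 (n + j)%nat) (z j) (z (n + j)%nat) t).
{ intros t j. unfold zb. rewrite (proj2 (Nat.ltb_ge (n + j) n)) by lia. replace (n + j - n)%nat with j by lia. auto. }
set (D := dot m z1 z1 + Dz).
assert (PD1 : 0 <= dot m z1 z1) by apply dot_self_ge0.
assert (HDz1 : dot m z1 z1 <= 2 * D0 + 1 / 2).
{ unfold z1. eapply Rle_trans; [apply dot_sq_add_le|]. fold D0. lra. }
assert (HDsum : sumR n (fun i => z1 i ^ 2 + z1 (n + i)%nat ^ 2 + z i ^ 2 + z (n + i)%nat ^ 2) = D).
{ unfold D, Dz, m. rewrite !dot_double_pair, <- sumR_plus. apply sumR_ext; intros; ring. }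
assert (Hzz : forall t, 0 <= t <= 1 -> dot m (zb t) (zb t) <= 13 * D).
{ intros t Ht. unfold m. rewrite dot_double_pair, <- HDsum, <- sumR_scal. apply sumR_le; intros i Hi.
  rewrite Zx, Zv; auto. apply herm_bounds; auto. }
(* From [h >= - kap (1 + |zb + y|^2)] and [|zb|^2 <= 13 D]; the quadratic rest has coefficient
   [2 kap]. [c1] then has to satisfy [2 c1 >= 144 D], [c1 ^ 2 >= 32 kap] and [c1 >= 3]. *)
set (m0 := - kap * (1 + 26 * D)).
set (c1 := 72 * D + 32 * kap + 3).
(* Chosen so that the initial condition of [gaussian_propagation] concerns exactly the ball
   [|y|^2 <= r2]. *)
set (c0 := 16 * l / r2).
set (mu := exp (ln (u z0) - 1)).
assert (HPr := gaussian_propagation n u ux uv uvv h zb ab 1 m0 (2 * kap) c1 c0 mu Hst0 Rlt_0_1).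
assert (HD0 : 0 <= D) by (unfold D; lra).
assert (Hc0 : 0 < c0) by (apply Rdiv_lt_0_compat; lra).
assert (Hfin : mu / 4 * exp (m0 * 1 - (INR n + 2) * (c1 * 1 + 40 * ln (1 + c0 * 1 / 40))) <= u (zb 1)).
{ apply HPr; auto.
  - unfold c1; lra.
  - lra.
  - unfold c1. nra.
  - apply exp_pos.
  - intros t i Ht Hi. rewrite Zv. apply (der_ext (fun t => herm (z1 i) (z1 (n + i)%nat) (z i) (z (n + i)%nat) t) _ _ (herm1 (z1 i) (z1 (n + i)%nat) (z i) (z (n + i)%nat) t)); auto.
    + intros; rewrite Zx; auto.
    + unfold herm, herm1. auto_derive; auto. ring.
  - intros t i Ht Hi. apply (der_ext (fun t => herm1 (z1 i) (z1 (n + i)%nat) (z i) (z (n + i)%nat) t) _ _ (ab t i)); auto.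
    unfold herm1, ab, herm2. auto_derive; auto. ring.
  - intros t Ht. apply Rle_trans with (144 * D); [|unfold c1; lra].
    rewrite <- HDsum, <- sumR_scal. apply sumR_le; intros i Hi. apply herm_bounds; auto.
  - intros t y Ht. eapply Rle_trans; [|apply Hh].
    assert (G := dot_sq_add_le m (zb t) y). specialize (Hzz t Ht). unfold m0. fold m. assert (dot m (vadd (zb t) y 1) (vadd (zb t) y 1) <= 26 * D + 2 * dot m y y) by lra.
    assert (kap * dot m (vadd (zb t) y 1) (vadd (zb t) y 1) <= kap * (26 * D + 2 * dot m y y)) by (apply Rmult_le_compat_l; auto). lra.
  - intros y Hyy. fold l m in Hyy.
    assert (Hyr : dot m y y <= r2).
    { apply (Rmult_le_reg_l (16 * l / r2)); auto. replace (16 * l / r2 * r2) with (16 * l) by (field; lra).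
      fold c0. unfold l. lra. }
    replace (u (vadd (zb 0) y 1)) with (u (vadd z0 (vadd y1 y 1) 1)).
    + unfold mu. rewrite <- (exp_ln (u (vadd z0 (vadd y1 y 1) 1))) by auto.
      assert (G := dot_sq_add_le m y1 y).
      specialize (Hp (vadd y1 y 1) ltac:(lra)). specialize (Hy y Hyr).
      assert (k1 * exp (k2 * D0) * dot m (vadd y1 y 1) (vadd y1 y 1) <= k1 * exp (k2 * D0) * (4 * r2)).
      { apply Rmult_le_compat_l; [apply Rmult_le_pos; auto; left; apply exp_pos|lra]. }
      apply exp_le. lra.
    + apply (scont_indep m); auto. intros j Hj. rewrite <- vadd_vadd. fold z1. change (z1 j + 1 * y j = zb 0 j + 1 * y j). f_equal.
      destruct (Nat.lt_ge_cases j n) as [Lj|Lj].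
      * rewrite Zx; auto. unfold herm. ring.
      * replace j with (n + (j - n))%nat by lia. rewrite Zv. unfold herm1. ring. }
replace (u (zb 1)) with (u z) in Hfin.
2: { apply (scont_indep m); auto. intros j Hj. destruct (Nat.lt_ge_cases j n) as [Lj|Lj].
  - rewrite Zx; auto. unfold herm. ring.
  - replace j with (n + (j - n))%nat by lia. rewrite Zv. unfold herm1. ring. }
apply ln_le in Hfin.
2: { apply Rmult_lt_0_compat; [apply Rdiv_lt_0_compat; [apply exp_pos|lra]|apply exp_pos]. }
rewrite ln_mu_exp in Hfin by apply exp_pos. unfold mu in Hfin. rewrite ln_exp in Hfin.
eapply Rle_trans; [|exact Hfin].
assert (HLn : ln (1 + c0 * 1 / 40) <= L0 + k2 * D0).
{ rewrite <- (ln_exp (k2 * D0)). unfold L0. rewrite <- ln_mult; [|lra|apply exp_pos].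
  apply ln_le; [lra|]. unfold c0, r2. rewrite exp_Ropp. assert (E1 : exp 0 <= exp (k2 * D0)) by (apply exp_le; lra).
  rewrite exp_0 in E1.
  replace (16 * l / (/ exp (k2 * D0) / (4 * (k1 + 1))) * 1 / 40) with (8 / 5 * l * (k1 + 1) * exp (k2 * D0)) by (field; split; lra). lra. }
set (S := 1 + D0 + Dz).
assert (HS : D <= 2 * S) by (unfold D, S; lra).
assert (HS1 : 1 <= S) by (unfold S; lra).
assert (G1 : - kap * (53 * S) <= m0). { unfold m0. assert (kap * (1 + 26 * D) <= kap * (53 * S)) by (apply Rmult_le_compat_l; lra). lra. }
assert (G2 : c1 <= (147 + 32 * kap) * S).
{ unfold c1. assert (32 * kap * 1 <= 32 * kap * S) by (apply Rmult_le_compat_l; lra). lra. }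
assert (G3 : L0 + k2 * D0 <= (L0 + k2) * S).
{ assert (L0 * 1 <= L0 * S) by (apply Rmult_le_compat_l; lra). assert (k2 * D0 <= k2 * S) by (apply Rmult_le_compat_l; unfold S; lra). lra. }
assert (G4 : (INR n + 2) * (c1 * 1 + 40 * ln (1 + c0 * 1 / 40)) <= (INR n + 2) * ((147 + 32 * kap + 40 * (L0 + k2)) * S)).
{ apply Rmult_le_compat_l; lra. }
assert (G5 : 1 + ln 4 <= (1 + ln 4) * S) by (rewrite <- (Rmult_1_r (1 + ln 4)) at 1; apply Rmult_le_compat_l; lra).
unfold c. lra.
Qed.

(** Harnack with one point at 0 bounds [ln u] quadratically on both sides. During time 1/4 the
    amplitude gains [m0 / 4], the carrying cost takes back at most [m0 / 16] plus constants, and the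
    growth bound caps the net gain by a multiple of [R2]; the factor 16/3 in [C1] is the inverse of
    1/4 - 1/16. *)
Lemma potential_upper n u ux uv uvv h k1 k2 k : kinetic_stationary n u ux uv uvv h ->
  0 <= k1 -> 0 <= k2 -> locally_semiconvex (2 * n) (fun z => ln (u z)) k1 k2 ->
  0 <= k -> semiconvex (2 * n) h k ->
  exists c, 0 <= c /\ forall z, h z <= c * (1 + dot (2 * n) z z) /\ ln (u z) <= c * (1 + dot (2 * n) z z).
Proof.
intros Hst Hk1 Hk2 Hsemi Hk Hh.
destruct (semiconvex_lower _ _ _ Hk Hh) as [kap [Hkap Hlow]].
destruct (harnack n u ux uv uvv h k1 k2 kap Hst Hk1 Hk2 Hsemi Hkap Hlow) as [c [Hc Hhar]].
assert (Hst0 := Hst). destruct Hst as (Hu & Hcu & HD & HPDE).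
set (m := (2 * n)%nat) in *. assert (Hn := pos_INR n).
set (l0 := ln (u (fun _ => 0))) in *.
assert (Hup : forall z, ln (u z) <= l0 + c * (1 + dot m z z)).
{ intros z. specialize (Hhar z (fun _ => 0)). rewrite dot_0_0 in Hhar. fold l0 in Hhar. lra. }
assert (Hdn : forall z, l0 - c * (1 + dot m z z) <= ln (u z)).
{ intros z. specialize (Hhar (fun _ => 0) z). rewrite dot_0_0 in Hhar. fold l0 in Hhar. lra. }
set (l := - ln (bump_floor n)). assert (Hl : 0 < l) by apply log_floor_pos.
set (L1 := ln (1 + 16 * l * (1 / 4) / 40)).
assert (HL1 : 0 <= L1). { unfold L1. rewrite <- ln_1. apply ln_le; lra. }
assert (H4 : 0 < ln 4) by (rewrite <- ln_1; apply ln_increasing; lra).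
(* Weight of the Young inequality that defines [c1]; this value is what makes the carrying cost
   proportional to [m0] no larger than [m0 / 16]. *)
set (th := / (16 * (INR n + 2))).
assert (Hth : 0 < th) by (apply Rinv_0_lt_compat; lra).
assert (Hth2 : (INR n + 2) * th = / 16) by (unfold th; field; lra).
set (C0 := (INR n + 2) / 4 * (th * (44 * kap) + 4 / th + 3)).
assert (HC0 : 0 <= C0).
{ unfold C0. assert (0 < 4 / th) by (apply Rdiv_lt_0_compat; lra). assert (0 <= th * (44 * kap)) by (apply Rmult_le_pos; lra).
  apply Rmult_le_pos; lra. }
set (C1 := 16 / 3 * (21 * c + ln 4 + C0 + (INR n + 2) * (40 * L1))).
assert (HC1 : 0 <= C1).
{ unfold C1. assert (0 <= (INR n + 2) * (40 * L1)) by (apply Rmult_le_pos; lra). lra. }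
exists (C1 + 4 * k + c + Rabs l0). split; [generalize (Rabs_pos l0); lra|].
intros z0. assert (Pz := dot_self_ge0 m z0). set (R2 := 1 + dot m z0 z0) in *.
assert (HR2 : 1 <= R2) by (unfold R2; lra).
assert (Q1 : 0 <= Rabs l0 * R2) by (apply Rmult_le_pos; [apply Rabs_pos|lra]).
assert (Q2 : 0 <= C1 * R2) by (apply Rmult_le_pos; lra).
assert (Q3 : 0 <= k * R2) by (apply Rmult_le_pos; lra).
assert (Q4 : 0 <= c * R2) by (apply Rmult_le_pos; lra).
split.
2: { specialize (Hup z0). fold R2 in Hup. assert (Rabs l0 * 1 <= Rabs l0 * R2) by (apply Rmult_le_compat_l; [apply Rabs_pos|lra]).
  generalize (Rle_abs l0). lra. }
destruct (Hh z0) as [p Hp].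
destruct (half_space_ball m p (sqrt R2) (sqrt_pos R2)) as [y1 [Hy1 Hy]].
replace (sqrt R2 ^ 2) with R2 in * by (simpl; rewrite Rmult_1_r, sqrt_sqrt; lra).
set (z1 := vadd z0 y1 1).
set (m0 := h z0 - 4 * k * R2).
assert (Hball : forall y, dot m y y <= R2 -> m0 <= h (vadd z1 y 1)).
{ intros y Hyr. unfold z1. rewrite vadd_vadd. specialize (Hp (vadd y1 y 1)). specialize (Hy y Hyr).
  assert (G := dot_sq_add_le m y1 y). assert (k * dot m (vadd y1 y 1) (vadd y1 y 1) <= k * (4 * R2)) by (apply Rmult_le_compat_l; lra).
  unfold m0. lra. }
destruct (Rle_lt_dec m0 0) as [L|Hm0]; [unfold m0 in L; lra|].
assert (Hz1 : dot m z1 z1 <= 4 * R2).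
{ unfold z1. eapply Rle_trans; [apply dot_sq_add_le|]. unfold R2 in *. lra. }
set (dd := fun j => if Nat.ltb j n then z1 (n + j)%nat else 0).
set (zb := fun t => vadd z1 dd t).
assert (Dx : forall j, (j < n)%nat -> dd j = z1 (n + j)%nat).
{ intros j Hj. unfold dd. rewrite (proj2 (Nat.ltb_lt j n) Hj); auto. }
assert (Dv : forall j, dd (n + j)%nat = 0).
{ intros j. unfold dd. rewrite (proj2 (Nat.ltb_ge (n + j) n)) by lia. auto. }
assert (Hdd : dot m dd dd <= 4 * R2).
{ eapply Rle_trans; [|exact Hz1]. unfold m. rewrite !dot_double_pair. apply sumR_le; intros i Hi. rewrite Dx, Dv; auto.
  generalize (pow2_ge_0 (z1 i)). lra. }
(* The velocity is at most [2 sqrt R2], so free flight for time 1/4 moves the centre by at most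
   [sqrt R2 / 2]; a further displacement with [|y|^2 <= R2 / 4] stays in the ball where
   [h >= m0]. *)
assert (Hzb : forall t y, 0 <= t <= 1 / 4 -> vadd (zb t) y 1 = vadd z1 (vadd (fun i => t * dd i) y 1) 1 /\ dot m (fun i => t * dd i) (fun i => t * dd i) <= R2 / 4).
{ intros t y Ht. split.
  - apply functional_extensionality; intros i. unfold zb, vadd. ring.
  - rewrite dot_scal_l, dot_comm, dot_scal_l. assert (P := dot_self_ge0 m dd).
    assert (t * t <= 1 / 16) by nra. assert (t * t * dot m dd dd <= 1 / 16 * (4 * R2)) by (apply Rmult_le_compat; nra). lra. }
(* For [|y|^2 > R2 / 4] the first part cancels [m0], and the second absorbs the general lower bound
   of [h], where [1 + |z|^2 <= 10 R2 + 4 |y|^2 <= 44 |y|^2]. *)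
set (s := 4 * m0 / R2 + 44 * kap).
assert (Hm0R : 0 < m0 / R2) by (apply Rdiv_lt_0_compat; lra).
assert (Hm0R' : m0 / R2 <= m0).
{ apply (Rmult_le_reg_r R2); [lra|]. unfold Rdiv. rewrite Rmult_assoc, Rinv_l by lra. nra. }
assert (Hs : 0 <= s) by (unfold s, Rdiv in *; lra).
(* By the arithmetic-geometric inequality [(th s + 4 / th) ^ 2 >= 16 s], so [c1] is admissible while
   depending on [s] linearly with a small slope. *)
set (c1 := th * s + 4 / th + 3).
assert (H4th : 0 < 4 / th) by (apply Rdiv_lt_0_compat; lra).
assert (Hths : 0 <= th * s) by (apply Rmult_le_pos; lra).
set (mu := exp (l0 - 11 * c * R2)).
assert (Hfin : mu / 4 * exp (m0 * (1 / 4) - (INR n + 2) * (c1 * (1 / 4) + 40 * ln (1 + 16 * l * (1 / 4) / 40))) <= u (zb (1 / 4))).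
{ apply (gaussian_propagation n u ux uv uvv h zb (fun _ _ => 0) (1 / 4) m0 s c1 (16 * l) mu Hst0); try lra.
  - unfold c1; lra.
  - unfold c1. assert (E : th * s * (4 / th) = 4 * s) by (field; lra). set (a := th * s) in *. set (b := 4 / th) in *. generalize (pow2_ge_0 (a - b)). nra.
  - apply exp_pos.
  - intros t i Ht Hi. unfold zb, vadd. rewrite Dx, Dv; auto. auto_derive; auto. ring.
  - intros t i Ht Hi. unfold zb, vadd. rewrite Dv; auto. auto_derive; auto. ring.
  - intros t Ht. rewrite sumR_0; [unfold c1; lra|]. intros; ring.
  - intros t y Ht. destruct (Hzb t y Ht) as [E1 E2]. fold m.
    set (d := fun i => t * dd i) in *.
    assert (G := dot_sq_add_le m d y). assert (Py := dot_self_ge0 m y).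
    destruct (Rle_lt_dec (dot m y y) (R2 / 4)) as [Ly|Ly].
    + rewrite E1. assert (m0 <= h (vadd z1 (vadd d y 1) 1)) by (apply Hball; lra).
      assert (0 <= s * dot m y y) by (apply Rmult_le_pos; auto). lra.
    + apply Rle_trans with (- (44 * kap) * dot m y y).
      * assert (m0 / R2 * (R2 / 4) <= m0 / R2 * dot m y y) by (apply Rmult_le_compat_l; lra).
        replace (m0 / R2 * (R2 / 4)) with (m0 / 4) in H by (field; lra). unfold s. unfold Rdiv in *. lra.
      * eapply Rle_trans; [|apply Hlow]. rewrite E1.
        assert (G2 := dot_sq_add_le m z1 (vadd d y 1)). fold m.
        assert (kap * (1 + dot m (vadd z1 (vadd d y 1) 1) (vadd z1 (vadd d y 1) 1)) <= kap * (44 * dot m y y)) by (apply Rmult_le_compat_l; lra). lra.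
  - intros y Hyy. fold l m in Hyy.
    assert (Hyr : dot m y y <= 1).
    { apply (Rmult_le_reg_l (16 * l)); [lra|]. unfold l in *. lra. }
    unfold mu. rewrite <- (exp_ln (u (vadd (zb 0) y 1))) by auto.
    apply exp_le. eapply Rle_trans; [|apply Hdn].
    replace (zb 0) with z1 by (apply functional_extensionality; intros i; unfold zb, vadd; ring).
    assert (G := dot_sq_add_le m z1 y).
    assert (c * (1 + dot m (vadd z1 y 1) (vadd z1 y 1)) <= c * (11 * R2)) by (apply Rmult_le_compat_l; lra). lra. }
apply ln_le in Hfin.
2: { apply Rmult_lt_0_compat; [apply Rdiv_lt_0_compat; [apply exp_pos|lra]|apply exp_pos]. }
rewrite ln_mu_exp in Hfin by apply exp_pos. unfold mu in Hfin. rewrite ln_exp in Hfin.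
fold L1 in Hfin.
assert (HU := Hup (zb (1 / 4))).
assert (Hzq : dot m (zb (1 / 4)) (zb (1 / 4)) <= 9 * R2).
{ destruct (Hzb (1 / 4) (fun _ => 0) ltac:(lra)) as [E1 E2].
  replace (zb (1 / 4)) with (vadd z1 (fun i => 1 / 4 * dd i) 1) by (apply functional_extensionality; intros i; unfold zb, vadd; ring).
  assert (G := dot_sq_add_le m z1 (fun i => 1 / 4 * dd i)). lra. }
assert (c * (1 + dot m (zb (1 / 4)) (zb (1 / 4))) <= c * (10 * R2)) by (apply Rmult_le_compat_l; lra).
assert (E1 : (INR n + 2) * (c1 * (1 / 4)) = / 16 * (m0 / R2) + C0).
{ unfold c1, C0, s. replace (/ 16) with ((INR n + 2) * th) by auto. field. lra. }
assert (m0 / 4 <= 21 * c * R2 + ln 4 + / 16 * m0 + C0 + (INR n + 2) * (40 * L1)).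
{ assert ((INR n + 2) * (c1 * (1 / 4) + 40 * L1) = (INR n + 2) * (c1 * (1 / 4)) + (INR n + 2) * (40 * L1)) by ring. lra. }
assert (m0 <= C1 * R2).
{ unfold C1. set (K := ln 4 + C0 + (INR n + 2) * (40 * L1)) in *.
  assert (0 <= K). { unfold K. assert (0 <= (INR n + 2) * (40 * L1)) by (apply Rmult_le_pos; lra). lra. }
  assert (K * 1 <= K * R2) by (apply Rmult_le_compat_l; lra).
  replace (16 / 3 * (21 * c + ln 4 + C0 + (INR n + 2) * (40 * L1)) * R2) with (16 / 3 * (21 * c * R2 + K * R2)) by (unfold K; ring).
  unfold K in *. lra. }
unfold m0 in *. lra.
Qed.

(** * The two-point maximum principle *)

Definition kinetic_rhs n (gd gvv : nat -> R -> (nat -> R) -> R) t (z : nat -> R) :=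
  sumR n (fun i => gvv i t z - z (n + i)%nat * gd i t z).

Definition kinetic_solution n (g : R -> (nat -> R) -> R) (gd gvv : nat -> R -> (nat -> R) -> R) (h : (nat -> R) -> R) :=
  (forall t z, 0 < t -> 0 < g t z) /\
  (forall tk t (pk : nat -> nat -> R) (p : nat -> R), 0 < t -> is_lim_seq tk (Finite t) ->
     (forall i, (i < 2 * n)%nat -> is_lim_seq (fun k => pk k i) (p i)) ->
     is_lim_seq (fun k => g (tk k) (pk k)) (g t p)) /\
  (forall t i, 0 < t -> (i < 2 * n)%nat -> Dp i (g t) (gd i t)) /\
  (forall t i, 0 < t -> (i < n)%nat -> Dp (n + i) (gd (n + i)%nat t) (gvv i t)) /\
  (forall t z, 0 < t -> is_derive (fun s => g s z) t (kinetic_rhs n gd gvv t z + h z * g t z)).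

Definition gauss_barrier m (A : R) (z : nat -> R) := exp (A * (1 + dot m z z)).

Lemma Dp_dot_self m i : (i < m)%nat -> Dp i (fun z => dot m z z) (fun z => 2 * z i).
Proof.
intros Hi.
apply (Dp_ext i (fun z => dot m z z) (fun z => sumR m (fun j => if Nat.eq_dec j i then 2 * z j else 0)) _ _); auto.
- apply Dp_sumR. intros j Hj z. unfold upd. destruct (Nat.eq_dec j i) as [->|].
  + auto_derive; auto. ring.
  + apply der_const.
- intros z. apply (sumR_delta m i (fun j => 2 * z j)); auto.
Qed.

Lemma Dp_barrier m A i : (i < m)%nat ->
  Dp i (gauss_barrier m A) (fun z => 2 * A * z i * gauss_barrier m A z).
Proof.
intros Hi.
apply (Dp_ext _ _ _ _ _ (Dp_exp _ _ _ (Dp_scal _ A _ _ (Dp_plus _ _ _ _ _ (Dp_const _ 1) (Dp_dot_self m i Hi))))).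
- intros z. auto.
- intros z. unfold gauss_barrier. ring.
Qed.

Lemma Dp_barrier2 m A i : (i < m)%nat ->
  Dp i (fun z => 2 * A * z i * gauss_barrier m A z) (fun z => (2 * A + 4 * A ^ 2 * z i ^ 2) * gauss_barrier m A z).
Proof.
intros Hi.
apply (Dp_ext _ _ _ _ _ (Dp_mult _ _ _ _ _ (Dp_scal _ (2 * A) _ _ (Dp_coord i i)) (Dp_barrier m A i Hi))).
- intros z. auto.
- intros z. destruct (Nat.eq_dec i i); [ring|congruence].
Qed.

(** The evolution inequality for the barrier, divided by the barrier. The terms of [Gam] pay in turn
    for the constant and the quadratic part of the v-Laplacian, for transport and for [h]; the final
    1 gives strictness. *)
Lemma barrier_supersolution n A0 Gam A c hz z : 0 < A0 -> A0 <= A <= 2 * A0 -> 0 <= c ->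
  hz <= c * (1 + dot (2 * n) z z) -> Gam = 4 * INR n * A0 + 16 * A0 ^ 2 + 2 * A0 + c + 1 ->
  0 < Gam * (1 + dot (2 * n) z z) - sumR n (fun k => 2 * A + 4 * A ^ 2 * z (n + k)%nat ^ 2)
      + sumR n (fun k => 2 * A * (z (n + k)%nat * z k)) - hz.
Proof.
intros HA0 HA Hc Hh ->.
assert (Hn := pos_INR n).
assert (Hd := dot_double n z). assert (Hcr := cross_le n z).
apply Rabs_le_between in Hcr.
rewrite sumR_plus, sumR_const, !sumR_scal.
set (xx := sumR n (fun k => z k ^ 2)) in *. set (vv := sumR n (fun k => z (n + k)%nat ^ 2)) in *.
set (cr := sumR n (fun k => z (n + k)%nat * z k)) in *. set (D := dot (2 * n) z z) in *.
assert (0 <= xx) by (apply sumR_pos; intros; apply pow2_ge_0).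
assert (0 <= vv) by (apply sumR_pos; intros; apply pow2_ge_0).
assert (HD0 : 0 <= D) by lra.
assert (A ^ 2 <= 4 * A0 ^ 2) by nra.
assert (4 * A ^ 2 * vv <= 16 * A0 ^ 2 * D) by (apply Rmult_le_compat; nra).
assert (INR n * (2 * A) <= 4 * INR n * A0) by nra.
assert (0 <= 4 * INR n * A0 * D) by (repeat apply Rmult_le_pos; lra).
assert (A * (2 * cr) >= A * - D) by (apply Rmult_ge_compat_l; lra).
assert (A * D <= 2 * A0 * D) by (apply Rmult_le_compat_r; lra).
assert (0 <= A0 ^ 2) by apply pow2_ge_0.
lra.
Qed.

Lemma deriv_shift i f f' z w c s : Dp i f f' ->
  is_derive (fun r => f (vadd (upd z i r) w c)) s (f' (vadd (upd z i s) w c)).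
Proof.
intros H.
apply (der_ext (fun r => f (upd (vadd z w c) i (r + c * w i))) _ _ (f' (upd (vadd z w c) i (s + c * w i)) * (1 + 0))).
- intros r. rewrite upd_vadd; auto.
- rewrite upd_vadd. ring.
- apply (der_comp (fun x => f (upd (vadd z w c) i x)) (fun r => r + c * w i)).
  + apply Dp_at; auto.
  + apply der_plus; [apply der_id|apply der_const].
Qed.

Lemma deriv_shift_r i f f' z w c : Dp i f f' ->
  is_derive (fun r => f (vadd z (upd w i r) c)) (w i) (c * f' (vadd z w c)).
Proof.
intros H.
apply (der_ext (fun r => f (upd (vadd z w c) i (z i + c * r))) _ _ (f' (upd (vadd z w c) i (z i + c * w i)) * (0 + c * 1))).
- intros r. rewrite upd_vadd_r; auto.
- rewrite <- upd_vadd_r, upd_same. ring.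
- apply (der_comp (fun x => f (upd (vadd z w c) i x)) (fun r => z i + c * r)).
  + apply Dp_at; auto.
  + apply der_plus; [apply der_const|apply der_scal, der_id].
Qed.

Lemma quad_upd_deriv m A w i : (i < m)%nat -> symmetric m A ->
  is_derive (fun r => quad m A (upd w i r)) (w i) (2 * mv m A w i).
Proof.
intros Hi HA. set (e := fun j => if Nat.eq_dec j i then 1 else 0).
assert (Ee : dot m e (mv m A w) = mv m A w i).
{ unfold dot, e. rewrite <- (sumR_delta m i (mv m A w) Hi). apply sumR_ext; intros j _. destruct (Nat.eq_dec j i); ring. }
apply (der_ext (fun r => quad m A w + 2 * (r - w i) * dot m e (mv m A w) + (r - w i) ^ 2 * quad m A e) _ _ (2 * mv m A w i)); auto.
- intros r. rewrite <- quad_vadd; auto. f_equal. apply functional_extensionality; intros j. unfold vadd, upd, e.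
  destruct (Nat.eq_dec j i) as [->|]; ring.
- rewrite Ee. auto_derive; auto. ring.
Qed.

Lemma deriv_exp_mult (f : R -> R) (f' a b s : R) : is_derive f s f' ->
  is_derive (fun r => exp (a + b * r) * f r) s (exp (a + b * s) * (b * f s + f')).
Proof.
intros H. apply (der_ext (fun r => exp (a + b * r) * f r) _ _ (exp (a + b * s) * (0 + b * 1) * f s + exp (a + b * s) * f')).
- auto.
- ring.
- apply (der_mult (fun r => exp (a + b * r)) f); auto.
  apply (der_exp (fun r => a + b * r)), der_plus; [apply der_const|apply der_scal, der_id].
Qed.

(** The tilt is allowed to vary affinely with the base point. The free slope [b] produces the terms
    [2 b P'] and [b ^ 2 P], which are tuned where the lemma is applied. *)
Lemma tilted_second_derivative (P P' M M' G G' B B' : R -> R) (P2 M2 G2 B2 a b E eps s0 : R) :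
  (forall s, is_derive P s (P' s)) -> (forall s, is_derive M s (M' s)) ->
  (forall s, is_derive G s (G' s)) -> (forall s, is_derive B s (B' s)) ->
  is_derive P' s0 P2 -> is_derive M' s0 M2 -> is_derive G' s0 G2 -> is_derive B' s0 B2 ->
  (forall s, exp a * P s0 + exp (- a) * M s0 - 2 * E * G s0 + eps * B s0 <=
     exp (a + b * (s - s0)) * P s + exp (- (a + b * (s - s0))) * M s - 2 * E * G s + eps * B s) ->
  0 <= exp a * (P2 + 2 * b * P' s0 + b ^ 2 * P s0) + exp (- a) * (M2 - 2 * b * M' s0 + b ^ 2 * M s0)
       - 2 * E * G2 + eps * B2.
Proof.
intros HP HM HG HB HP2 HM2 HG2 HB2 Hmin.
set (a1 := a - b * s0). set (a2 := - a + b * s0).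
set (f := fun s => exp (a1 + b * s) * P s + exp (a2 + - b * s) * M s - 2 * E * G s + eps * B s).
set (f' := fun s => exp (a1 + b * s) * (b * P s + P' s) + exp (a2 + - b * s) * (- b * M s + M' s) - 2 * E * G' s + eps * B' s).
assert (E1 : exp (a1 + b * s0) = exp a) by (f_equal; unfold a1; ring).
assert (E2 : exp (a2 + - b * s0) = exp (- a)) by (f_equal; unfold a2; ring).
apply (min_deriv2 f f' s0 _ 1 Rlt_0_1).
- intros s _. unfold f, f'. apply der_plus; [apply der_minus; [apply der_plus|]|].
  + apply deriv_exp_mult; auto.
  + apply deriv_exp_mult; auto.
  + apply der_scal; auto.
  + apply der_scal; auto.
- apply (der_ext f' _ _ (exp (a1 + b * s0) * (b * (b * P s0 + P' s0) + (b * P' s0 + P2)) + exp (a2 + - b * s0) * (- b * (- b * M s0 + M' s0) + (- b * M' s0 + M2)) - 2 * E * G2 + eps * B2)).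
  + auto.
  + rewrite E1, E2. ring.
  + unfold f'. apply der_plus; [apply der_minus; [apply der_plus|]|].
    * apply (deriv_exp_mult (fun s => b * P s + P' s)). apply der_plus; auto. apply der_scal; auto.
    * apply (deriv_exp_mult (fun s => - b * M s + M' s)). apply der_plus; auto. apply der_scal; auto.
    * apply der_scal; auto.
    * apply der_scal; auto.
- intros s _. unfold f. rewrite E1, E2.
  replace (exp (a1 + b * s)) with (exp (a + b * (s - s0))) by (f_equal; unfold a1; ring).
  replace (exp (a2 + - b * s)) with (exp (- (a + b * (s - s0)))) by (f_equal; unfold a2; ring).
  apply Hmin.
Qed.

(** The geometric mean is the lower envelope of these expressions, which are linear in X and Y, so
    the linear equation applies to each term. [balanced_tilt] gives the [a] with equality. *)
Lemma amgm_tilt X Y a : 0 < X -> 0 < Y -> 2 * sqrt (X * Y) <= exp a * X + exp (- a) * Y.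
Proof.
intros HX HY. assert (Ha := exp_pos a). assert (Ha' := exp_pos (- a)).
assert (E : exp a * exp (- a) = 1) by (rewrite <- exp_plus, Rplus_opp_r; apply exp_0).
assert (P1 := Rmult_lt_0_compat _ _ Ha HX). assert (P2 := Rmult_lt_0_compat _ _ Ha' HY).
rewrite <- (sqrt_Rsqr (exp a * X)), <- (sqrt_Rsqr (exp (- a) * Y)) by lra.
replace (X * Y) with (exp a * X * (exp (- a) * Y)) by (replace (exp a * X * (exp (- a) * Y)) with (exp a * exp (- a) * (X * Y)) by ring; rewrite E; ring).
rewrite sqrt_mult by lra. rewrite !sqrt_Rsqr by lra.
generalize (sqrt_sqrt (exp a * X)) (sqrt_sqrt (exp (- a) * Y)) (pow2_ge_0 (sqrt (exp a * X) - sqrt (exp (- a) * Y))).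
intros. nra.
Qed.

Lemma balanced_tilt X Y : 0 < X -> 0 < Y -> exists a, exp a * X = sqrt (X * Y) /\ exp (- a) * Y = sqrt (X * Y).
Proof.
intros HX HY. exists ((ln Y - ln X) / 2).
assert (E : sqrt (X * Y) = exp ((ln X + ln Y) / 2)).
{ rewrite <- (sqrt_Rsqr (exp ((ln X + ln Y) / 2))) by (left; apply exp_pos). f_equal.
  unfold Rsqr. rewrite <- exp_plus. replace ((ln X + ln Y) / 2 + (ln X + ln Y) / 2) with (ln X + ln Y) by field.
  rewrite exp_plus, !exp_ln; auto. }
rewrite E. split.
- rewrite <- (exp_ln X) at 2 by auto. rewrite <- exp_plus. f_equal. field.
- rewrite <- (exp_ln Y) at 2 by auto. rewrite <- exp_plus. f_equal. field.
Qed.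

Definition convexity_gap n (g : R -> (nat -> R) -> R) (N : R -> mat) eps (A : R -> R) t z w :=
  2 * sqrt (g t (vadd z w 1) * g t (vadd z w (-1))) - 2 * exp (/ 2 * quad (2 * n) (N t) w) * g t z
  + eps * gauss_barrier (2 * n) (A t) z.

Definition tilted_gap n (g : R -> (nat -> R) -> R) (N : R -> mat) eps (A : R -> R) t z w a :=
  exp a * g t (vadd z w 1) + exp (- a) * g t (vadd z w (-1)) - 2 * exp (/ 2 * quad (2 * n) (N t) w) * g t z
  + eps * gauss_barrier (2 * n) (A t) z.

Lemma lim_sqrt f (l : R) : 0 <= l -> is_lim_seq f l -> is_lim_seq (fun k => sqrt (f k)) (sqrt l).
Proof. intros H. apply is_lim_seq_continuous, continuity_pt_sqrt; auto. Qed.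

Lemma lim_dot_self m (zk : nat -> nat -> R) (z : nat -> R) :
  (forall i, (i < m)%nat -> is_lim_seq (fun k => zk k i) (z i)) -> is_lim_seq (fun k => dot m (zk k) (zk k)) (dot m z z).
Proof. intros H. apply sumR_lim; intros i Hi. apply is_lim_seq_mult'; auto. Qed.

Lemma lim_vadd (zk wk : nat -> nat -> R) (z w : nat -> R) c i :
  is_lim_seq (fun k => zk k i) (z i) -> is_lim_seq (fun k => wk k i) (w i) ->
  is_lim_seq (fun k => vadd (zk k) (wk k) c i) (vadd z w c i).
Proof.
intros. unfold vadd. apply is_lim_seq_plus'; auto. apply is_lim_seq_mult'; auto. apply is_lim_seq_const.
Qed.

Lemma lim_barrier m (Ak : nat -> R) (A : R) (zk : nat -> nat -> R) (z : nat -> R) : is_lim_seq Ak A ->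
  (forall i, (i < m)%nat -> is_lim_seq (fun k => zk k i) (z i)) ->
  is_lim_seq (fun k => gauss_barrier m (Ak k) (zk k)) (gauss_barrier m A z).
Proof.
intros HA Hz. apply lim_exp, is_lim_seq_mult'; auto. apply is_lim_seq_plus'; [apply is_lim_seq_const|].
apply lim_dot_self; auto.
Qed.

Lemma gap_lim n g gd gvv h N eps A (tk : nat -> R) (t : R) (zk wk : nat -> nat -> R) (z w : nat -> R) :
  kinetic_solution n g gd gvv h -> 0 < t ->
  (forall i j, (i < 2 * n)%nat -> (j < 2 * n)%nat -> continuity_pt (fun s => N s i j) t) -> continuity_pt A t ->
  is_lim_seq tk t -> (forall i, (i < 2 * n)%nat -> is_lim_seq (fun k => zk k i) (z i)) ->
  (forall i, (i < 2 * n)%nat -> is_lim_seq (fun k => wk k i) (w i)) ->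
  is_lim_seq (fun k => convexity_gap n g N eps A (tk k) (zk k) (wk k)) (convexity_gap n g N eps A t z w).
Proof.
intros (Hpos & Hlim & _) Ht HN HA Lt Lz Lw. unfold convexity_gap.
assert (Lg : forall c, is_lim_seq (fun k => g (tk k) (vadd (zk k) (wk k) c)) (g t (vadd z w c))).
{ intros c. apply Hlim; auto. intros; apply lim_vadd; auto. }
apply is_lim_seq_plus'; [apply is_lim_seq_minus'|].
- apply is_lim_seq_mult'; [apply is_lim_seq_const|]. apply lim_sqrt.
  + left. apply Rmult_lt_0_compat; apply Hpos; auto.
  + apply is_lim_seq_mult'; apply Lg.
- apply is_lim_seq_mult'; [|apply Hlim; auto]. apply is_lim_seq_mult'; [apply is_lim_seq_const|].
  apply lim_exp, is_lim_seq_mult'; [apply is_lim_seq_const|].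
  apply sumR_lim; intros i Hi. apply sumR_lim; intros j Hj. apply is_lim_seq_mult'; auto. apply is_lim_seq_mult'; auto.
  apply (is_lim_seq_continuous (fun s => N s i j)); auto.
- apply is_lim_seq_mult'; [apply is_lim_seq_const|]. apply lim_barrier; auto.
  apply is_lim_seq_continuous; auto.
Qed.

Lemma gap_le_tilted n g N eps A t z w a : (forall z, 0 < g t z) ->
  convexity_gap n g N eps A t z w <= tilted_gap n g N eps A t z w a.
Proof.
intros H. unfold convexity_gap, tilted_gap. assert (G := amgm_tilt _ _ a (H (vadd z w 1)) (H (vadd z w (-1)))). lra.
Qed.

(* First and second order conditions at a first touching point contradict the evolution equation. *)
Lemma gap_no_touching n g gd gvv h K N s t A0 c eps z w :
  let Gam := 4 * INR n * A0 + 16 * A0 ^ 2 + 2 * A0 + c + 1 in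
  let A := fun t => A0 + Gam * (t - s) in
  kinetic_solution n g gd gvv h -> 0 < s < t -> 0 < A0 -> Gam * (t - s) <= A0 -> 0 <= c -> 0 < eps ->
  (forall z, h z <= c * (1 + dot (2 * n) z z)) ->
  (forall z w, - quad (2 * n) K w <= h (vadd z w 1) + h (vadd z w (-1)) - 2 * h z) ->
  0 <= quad (2 * n) K w ->
  (forall i j, (i < 2 * n)%nat -> (j < 2 * n)%nat -> is_derive (fun s => N s i j) t (riccati_rhs n (N t) K i j)) ->
  symmetric (2 * n) (N t) ->
  (forall t', s <= t' < t -> 0 < convexity_gap n g N eps A t' z w) ->
  (forall z w, 0 <= convexity_gap n g N eps A t z w) ->
  convexity_gap n g N eps A t z w = 0 -> False.
Proof.
intros Gam A (Hpos & Hlim & Hgd & Hgvv & Hgt) Hst HA0 HGam Hc Heps Hhup Hhc HKp HN HNs Hbefore Hat Hz0.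
assert (Ht : 0 < t) by lra. assert (Hn := pos_INR n).
set (m := (2 * n)%nat) in *.
assert (HGam0 : 0 < Gam). { unfold Gam. assert (0 <= 4 * INR n * A0) by (apply Rmult_le_pos; lra). assert (0 <= A0 ^ 2) by apply pow2_ge_0. lra. }
set (zp := vadd z w 1). set (zm := vadd z w (-1)).
destruct (balanced_tilt (g t zp) (g t zm) (Hpos t zp Ht) (Hpos t zm Ht)) as [a [Ha1 Ha2]].
set (al := sqrt (g t zp * g t zm)) in *.
set (E := exp (/ 2 * quad m (N t) w)).
set (B := gauss_barrier m (A t) z).
assert (HB : 0 < B) by apply exp_pos. assert (HE : 0 < E) by apply exp_pos.
assert (Hg0 : 0 < g t z) by (apply Hpos; auto).
assert (Hal : 0 < al) by (apply sqrt_lt_R0, Rmult_lt_0_compat; apply Hpos; auto).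
(* Vanishing of the gap expresses the balanced value [al] through [g t z], and in particular
   [al <= E * g t z]. *)
assert (Halpha : 2 * al = 2 * E * g t z - eps * B) by (unfold convexity_gap in Hz0; fold m in Hz0; fold zp zm in Hz0; fold al E B in Hz0; lra).
assert (Hal2 : al <= E * g t z) by (assert (0 < eps * B) by (apply Rmult_lt_0_compat; auto); lra).
assert (Htil : forall z' w' a', tilted_gap n g N eps A t z w a <= tilted_gap n g N eps A t z' w' a').
{ intros z' w' a'. apply Rle_trans with 0.
  - unfold tilted_gap. fold zp zm. rewrite Ha1, Ha2. fold m E B. lra.
  - eapply Rle_trans; [apply (Hat z' w')|]. apply gap_le_tilted. intros; apply Hpos; auto. }
assert (Z1 : forall i, (i < m)%nat -> exp a * gd i t zp + exp (- a) * gd i t zm - 2 * E * gd i t z + eps * (2 * A t * z i * B) = 0).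
{ intros i Hi. apply (min_deriv (fun r => tilted_gap n g N eps A t (upd z i r) w a) (z i) _ 1); [|lra|].
  - unfold tilted_gap. fold m. fold E.
    replace zp with (vadd (upd z i (z i)) w 1) by (rewrite upd_same; auto).
    replace zm with (vadd (upd z i (z i)) w (-1)) by (rewrite upd_same; auto).
    apply der_plus; [apply der_minus; [apply der_plus|]|]; apply der_scal.
    + apply deriv_shift; auto.
    + apply deriv_shift; auto.
    + apply Hgd; auto.
    + apply (Dp_barrier m (A t) i Hi z).
  - intros r _. rewrite upd_same. apply Htil. }
assert (W1 : forall i, (i < m)%nat -> exp a * gd i t zp - exp (- a) * gd i t zm = 2 * E * mv m (N t) w i * g t z).
{ intros i Hi.
  assert (M : exp a * (1 * gd i t zp) + exp (- a) * (-1 * gd i t zm) - 2 * (E * (/ 2 * (2 * mv m (N t) w i))) * g t z = 0); [|lra].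
  apply (min_deriv (fun r => tilted_gap n g N eps A t z (upd w i r) a) (w i) _ 1); [|lra|].
  - unfold tilted_gap. fold m. fold B.
    apply (der_ext (fun r => exp a * g t (vadd z (upd w i r) 1) + exp (- a) * g t (vadd z (upd w i r) (-1)) - 2 * g t z * exp (/ 2 * quad m (N t) (upd w i r)) + eps * B) _ _
      (exp a * (1 * gd i t zp) + exp (- a) * (-1 * gd i t zm) - 2 * g t z * (exp (/ 2 * quad m (N t) (upd w i (w i))) * (/ 2 * (2 * mv m (N t) w i))) + 0)).
    + intros r. ring.
    + rewrite upd_same. fold E. ring.
    + apply der_plus; [apply der_minus; [apply der_plus|]; apply der_scal|apply der_const].
      * apply deriv_shift_r; auto.
      * apply deriv_shift_r; auto.
      * apply (der_exp (fun r => / 2 * quad m (N t) (upd w i r))), der_scal, quad_upd_deriv; auto.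
  - intros r _. rewrite upd_same. apply Htil. }
(* The tilt a moves with the base point at rate - (N w)_{v_k}; this produces the N D N term of the Riccati equation. *)
assert (K2 : forall k, (k < n)%nat ->
  0 <= exp a * gvv k t zp + exp (- a) * gvv k t zm - 2 * E * gvv k t z
     + eps * ((2 * A t + 4 * A t ^ 2 * z (n + k)%nat ^ 2) * B)
     - 2 * mv m (N t) w (n + k)%nat * (exp a * gd (n + k)%nat t zp - exp (- a) * gd (n + k)%nat t zm)
     + 2 * mv m (N t) w (n + k)%nat ^ 2 * al).
{ intros k Hk. assert (Hk' : (n + k < m)%nat) by (unfold m; lia).
  set (b := - mv m (N t) w (n + k)%nat).
  assert (M := tilted_second_derivative
    (fun r => g t (vadd (upd z (n + k) r) w 1)) (fun r => gd (n + k)%nat t (vadd (upd z (n + k) r) w 1))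
    (fun r => g t (vadd (upd z (n + k) r) w (-1))) (fun r => gd (n + k)%nat t (vadd (upd z (n + k) r) w (-1)))
    (fun r => g t (upd z (n + k) r)) (fun r => gd (n + k)%nat t (upd z (n + k) r))
    (fun r => gauss_barrier m (A t) (upd z (n + k) r)) (fun r => 2 * A t * (upd z (n + k) r) (n + k)%nat * gauss_barrier m (A t) (upd z (n + k) r))
    (gvv k t (vadd (upd z (n + k) (z (n + k)%nat)) w 1)) (gvv k t (vadd (upd z (n + k) (z (n + k)%nat)) w (-1))) (gvv k t z)
    ((2 * A t + 4 * A t ^ 2 * z (n + k)%nat ^ 2) * gauss_barrier m (A t) z) a b E eps (z (n + k)%nat)).
  cbv beta in M.
  assert (M' := M (fun s => deriv_shift _ _ _ z w 1 s (Hgd t (n + k)%nat Ht Hk'))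
    (fun s => deriv_shift _ _ _ z w (-1) s (Hgd t (n + k)%nat Ht Hk'))
    (fun s => Dp_at _ _ _ z s (Hgd t (n + k)%nat Ht Hk'))
    (fun s => Dp_at _ _ _ z s (Dp_barrier m (A t) (n + k) Hk'))
    (deriv_shift _ _ _ z w 1 _ (Hgvv t k Ht Hk)) (deriv_shift _ _ _ z w (-1) _ (Hgvv t k Ht Hk))
    (Hgvv t k Ht Hk z) (Dp_barrier2 m (A t) (n + k) Hk' z)).
  clear M. rewrite !upd_same in M'. fold zp zm B in M'.
  assert (M2 : forall s0, exp a * g t zp + exp (- a) * g t zm - 2 * E * g t z + eps * B <=
     exp (a + b * (s0 - z (n + k)%nat)) * g t (vadd (upd z (n + k) s0) w 1) +
     exp (- (a + b * (s0 - z (n + k)%nat))) * g t (vadd (upd z (n + k) s0) w (-1)) - 2 * E * g t (upd z (n + k) s0) +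
     eps * gauss_barrier m (A t) (upd z (n + k) s0)).
  { intros r. apply (Htil (upd z (n + k) r) w (a + b * (r - z (n + k)%nat))). }
  specialize (M' M2). clear M2.
  assert (Eb : exp a * (b ^ 2 * g t zp) + exp (- a) * (b ^ 2 * g t zm) = 2 * b ^ 2 * al).
  { replace (exp a * (b ^ 2 * g t zp) + exp (- a) * (b ^ 2 * g t zm)) with (b ^ 2 * (exp a * g t zp) + b ^ 2 * (exp (- a) * g t zm)) by ring.
    rewrite Ha1, Ha2. ring. }
  replace (mv m (N t) w (n + k)%nat) with (- b) by (unfold b; ring).
  replace (2 * (- b) ^ 2 * al) with (2 * b ^ 2 * al) by ring. rewrite <- Eb.
  eapply Rle_trans; [exact M'|]. right. ring. }
set (Nv := fun k => mv m (N t) w (n + k)%nat). set (Nx := fun k => mv m (N t) w k).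
(* The velocities at the outer points are those of [z] plus and minus those of [w], so transport
   splits into [z_v] times the condition [Z1] and [w_v] times [W1]. Inserting [W1] into [K2] leaves
   [-4 + 2 = -2] times the square of [Nv], because [al <= E * g t z]. *)
assert (Tk : forall k, (k < n)%nat ->
  eps * B * (2 * A t * (z (n + k)%nat * z k) - (2 * A t + 4 * A t ^ 2 * z (n + k)%nat ^ 2)) + E * g t z * (2 * Nv k ^ 2 - 2 * (w (n + k)%nat * Nx k)) <=
  exp a * (gvv k t zp - zp (n + k)%nat * gd k t zp) + exp (- a) * (gvv k t zm - zm (n + k)%nat * gd k t zm) - 2 * E * (gvv k t z - z (n + k)%nat * gd k t z)).
{ intros k Hk. specialize (K2 k Hk).
  assert (Z := Z1 k ltac:(unfold m; lia)). assert (Wx := W1 k ltac:(unfold m; lia)). assert (Wv := W1 (n + k)%nat ltac:(unfold m; lia)).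
  rewrite Wv in K2. fold (Nv k) in K2. fold (Nx k) in Wx.
  assert (T1 : Nv k ^ 2 * al <= Nv k ^ 2 * (E * g t z)) by (apply Rmult_le_compat_l; [apply pow2_ge_0|auto]).
  unfold zp at 2, zm at 2. unfold vadd.
  assert (T2 : z (n + k)%nat * (exp a * gd k t zp + exp (- a) * gd k t zm - 2 * E * gd k t z + eps * (2 * A t * z k * B)) = 0) by (rewrite Z; ring).
  assert (T3 : w (n + k)%nat * (exp a * gd k t zp - exp (- a) * gd k t zm) = w (n + k)%nat * (2 * E * Nx k * g t z)) by (rewrite Wx; auto).
  unfold Nv in *. nra. }
set (op := kinetic_rhs n gd gvv t).
assert (HT : exp a * (op zp + h zp * g t zp) + exp (- a) * (op zm + h zm * g t zm)
  - (E * quad m (riccati_rhs n (N t) K) w * g t z + 2 * E * (op z + h z * g t z))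
  + eps * (B * (Gam * (1 + dot m z z))) <= 0).
{ apply (left_min_deriv (fun r => tilted_gap n g N eps A r z w a) t _ (t - s)); [|lra|].
  - unfold tilted_gap. fold m. fold zp zm.
    apply der_plus; [apply der_minus; [apply der_plus; apply der_scal; apply Hgt; auto|]|apply der_scal].
    + apply (der_ext (fun r => (2 * exp (/ 2 * quad m (N r) w)) * g r z) _ _
       ((2 * (exp (/ 2 * quad m (N t) w) * (/ 2 * quad m (riccati_rhs n (N t) K) w))) * g t z + (2 * exp (/ 2 * quad m (N t) w)) * (op z + h z * g t z))); [auto|fold E; field|].
      apply (der_mult (fun r => 2 * exp (/ 2 * quad m (N r) w)) (fun r => g r z)); [|apply Hgt; auto].
      apply der_scal, (der_exp (fun r => / 2 * quad m (N r) w)), der_scal.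
      apply sumR_is_derive; intros i Hi. apply sumR_is_derive; intros j Hj.
      apply (der_ext (fun r => w i * w j * N r i j) _ _ (w i * w j * riccati_rhs n (N t) K i j)); [intros; ring|ring|].
      apply der_scal, HN; auto.
    + unfold B, gauss_barrier. apply (der_exp (fun r => A r * (1 + dot m z z))).
      apply (der_ext (fun r => (1 + dot m z z) * (A0 + Gam * (r - s))) _ _ ((1 + dot m z z) * (0 + Gam * (1 - 0)))); [intros; unfold A; ring|ring|].
      apply der_scal, der_plus; [apply der_const|apply der_scal, der_minus; [apply der_id|apply der_const]].
  - intros r Hr. apply Rle_trans with 0.
    + unfold tilted_gap. fold zp zm. rewrite Ha1, Ha2. fold m E B. lra.
    + left. eapply Rlt_le_trans; [apply (Hbefore r); lra|]. apply gap_le_tilted. intros; apply Hpos; lra. }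
assert (HR := quad_riccati n (N t) K w HNs). fold m in HR. rewrite HR in HT.
assert (HS := sumR_le n _ _ Tk).
assert (BS := barrier_supersolution n A0 Gam (A t) c (h z) z HA0 ltac:(unfold A; split; nra) Hc (Hhup z) eq_refl). fold m in BS.
(* Semiconvexity of [h] comes weighted with [al]; since K is non-negative at [w], the weight may be
   raised to [E * g t z]. *)
assert (Hconv : al * (h zp + h zm - 2 * h z) >= - (E * g t z * quad m K w)).
{ specialize (Hhc z w). fold zp zm in Hhc.
  assert (al * - quad m K w <= al * (h zp + h zm - 2 * h z)) by (apply Rmult_le_compat_l; lra).
  assert (al * quad m K w <= E * g t z * quad m K w) by (apply Rmult_le_compat_r; lra). lra. }
set (SB1 := sumR n (fun k => 2 * A t * (z (n + k)%nat * z k))) in *.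
set (SB2 := sumR n (fun k => 2 * A t + 4 * A t ^ 2 * z (n + k)%nat ^ 2)) in *.
assert (HBS := Rmult_lt_0_compat _ _ (Rmult_lt_0_compat _ _ Heps HB) BS).
set (Rk := sumR n (fun k => 2 * mv m (N t) w (n + k)%nat ^ 2 - 2 * (w (n + k)%nat * mv m (N t) w k))) in *.
assert (HS' : eps * B * (SB1 - SB2) + E * g t z * Rk <= exp a * op zp + exp (- a) * op zm - 2 * E * op z).
{ eapply Rle_trans; [|eapply Rle_trans; [exact HS|]]; right.
  - unfold SB1, SB2, Rk. rewrite <- sumR_minus, <- !sumR_scal, <- sumR_plus. apply sumR_ext; intros. unfold Nv, Nx. ring.
  - unfold op, kinetic_rhs. rewrite <- !sumR_scal, <- sumR_plus, <- sumR_minus. apply sumR_ext; intros. ring. }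
clear HS Tk.
assert (H1 : exp a * (h zp * g t zp) = h zp * al) by (rewrite <- Ha1; ring).
assert (H2 : exp (- a) * (h zm * g t zm) = h zm * al) by (rewrite <- Ha2; ring).
assert (H3 : 2 * E * (h z * g t z) = h z * (2 * al) + eps * B * h z) by (rewrite Halpha; ring).
(* The terms [E g Rk] and [E g K(w,w)] cancel between [HT], [HS'] and [Hconv]; what remains is
   [eps B] times the positive quantity in [BS], bounded above by 0. *)
nra.
Qed.

Definition barrier_slope n A0 c := 4 * INR n * A0 + 16 * A0 ^ 2 + 2 * A0 + c + 1.

Lemma barrier_slope_pos n A0 c : 0 < A0 -> 0 <= c -> 0 < barrier_slope n A0 c.
Proof.
intros HA Hc. unfold barrier_slope. assert (0 <= 4 * INR n * A0) by (generalize (pos_INR n); intros; apply Rmult_le_pos; lra).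
generalize (pow2_ge_0 A0). lra.
Qed.

(** Taking logarithms, a non-positive gap forces [(A0 - A1) X - N(w,w) / 2 <= L] with
    [X = 1 + |z|^2]. Both terms on the left are non-negative, so each of them is bounded. *)
Lemma gap_bounded n (g : R -> (nat -> R) -> R) (N : R -> mat) eps A A0 A1 G t z w : 0 < eps -> 0 < A1 < A0 -> A0 <= A -> 0 < G ->
  0 < g t z <= G * exp (A1 * (1 + dot (2 * n) z z)) ->
  eps * gauss_barrier (2 * n) A z <= 2 * exp (/ 2 * quad (2 * n) (N t) w) * g t z ->
  quad (2 * n) (N t) w <= 0 ->
  dot (2 * n) z z <= Rabs (ln (2 * G / eps)) / (A0 - A1) /\
  - quad (2 * n) (N t) w <= 2 * (Rabs (ln (2 * G / eps)) + A1 * (1 + Rabs (ln (2 * G / eps)) / (A0 - A1))).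
Proof.
intros Heps HA1 HA HG Hg Hbad HN. set (m := (2 * n)%nat) in *.
set (X := 1 + dot m z z) in *. assert (HX : 1 <= X) by (unfold X; generalize (dot_self_ge0 m z); lra).
assert (HEg : exp (A0 * X) <= gauss_barrier m A z) by (apply exp_le; fold X; apply Rmult_le_compat_r; lra).
set (L := ln (2 * G / eps)).
assert (HL : 2 * G = eps * exp L) by (unfold L; rewrite exp_ln; [field; lra|apply Rdiv_lt_0_compat; lra]).
assert (HE : 0 < exp (/ 2 * quad m (N t) w)) by apply exp_pos.
assert (Hchain : eps * exp (A0 * X) <= eps * exp (L + A1 * X + / 2 * quad m (N t) w)).
{ apply Rle_trans with (eps * gauss_barrier m A z); [apply Rmult_le_compat_l; lra|].
  eapply Rle_trans; [exact Hbad|]. rewrite !exp_plus.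
  replace (eps * (exp L * exp (A1 * X) * exp (/ 2 * quad m (N t) w))) with (eps * exp L * exp (A1 * X) * exp (/ 2 * quad m (N t) w)) by ring.
  rewrite <- HL. assert (exp (/ 2 * quad m (N t) w) * g t z <= exp (/ 2 * quad m (N t) w) * (G * exp (A1 * X))) by (apply Rmult_le_compat_l; lra). lra. }
apply Rmult_le_reg_l in Hchain; auto.
assert (Hexp : A0 * X <= L + A1 * X + / 2 * quad m (N t) w).
{ apply Rnot_lt_le; intros Hlt. apply exp_increasing in Hlt. lra. }
assert (HLa := Rle_abs L).
assert (HXb : X <= Rabs L / (A0 - A1)).
{ apply (Rmult_le_reg_r (A0 - A1)); [lra|]. unfold Rdiv. rewrite Rmult_assoc, Rinv_l by lra. lra. }
split; [unfold X in HXb; lra|].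
assert (A1 * X <= A1 * (1 + Rabs L / (A0 - A1))) by (apply Rmult_le_compat_l; lra).
assert (0 <= A0 * X) by (apply Rmult_le_pos; lra). lra.
Qed.

(** One comparison on an interval short enough for the barrier exponent to stay below [2 A0]. Bad
    pairs are bounded by [gap_bounded], with [eta] converting the bound on [N(w,w)] into one on
    [w]. *)
Lemma log_convexity_step n g gd gvv h K N s T A0 A1 G c eps eta :
  kinetic_solution n g gd gvv h -> 0 < s -> 0 < A1 < A0 -> barrier_slope n A0 c * (T - s) <= A0 -> 0 <= c -> 0 < eps ->
  (forall z, h z <= c * (1 + dot (2 * n) z z)) ->
  (forall z w, - quad (2 * n) K w <= h (vadd z w 1) + h (vadd z w (-1)) - 2 * h z) ->
  (forall w, 0 <= quad (2 * n) K w) ->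
  (forall t i j, s <= t <= T -> (i < 2 * n)%nat -> (j < 2 * n)%nat -> is_derive (fun s => N s i j) t (riccati_rhs n (N t) K i j)) ->
  (forall t, s <= t <= T -> symmetric (2 * n) (N t)) ->
  0 < eta -> (forall t w, s <= t <= T -> quad (2 * n) (N t) w <= - eta * dot (2 * n) w w) ->
  0 < G -> (forall t z, s <= t <= T -> g t z <= G * exp (A1 * (1 + dot (2 * n) z z))) ->
  let A := fun t => A0 + barrier_slope n A0 c * (t - s) in
  (forall z w, 0 < convexity_gap n g N eps A s z w) ->
  forall t z w, s <= t <= T -> 0 < convexity_gap n g N eps A t z w.
Proof.
intros Hsol Hs HA1 HGam Hc Heps Hhup Hhc HKp HN HNs Heta HNeg HG Hgrow A Hinit t0 z0 w0 Ht0.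
apply Rnot_le_lt; intros Hbad0. set (m := (2 * n)%nat) in *.
assert (Hsp := barrier_slope_pos n A0 c ltac:(lra) Hc).
assert (HAc : forall t, continuity_pt A t).
{ intros t. apply (der_cont A t (0 + barrier_slope n A0 c * (1 - 0))). unfold A. apply der_plus; [apply der_const|].
  apply (der_scal (fun r => r - s)), der_minus; [apply der_id|apply der_const]. }
assert (HAA : forall t, s <= t <= T -> A0 <= A t) by (intros t Ht; unfold A; nra).
assert (HNc : forall t i j, s <= t <= T -> (i < m)%nat -> (j < m)%nat -> continuity_pt (fun r => N r i j) t).
{ intros. eapply der_cont. apply HN; auto. }
set (shift := fun (p : nat -> R) j => p (m + j)%nat).
set (L := Rabs (ln (2 * G / eps))). set (Rz := L / (A0 - A1)). set (Rw := 2 * (L + A1 * (1 + Rz)) / eta).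
assert (HL : 0 <= L) by apply Rabs_pos.
assert (HRz : 0 <= Rz) by (apply Rmult_le_pos; auto; left; apply Rinv_0_lt_compat; lra).
assert (HRw : 0 <= Rw).
{ apply Rmult_le_pos; [|left; apply Rinv_0_lt_compat; lra]. assert (0 <= A1 * (1 + Rz)) by (apply Rmult_le_pos; lra). lra. }
(* [first_bad] treats single points, so the pair is stored as one point of [2 m] coordinates, [z]
   first and [w] recovered by [shift]. *)
set (pack := fun (z w : nat -> R) j => if Nat.ltb j m then z j else w (j - m)%nat).
(* Packing changes the coordinates beyond [m]; [gap_lim] on constant sequences shows that the gap
   does not see them. *)
assert (Hpack : forall t z w, s <= t <= T -> convexity_gap n g N eps A t (pack z w) (shift (pack z w)) = convexity_gap n g N eps A t z w).
{ intros t z w Ht.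
  assert (Lc : is_lim_seq (fun k : nat => convexity_gap n g N eps A t (pack z w) (shift (pack z w))) (convexity_gap n g N eps A t z w)).
  { apply (gap_lim n g gd gvv h N eps A (fun _ => t) t (fun _ => pack z w) (fun _ => shift (pack z w)) z w Hsol); auto; try lra.
    - apply is_lim_seq_const.
    - intros i Hi. unfold pack. rewrite (proj2 (Nat.ltb_lt i m) Hi). apply is_lim_seq_const.
    - intros i Hi. unfold shift, pack. rewrite (proj2 (Nat.ltb_ge (m + i) m)) by lia. replace (m + i - m)%nat with i by lia. apply is_lim_seq_const. }
  apply is_lim_seq_unique in Lc. rewrite Lim_seq_const in Lc. congruence. }
destruct (first_bad (m + m) (fun t p => convexity_gap n g N eps A t p (shift p) <= 0) s T (1 + Rz + Rw)) with (t0 := t0) (p0 := pack z0 w0)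
  as [t [p [Ht [Htouch Hbefore]]]]; auto.
- intros t p Ht Hp.
  assert (Hgpos : 0 < g t p) by (apply Hsol; lra).
  assert (Hq : quad m (N t) (shift p) <= 0).
  { eapply Rle_trans; [apply HNeg; auto|]. generalize (dot_self_ge0 m (shift p)). nra. }
  assert (Hg2 : 0 < g t p <= G * exp (A1 * (1 + dot m p p))) by (split; auto).
  assert (Hb3 : eps * gauss_barrier m (A t) p <= 2 * exp (/ 2 * quad m (N t) (shift p)) * g t p).
  { unfold convexity_gap in Hp. fold m in Hp. generalize (sqrt_pos (g t (vadd p (shift p) 1) * g t (vadd p (shift p) (-1)))). lra. }
  destruct (gap_bounded n g N eps (A t) A0 A1 G t p (shift p) Heps HA1 (HAA t Ht) HG Hg2 Hb3 Hq) as [B1 B2].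
  fold m L in B1, B2. fold Rz in B1, B2.
  assert (B3 : dot m (shift p) (shift p) <= Rw).
  { unfold Rw. apply (Rmult_le_reg_r eta); auto. unfold Rdiv. rewrite Rmult_assoc, Rinv_l by lra. specialize (HNeg t (shift p) Ht). lra. }
  assert (Babs : forall x, x ^ 2 <= Rz + Rw -> Rabs x <= 1 + Rz + Rw) by (intros x Hx; apply Rabs_le; split; nra).
  intros i Hi. apply Babs. destruct (Nat.lt_ge_cases i m) as [Li|Li].
  + generalize (coord_sq_le m p i Li). lra.
  + generalize (coord_sq_le m (shift p) (i - m) ltac:(lia)). unfold shift at 1. replace (m + (i - m))%nat with i by lia. lra.
- intros tk t pk p Hk L1 L2.
  assert (Ht : s <= t <= T) by (apply (lim_interval tk); auto; apply Hk).
  apply (lim_le (fun k => convexity_gap n g N eps A (tk k) (pk k) (shift (pk k))) (fun _ => 0)); [intros k; apply Hk| |apply is_lim_seq_const].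
  apply (gap_lim n g gd gvv h); auto; try lra.
  + intros i Hi. apply L2. lia.
  + intros i Hi. apply L2. lia.
- intros p Hp. specialize (Hinit p (shift p)). lra.
- rewrite Hpack; auto.
- assert (Hpos' : forall t' z w, s <= t' < t -> 0 < convexity_gap n g N eps A t' z w).
  { intros t' z w Ht'. apply Rnot_le_lt; intros Hle. apply (Hbefore t' (pack z w)); auto. rewrite Hpack; auto; lra. }
  assert (Hat : forall z w, 0 <= convexity_gap n g N eps A t z w).
  { intros z w. apply (left_limit_nonneg (fun r => convexity_gap n g N eps A r z w) s t); [lra|intros; apply Hpos'; lra|].
    apply (gap_lim n g gd gvv h N eps A (fun k => t + (s - t) * / (INR k + 1)) t (fun _ => z) (fun _ => w)); auto; try lra;
      try (intros; apply is_lim_seq_const).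
    + intros; apply HNc; auto; lra.
    + apply lim_approach. }
  assert (Hz : convexity_gap n g N eps A t p (shift p) = 0) by (apply Rle_antisym; auto).
  assert (HGt : barrier_slope n A0 c * (t - s) <= A0) by nra.
  apply (gap_no_touching n g gd gvv h K N s t A0 c eps p (shift p)); auto; try lra.
  + intros; apply HN; auto; lra.
  + apply HNs; lra.
Qed.

Lemma gap_barrier_ext n g N eps A A' t z w : A t = A' t ->
  convexity_gap n g N eps A t z w = convexity_gap n g N eps A' t z w.
Proof. unfold convexity_gap. intros ->; auto. Qed.

Lemma gap_eps_limit n g N t z w A0 : (forall eps, 0 < eps -> exists A, A t <= A0 /\ 0 < convexity_gap n g N eps A t z w) ->
  exp (/ 2 * quad (2 * n) (N t) w) * g t z <= sqrt (g t (vadd z w 1) * g t (vadd z w (-1))).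
Proof.
intros H. apply Rnot_lt_le; intros Hlt.
set (x := sqrt (g t (vadd z w 1) * g t (vadd z w (-1)))) in *. set (y := exp (/ 2 * quad (2 * n) (N t) w) * g t z) in *.
set (B := exp (A0 * (1 + dot (2 * n) z z))). assert (HB : 0 < B) by apply exp_pos.
destruct (H ((y - x) / B)) as [A [HA Hgap]]; [apply Rdiv_lt_0_compat; lra|].
assert (HX := dot_self_ge0 (2 * n) z).
assert (HBl : gauss_barrier (2 * n) (A t) z <= B) by (apply exp_le, Rmult_le_compat_r; lra).
assert ((y - x) / B * gauss_barrier (2 * n) (A t) z <= y - x).
{ apply Rle_trans with ((y - x) / B * B); [apply Rmult_le_compat_l; auto; left; apply Rdiv_lt_0_compat; lra|right; field; lra]. }
unfold convexity_gap in Hgap. fold x in Hgap. unfold y in *. lra.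
Qed.

(* As N(t - t0) tends to -oo, the comparison function degenerates and the gap becomes positive. *)
Lemma gap_initially_positive n g gd gvv h K N A0 A1 G eps t0 t :
  kinetic_solution n g gd gvv h -> 0 < t0 < t -> 0 < A1 < A0 -> 0 < eps ->
  symmetric (2 * n) K -> riccati_solution n K N -> inv_tends_to_zero (2 * n) N ->
  0 < G -> (forall r z, t0 <= r <= t -> g r z <= G * exp (A1 * (1 + dot (2 * n) z z))) ->
  exists s, t0 < s < t /\ forall z w, 0 < convexity_gap n g (fun r => N (r - t0)) eps (fun _ => A0) s z w.
Proof.
intros Hsol Ht HA1 Heps HK HN Hinv HG Hgrow. apply NNPP; intros Hn.
set (m := (2 * n)%nat) in *.
destruct (riccati_neg_near_0 n K N HK HN Hinv 0) as [d0 [Hd0 Hneg0]].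
set (dl := Rmin d0 (t - t0) / 2).
assert (D0 : 0 < Rmin d0 (t - t0)) by (apply Rmin_glb_lt; lra).
assert (D1 := Rmin_l d0 (t - t0)). assert (D2 := Rmin_r d0 (t - t0)).
set (sk := fun k : nat => t0 + dl * / (INR k + 1)).
assert (Hsk : forall k, t0 < sk k < t /\ 0 < sk k - t0 < d0).
{ intros k. assert (Hi := inv_succ_bounds k).
  assert (0 < dl * / (INR k + 1) <= dl) by (split; unfold dl in *; nra). unfold sk. unfold dl in *. lra. }
assert (Lsk : is_lim_seq sk t0) by apply lim_approach.
assert (Hzw : forall k, exists zw : (nat -> R) * (nat -> R), convexity_gap n g (fun r => N (r - t0)) eps (fun _ => A0) (sk k) (fst zw) (snd zw) <= 0).
{ intros k. apply NNPP; intros Hk. apply Hn. exists (sk k). split; [apply Hsk|]. intros z w.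
  apply Rnot_le_lt; intros Hle. apply Hk. exists (z, w); auto. }
destruct (choice _ Hzw) as [zw Hzw'].
set (zk := fun k => fst (zw k)). set (wk := fun k => snd (zw k)).
set (L := Rabs (ln (2 * G / eps))). set (Rz := L / (A0 - A1)). set (Rw := 2 * (L + A1 * (1 + Rz))).
assert (HL : 0 <= L) by apply Rabs_pos.
assert (HRz : 0 <= Rz) by (apply Rmult_le_pos; auto; left; apply Rinv_0_lt_compat; lra).
assert (HRw : 0 <= Rw).
{ unfold Rw. assert (0 <= A1 * (1 + Rz)) by (apply Rmult_le_pos; lra). lra. }
assert (Hq : forall k, quad m (N (sk k - t0)) (wk k) <= 0).
{ intros k. destruct (Hsk k) as [_ S2]. specialize (Hneg0 (sk k - t0) (wk k) S2). fold m in Hneg0. lra. }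
assert (Hb : forall k, dot m (zk k) (zk k) <= Rz /\ - quad m (N (sk k - t0)) (wk k) <= Rw).
{ intros k. destruct (Hsk k) as [S1 S2].
  apply (gap_bounded n g (fun r => N (r - t0)) eps A0 A0 A1 G (sk k) (zk k) (wk k)); auto; try lra.
  - split; [apply Hsol; lra|apply Hgrow; lra].
  - specialize (Hzw' k). unfold convexity_gap in Hzw'. fold m (zk k) (wk k) in Hzw'. fold m.
    generalize (sqrt_pos (g (sk k) (vadd (zk k) (wk k) 1) * g (sk k) (vadd (zk k) (wk k) (-1)))). lra. }
(* [- N(w,w)] stays below [Rw] while [N] tends to minus infinity, so [w] tends to 0; the multiple
   [(Rw + 1) / ep ^ 2] forces [|w_i| < ep]. *)
assert (Lw : forall i, (i < m)%nat -> is_lim_seq (fun k => wk k i) 0).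
{ intros i Hi. apply is_lim_seq_spec. intros ep. assert (Hep := cond_pos ep).
  destruct (riccati_neg_near_0 n K N HK HN Hinv ((Rw + 1) / ep ^ 2)) as [d [Hd Hneg]]. fold m in Hneg.
  apply is_lim_seq_spec in Lsk. destruct (Lsk (mkposreal d Hd)) as [k0 Hk0]. exists k0. intros k Hk.
  specialize (Hk0 k Hk). simpl in Hk0. destruct (Hsk k) as [S1 S2]. rewrite Rabs_right in Hk0 by lra.
  specialize (Hneg (sk k - t0) (wk k) ltac:(lra)). destruct (Hb k) as [_ B2].
  assert (C := coord_sq_le m (wk k) i Hi).
  assert (He2 : 0 < ep ^ 2) by (apply pow_lt; auto).
  assert (Hw : (Rw + 1) / ep ^ 2 * wk k i ^ 2 <= Rw).
  { apply Rle_trans with ((Rw + 1) / ep ^ 2 * dot m (wk k) (wk k)); [apply Rmult_le_compat_l; auto; left; apply Rdiv_lt_0_compat; lra|lra]. }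
  rewrite Rminus_0_r.
  assert (wk k i ^ 2 < ep ^ 2).
  { apply Rnot_le_lt; intros Hle. assert ((Rw + 1) / ep ^ 2 * ep ^ 2 <= (Rw + 1) / ep ^ 2 * wk k i ^ 2) by (apply Rmult_le_compat_l; auto; left; apply Rdiv_lt_0_compat; lra).
    replace ((Rw + 1) / ep ^ 2 * ep ^ 2) with (Rw + 1) in * by (field; lra). lra. }
  apply Rabs_lt_between. split; nra. }
destruct (bounded_subseq m zk (1 + Rz)) as [sg [z [Hsg Lz]]].
{ intros k i Hi. assert (C := coord_sq_le m (zk k) i Hi). destruct (Hb k) as [B1 _]. apply Rabs_le. split; nra. }
assert (Lsub : forall (f : nat -> R) (l : R), is_lim_seq f l -> is_lim_seq (fun k => f (sg k)) l).
{ intros f l Hf. apply (is_lim_seq_subseq f); auto. apply eventually_subseq; auto. }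
assert (Lg : forall c, is_lim_seq (fun k => g (sk (sg k)) (vadd (zk (sg k)) (wk (sg k)) c)) (g t0 z)).
{ intros c. apply (proj1 (proj2 Hsol)); [lra|apply (Lsub sk); auto|]. intros i Hi.
  replace (Finite (z i)) with (Finite (vadd z (fun _ => 0) c i)) by (unfold vadd; f_equal; ring).
  apply lim_vadd; [apply Lz; auto|]. apply (Lsub (fun k => wk k i)). apply Lw; auto. }
assert (Lgz : is_lim_seq (fun k => g (sk (sg k)) (zk (sg k))) (g t0 z)).
{ apply (proj1 (proj2 Hsol)); [lra|apply (Lsub sk); auto|]. intros i Hi. apply Lz; auto. }
assert (Hg0 : 0 < g t0 z) by (apply Hsol; lra).
assert (Lall : is_lim_seq (fun k => 2 * sqrt (g (sk (sg k)) (vadd (zk (sg k)) (wk (sg k)) 1) * g (sk (sg k)) (vadd (zk (sg k)) (wk (sg k)) (-1))) - 2 * g (sk (sg k)) (zk (sg k)) + eps)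
  (2 * sqrt (g t0 z * g t0 z) - 2 * g t0 z + eps)).
{ apply is_lim_seq_plus'; [apply is_lim_seq_minus'|apply is_lim_seq_const].
  - apply is_lim_seq_mult'; [apply is_lim_seq_const|]. apply lim_sqrt; [nra|]. apply is_lim_seq_mult'; auto.
  - apply is_lim_seq_mult'; [apply is_lim_seq_const|auto]. }
(* The exponential factor is at most 1 and the barrier at least 1. In the limit all three points
   merge and [eps <= 0] remains, which is absurd. *)
assert (Hfin : 2 * sqrt (g t0 z * g t0 z) - 2 * g t0 z + eps <= 0).
{ refine (lim_le _ (fun _ => 0) _ 0 _ Lall (is_lim_seq_const 0)).
  intros k. set (q := sg k). specialize (Hzw' q). unfold convexity_gap in Hzw'. fold m (zk q) (wk q) in Hzw'.
  destruct (Hsk q) as [S1 S2].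
  assert (Hgq : 0 < g (sk q) (zk q)) by (apply Hsol; lra).
  assert (E1 : exp (/ 2 * quad m (N (sk q - t0)) (wk q)) <= 1).
  { rewrite <- exp_0. apply exp_le. specialize (Hq q). lra. }
  assert (B1 : 1 <= gauss_barrier m A0 (zk q)).
  { rewrite <- exp_0. apply exp_le. apply Rmult_le_pos; [lra|]. generalize (dot_self_ge0 m (zk q)). lra. }
  assert (exp (/ 2 * quad m (N (sk q - t0)) (wk q)) * g (sk q) (zk q) <= 1 * g (sk q) (zk q)) by (apply Rmult_le_compat_r; lra).
  assert (eps * 1 <= eps * gauss_barrier m A0 (zk q)) by (apply Rmult_le_compat_l; lra). lra. }
rewrite sqrt_square in Hfin; lra.
Qed.

(** Three stages: the time-shifted comparison function [N(t - t0)] over a time at most [tau], then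
    [t0 -> 0], then restarts with the unshifted [N] to reach later times. *)
Lemma log_convexity n g gd gvv h K N A1 c :
  kinetic_solution n g gd gvv h -> 0 < A1 -> 0 <= c ->
  (forall z, h z <= c * (1 + dot (2 * n) z z)) ->
  (forall z w, - quad (2 * n) K w <= h (vadd z w 1) + h (vadd z w (-1)) - 2 * h z) ->
  (forall w, 0 <= quad (2 * n) K w) ->
  symmetric (2 * n) K -> riccati_solution n K N -> inv_tends_to_zero (2 * n) N ->
  (forall s T, 0 < s -> exists G, 0 < G /\ forall t z, s <= t <= T -> g t z <= G * exp (A1 * (1 + dot (2 * n) z z))) ->
  forall t z w, 0 < t -> exp (/ 2 * quad (2 * n) (N t) w) * g t z <= sqrt (g t (vadd z w 1) * g t (vadd z w (-1))).
Proof.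
intros Hsol HA1 Hc Hhup Hhc HKp HK HN Hinv Hgrow.
set (m := (2 * n)%nat) in *.
assert (HNs := riccati_symmetric n K N HK HN Hinv).
set (A0 := A1 + 1).
assert (Hsl := barrier_slope_pos n A0 c ltac:(unfold A0; lra) Hc). set (sl := barrier_slope n A0 c) in *.
(* During this time the exponent rises from [A0] to [2 A0], the range allowed by
   [barrier_supersolution]. *)
set (tau := A0 / sl).
assert (Htau : 0 < tau) by (apply Rdiv_lt_0_compat; unfold A0; lra).
assert (Hsltau : sl * tau = A0) by (unfold tau; field; lra).
assert (Hshort : forall t0 t z w, 0 < t0 < t -> t - t0 <= tau ->
  exp (/ 2 * quad m (N (t - t0)) w) * g t z <= sqrt (g t (vadd z w 1) * g t (vadd z w (-1)))).
{ intros t0 t z w Ht Httau. apply (gap_eps_limit n g (fun r => N (r - t0)) t z w (2 * A0)).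
  intros eps Heps. destruct (Hgrow t0 t (proj1 Ht)) as [G [HG HgG]].
  destruct (gap_initially_positive n g gd gvv h K N A0 A1 G eps t0 t) as [s [Hs Hinit]]; auto; try (unfold A0; lra).
  destruct (riccati_negative n K N HK HKp HN Hinv (s - t0) (t - t0)) as [eta [Heta Hneg]]; [lra|].
  exists (fun r => A0 + sl * (r - s)). split; [nra|].
  apply (log_convexity_step n g gd gvv h K (fun r => N (r - t0)) s t A0 A1 G c eps eta); auto; try lra.
  - unfold A0; lra.
  - fold sl. nra.
  - intros r i j Hr Hi Hj.
    apply (der_ext (fun r => N (r - t0) i j) _ _ (riccati_rhs n (N (r - t0)) K i j * (1 - 0))); [auto|ring|].
    apply (der_comp (fun x => N x i j) (fun r => r - t0)); [apply HN; auto; lra|apply der_minus; [apply der_id|apply der_const]].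
  - intros r Hr. apply HNs. lra.
  - intros r v Hr. apply Hneg. lra.
  - intros r y Hr. apply HgG. lra.
  - intros y v. rewrite (gap_barrier_ext n g _ eps _ (fun _ => A0)); auto. fold sl. ring. }
assert (Hfirst : forall t z w, 0 < t <= tau -> exp (/ 2 * quad m (N t) w) * g t z <= sqrt (g t (vadd z w 1) * g t (vadd z w (-1)))).
{ intros t z w Ht.
  refine (lim_le (fun k => exp (/ 2 * quad m (N (t + - (t / 2) * / (INR k + 1) )) w) * g t z) _ (exp (/ 2 * quad m (N t) w) * g t z) _ _ _ (is_lim_seq_const _)).
  - intros k. assert (Hi := inv_succ_bounds k).
    replace (t + - (t / 2) * / (INR k + 1)) with (t - t / 2 * / (INR k + 1)) by ring. apply Hshort; [split|]; nra.
  - apply is_lim_seq_mult'; [|apply is_lim_seq_const]. apply lim_exp, is_lim_seq_mult'; [apply is_lim_seq_const|].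
    apply sumR_lim; intros i Hi. apply sumR_lim; intros j Hj.
    apply is_lim_seq_mult'; [|apply is_lim_seq_const]. apply is_lim_seq_mult'; [apply is_lim_seq_const|].
    apply (is_lim_seq_continuous (fun r => N r i j)); [eapply der_cont; apply HN; auto; lra|]. apply lim_approach. }
assert (Hall : forall (k : nat) t z w, 0 < t <= (INR k + 1) * tau -> exp (/ 2 * quad m (N t) w) * g t z <= sqrt (g t (vadd z w 1) * g t (vadd z w (-1)))).
{ induction k; intros t z w Ht.
  - apply Hfirst. simpl in Ht. lra.
  - rewrite S_INR in Ht.
    destruct (Rle_lt_dec t ((INR k + 1) * tau)) as [L|L]; [apply IHk; lra|].
    (* The induction hypothesis at [s] gives only a weak inequality; the barrier term makes the
       initial gap strictly positive. *)
    set (s := t - tau). assert (Hs : 0 < s).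
    { unfold s. generalize (pos_INR k). intros. assert (0 <= INR k * tau) by (apply Rmult_le_pos; lra). lra. }
    apply (gap_eps_limit n g N t z w (2 * A0)). intros eps Heps.
    destruct (Hgrow s t Hs) as [G [HG HgG]].
    destruct (riccati_negative n K N HK HKp HN Hinv s t Hs) as [eta [Heta Hneg]].
    exists (fun r => A0 + sl * (r - s)). split; [unfold s; nra|].
    apply (log_convexity_step n g gd gvv h K N s t A0 A1 G c eps eta); auto; try (unfold A0; lra).
    + fold sl. unfold s; nra.
    + intros r i j Hr Hi Hj. apply HN; auto; lra.
    + intros r Hr. apply HNs. lra.
    + intros y v. unfold convexity_gap. fold m.
      assert (I : exp (/ 2 * quad m (N s) v) * g s y <= sqrt (g s (vadd y v 1) * g s (vadd y v (-1)))) by (apply IHk; unfold s in *; lra).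
      assert (0 < eps * gauss_barrier m (A0 + barrier_slope n A0 c * (s - s)) y) by (apply Rmult_lt_0_compat; auto; apply exp_pos). lra.
    + unfold s; lra. }
intros t z w Ht. destruct (nfloor_ex (t / tau)) as [k [_ Hk]]; [left; apply Rdiv_lt_0_compat; auto|].
apply (Hall k). split; auto. left. apply (Rmult_lt_reg_r (/ tau)); [apply Rinv_0_lt_compat; auto|].
rewrite Rmult_assoc, Rinv_r by lra. unfold Rdiv in Hk. lra.
Qed.

(** * Finitely many coordinates, second order expansions, and the theorem *)

(* Only the first m coordinates vary; freezing the others makes every function depend on finitely many coordinates. *)
Definition freeze m (zeta z : nat -> R) : nat -> R := fun i => if Nat.ltb i m then z i else zeta i.

Lemma freeze_lt m zeta z i : (i < m)%nat -> freeze m zeta z i = z i.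
Proof. intros H. unfold freeze. rewrite (proj2 (Nat.ltb_lt i m) H); auto. Qed.

Lemma freeze_self m z : freeze m z z = z.
Proof. apply functional_extensionality; intros i. unfold freeze. destruct (Nat.ltb i m); auto. Qed.

Lemma freeze_upd m zeta z i s : (i < m)%nat -> freeze m zeta (upd z i s) = upd (freeze m zeta z) i s.
Proof.
intros H. apply functional_extensionality; intros j. unfold freeze, upd.
destruct (Nat.eq_dec j i) as [->|]; auto. rewrite (proj2 (Nat.ltb_lt i m) H); auto.
Qed.

Lemma partial_eq i f z l : derivable_pt_lim (fun s => f (upd z i s)) (z i) l -> partial i f z = l.
Proof.
intros H. unfold partial.
assert (S := epsilon_spec (inhabits 0) (fun l => derivable_pt_lim (fun s => f (upd z i s)) (z i) l) (ex_intro _ l H)).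
eapply uniqueness_limite; eauto.
Qed.

Lemma partial_freeze m zeta i f f' : (i < m)%nat -> Dp i (fun z => f (freeze m zeta z)) f' ->
  forall z, partial i f (freeze m zeta z) = f' z.
Proof.
intros Hi H z. apply partial_eq. apply is_derive_Reals. rewrite freeze_lt; auto.
apply (der_ext (fun s => f (freeze m zeta (upd z i s))) _ _ (f' z)); auto.
intros s. rewrite freeze_upd; auto.
Qed.

Lemma Dp_partial m zeta i f : (i < m)%nat ->
  (forall z, exists d, derivable_pt_lim (fun s => f (upd (freeze m zeta z) i s)) (freeze m zeta z i) d) ->
  Dp i (fun z => f (freeze m zeta z)) (fun z => partial i f (freeze m zeta z)).
Proof.
intros Hi H z. destruct (H z) as [d Hd]. rewrite (partial_eq i f _ d Hd).
apply is_derive_Reals in Hd. rewrite freeze_lt in Hd; auto.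
apply (der_ext (fun s => f (upd (freeze m zeta z) i s)) _ _ d); auto.
intros s. rewrite freeze_upd; auto.
Qed.

Lemma scont_freeze m zeta f : (forall z, cont_at m f (freeze m zeta z)) -> scont m (fun z => f (freeze m zeta z)).
Proof.
intros H zk z L. apply is_lim_seq_spec. intros eps.
destruct (H z eps (cond_pos eps)) as [del [Hdel Hc]].
assert (HN : forall j, (j <= m)%nat -> exists N, forall k, (N <= k)%nat -> forall i, (i < j)%nat -> Rabs (zk k i - z i) < del).
{ induction j as [|j IH]; intros Hj; [exists O; intros; lia|].
  destruct IH as [N HN]; [lia|]. assert (Lj := L j ltac:(lia)). apply is_lim_seq_spec in Lj.
  destruct (Lj (mkposreal del Hdel)) as [N' HN']. exists (max N N'). intros k Hk i Hi.
  destruct (Nat.eq_dec i j) as [->|]; [apply HN'; lia|apply HN; lia]. }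
destruct (HN m (Nat.le_refl _)) as [N HN']. exists N. intros k Hk. apply Hc.
- intros i Hi. rewrite !freeze_lt; auto.
- intros i Hi. unfold freeze. rewrite (proj2 (Nat.ltb_ge i m) Hi); auto.
Qed.

(** A class closed under sums and products, from which [h], which already contains second
    derivatives of U, is seen to be twice differentiable. *)
Fixpoint Ck m k (f : (nat -> R) -> R) : Prop :=
  scont m f /\ match k with O => True | S k' => exists f', forall i, (i < m)%nat -> Dp i f (f' i) /\ Ck m k' (f' i) end.

Lemma Ck_ext m k f g : (forall z, f z = g z) -> Ck m k f -> Ck m k g.
Proof. intros H. replace g with f; auto. apply functional_extensionality; auto. Qed.

Lemma Ck_scont m k f : Ck m k f -> scont m f.
Proof. destruct k; intros [H _]; auto. Qed.

Lemma Ck_pred m k f : Ck m (S k) f -> Ck m k f.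
Proof.
revert f. induction k as [|k IH]; intros f [H1 [f' H2]]; split; auto.
exists f'. intros i Hi. destruct (H2 i Hi) as [D C]. split; auto.
Qed.

Lemma scont_plus m f g : scont m f -> scont m g -> scont m (fun z => f z + g z).
Proof. intros H H' zk z L. apply is_lim_seq_plus'; auto. Qed.

Lemma scont_mult m f g : scont m f -> scont m g -> scont m (fun z => f z * g z).
Proof. intros H H' zk z L. apply is_lim_seq_mult'; auto. Qed.

Lemma Ck_const m k c : Ck m k (fun _ => c).
Proof.
revert c. induction k as [|k IH]; intros c; split; auto; try (intros zk z L; apply is_lim_seq_const).
exists (fun _ _ => 0). intros i Hi. split; [apply Dp_const|auto].
Qed.

Lemma Ck_coord m k j : (j < m)%nat -> Ck m k (fun z => z j).
Proof.
intros Hj. destruct k as [|k]; split; auto; try (intros zk z L; apply L; auto).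
exists (fun i _ => if Nat.eq_dec j i then 1 else 0). intros i Hi. split; [apply Dp_coord|].
destruct (Nat.eq_dec j i); apply Ck_const.
Qed.

Lemma Ck_plus m k f g : Ck m k f -> Ck m k g -> Ck m k (fun z => f z + g z).
Proof.
revert f g. induction k as [|k IH]; intros f g [H1 H2] [G1 G2]; split; auto using scont_plus.
destruct H2 as [f' Hf]. destruct G2 as [g' Hg]. exists (fun i z => f' i z + g' i z).
intros i Hi. destruct (Hf i Hi), (Hg i Hi). split; [apply Dp_plus; auto|apply IH; auto].
Qed.

Lemma Ck_mult m k f g : Ck m k f -> Ck m k g -> Ck m k (fun z => f z * g z).
Proof.
revert f g. induction k as [|k IH]; intros f g Hf0 Hg0; assert (Hf1 := Hf0); assert (Hg1 := Hg0);
destruct Hf1 as [H1 H2]; destruct Hg1 as [G1 G2]; split; auto using scont_mult.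
destruct H2 as [f' Hf]. destruct G2 as [g' Hg]. exists (fun i z => f' i z * g z + f z * g' i z).
intros i Hi. destruct (Hf i Hi), (Hg i Hi). split; [apply Dp_mult; auto|].
apply Ck_plus; apply IH; auto using Ck_pred.
Qed.

Lemma Ck_scal m k c f : Ck m k f -> Ck m k (fun z => c * f z).
Proof. intros H. apply Ck_mult; auto. apply Ck_const. Qed.

Lemma Ck_sumR m k p (f : nat -> (nat -> R) -> R) : (forall j, (j < p)%nat -> Ck m k (f j)) ->
  Ck m k (fun z => sumR p (fun j => f j z)).
Proof.
induction p; simpl; intros H; [apply Ck_const|]. apply Ck_plus; auto.
Qed.

Lemma Ck_derivs_2 m f : Ck m 2 f -> exists f1 f2, scont m f /\
  (forall i, (i < m)%nat -> Dp i f (f1 i) /\ scont m (f1 i)) /\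
  (forall i j, (i < m)%nat -> (j < m)%nat -> Dp i (f1 j) (f2 i j) /\ scont m (f2 i j)).
Proof.
intros [H0 [f1 H1]].
assert (Hx : forall j, exists f2j : nat -> (nat -> R) -> R, (j < m)%nat -> forall i, (i < m)%nat -> Dp i (f1 j) (f2j i) /\ scont m (f2j i)).
{ intros j. destruct (Nat.lt_ge_cases j m) as [L|L].
  - destruct (H1 j L) as [_ [_ [f2 H2]]]. exists f2. intros _ i Hi. destruct (H2 i Hi) as [D [C _]]. auto.
  - exists (fun _ _ => 0). lia. }
destruct (choice _ Hx) as [f2 Hf2].
exists f1, (fun i j => f2 j i). split; auto. split.
- intros i Hi. destruct (H1 i Hi) as [D [C _]]. auto.
- intros i j Hi Hj. apply Hf2; auto.
Qed.

Definition C2_derivs m (f : (nat -> R) -> R) (f1 : nat -> (nat -> R) -> R) (f2 : nat -> nat -> (nat -> R) -> R) :=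
  scont m f /\ (forall i, (i < m)%nat -> Dp i f (f1 i) /\ scont m (f1 i)) /\
  (forall i j, (i < m)%nat -> (j < m)%nat -> Dp i (f1 j) (f2 i j) /\ scont m (f2 i j)).

Lemma line_deriv2 m f f1 f2 z w s : C2_derivs m f f1 f2 ->
  is_derive (fun s => f (vadd z w s)) s (dot m w (fun i => f1 i (vadd z w s))) /\
  is_derive (fun s => dot m w (fun i => f1 i (vadd z w s))) s (quad m (fun i j => f2 i j (vadd z w s)) w).
Proof.
intros (H0 & H1 & H2). split.
- apply (line_deriv m f f1); auto; intros; apply H1; auto.
- apply (der_ext (fun s => sumR m (fun j => w j * f1 j (vadd z w s))) _ _ (sumR m (fun j => w j * sumR m (fun i => w i * f2 i j (vadd z w s))))).
  + auto.
  + unfold quad. rewrite sumR_swap. apply sumR_ext; intros j _. rewrite <- sumR_scal. apply sumR_ext; intros; ring.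
  + apply sumR_is_derive; intros j Hj. apply der_scal.
    apply (line_deriv m (f1 j) (fun i => f2 i j)).
    * intros i Hi; apply H2; auto.
    * intros i Hi; apply H2; auto.
    * apply H1; auto.
Qed.

Lemma vadd_zero_r z w : vadd z w 0 = z.
Proof. apply functional_extensionality; intros i. unfold vadd. ring. Qed.

(** Adding [c s^2 / 2] makes the restriction to the segment convex, so it lies above its tangent at
    0. *)
Lemma taylor_lower m f f1 f2 z w c : C2_derivs m f f1 f2 ->
  (forall s, 0 <= s <= 1 -> - c <= quad m (fun i j => f2 i j (vadd z w s)) w) ->
  f z + dot m (fun i => f1 i z) w - c / 2 <= f (vadd z w 1).
Proof.
intros H Hq.
set (F := fun s => f (vadd z w s) + c / 2 * (s * s)).
set (F1 := fun s => dot m w (fun i => f1 i (vadd z w s)) + c / 2 * (1 * s + s * 1)).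
assert (D1 : forall s, is_derive F s (F1 s)).
{ intros s. apply (der_plus (fun s => f (vadd z w s))); [apply (line_deriv2 m f f1 f2 z w s H)|].
  apply der_scal, der_mult; apply der_id. }
assert (D2 : forall s, is_derive F1 s (quad m (fun i j => f2 i j (vadd z w s)) w + c / 2 * (1 * 1 + 1 * 1))).
{ intros s. apply (der_plus (fun s => dot m w (fun i => f1 i (vadd z w s)))); [apply (line_deriv2 m f f1 f2 z w s H)|].
  apply der_scal. apply (der_plus (fun s => 1 * s) (fun s => s * 1)); [apply (der_scal (fun s => s)), der_id|].
  apply (der_ext (fun s => 1 * s) _ _ (1 * 1)); [intros; ring|auto|]. apply (der_scal (fun s => s)), der_id. }
assert (M1 : forall s, 0 <= s <= 1 -> F1 0 <= F1 s).
{ intros s [[Hs| <-] Hs1]; [|lra].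
  destruct (MVT_cor2 F1 (fun s => quad m (fun i j => f2 i j (vadd z w s)) w + c / 2 * (1 * 1 + 1 * 1)) 0 s Hs) as [r [Hr1 Hr2]].
  { intros; apply is_derive_Reals, D2. }
  specialize (Hq r ltac:(lra)). nra. }
destruct (MVT_cor2 F F1 0 1 Rlt_0_1) as [r [Hr1 Hr2]].
{ intros; apply is_derive_Reals, D1. }
specialize (M1 r ltac:(lra)).
unfold F in Hr1. rewrite vadd_zero_r in Hr1.
assert (E : F1 0 = dot m (fun i => f1 i z) w). { unfold F1. rewrite vadd_zero_r, dot_comm. ring. }
rewrite E in M1. lra.
Qed.

Lemma hess_freeze m zeta f f1 f2 : C2_derivs m (fun z => f (freeze m zeta z)) f1 f2 ->
  forall z i j, (i < m)%nat -> (j < m)%nat -> hess f (freeze m zeta z) i j = f2 i j z.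
Proof.
intros (_ & H1 & H2) z i j Hi Hj. unfold hess.
apply (partial_freeze m zeta i (partial j f) (f2 i j) Hi).
apply (Dp_ext i (f1 j) (f2 i j)); auto.
- apply H2; auto.
- intros y. symmetry. apply (partial_freeze m zeta j f); auto. apply H1; auto.
Qed.

Definition frozen_partial m zeta (f : (nat -> R) -> R) (l : list nat) (z : nat -> R) := iter_partial l f (freeze m zeta z).

Definition indices m (l : list nat) := Forall (fun i => (i < m)%nat) l.

Definition smooth_family m (F : list nat -> (nat -> R) -> R) :=
  forall l, indices m l -> scont m (F l) /\ forall i, (i < m)%nat -> Dp i (F l) (F (i :: l)).

Lemma smooth_freeze m zeta f : smooth_on m (fun _ => True) f -> smooth_family m (frozen_partial m zeta f).
Proof.
intros H l Hl. split.
- apply scont_freeze. intros z. apply (H l Hl (freeze m zeta z) I).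
- intros i Hi. apply (Dp_partial m zeta i (iter_partial l f) Hi). intros z. apply (H l Hl (freeze m zeta z) I); auto.
Qed.

Lemma smooth_family_Ck m F : smooth_family m F -> forall k l, indices m l -> Ck m k (F l).
Proof.
intros H k. induction k as [|k IH]; intros l Hl; split; auto; try apply (H l Hl).
exists (fun i => F (i :: l)). intros i Hi. split; [apply (H l Hl); auto|].
apply IH. constructor; auto.
Qed.

Lemma smooth_family_C2 m F : smooth_family m F -> C2_derivs m (F nil) (fun i => F (i :: nil)) (fun i j => F (i :: j :: nil)).
Proof.
intros H. assert (H0 : indices m nil) by constructor.
assert (H1 : forall i, (i < m)%nat -> indices m (i :: nil)) by (intros; constructor; auto).
assert (H2 : forall i j, (i < m)%nat -> (j < m)%nat -> indices m (i :: j :: nil)) by (intros; constructor; [auto|apply H1; auto]).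
split; [apply H; auto|]. split.
- intros i Hi. split; [apply (H nil H0); auto|apply (H _ (H1 i Hi))].
- intros i j Hi Hj. split; [apply (H _ (H1 j Hj)); auto|apply (H _ (H2 i j Hi Hj))].
Qed.

Lemma scont_exp m f : scont m f -> scont m (fun z => exp (f z)).
Proof. intros H zk z L. apply lim_exp; auto. Qed.

Definition potential n (D : list nat -> (nat -> R) -> R) (z : nat -> R) :=
  - / 2 * sumR n (fun i => z (n + i)%nat * D (i :: nil) z)
  + / 2 * sumR n (fun i => D ((n + i)%nat :: (n + i)%nat :: nil) z)
  - / 4 * sumR n (fun i => D ((n + i)%nat :: nil) z ^ 2).

Lemma potential_freeze n zeta U z : hfun n U (freeze (2 * n) zeta z) = potential n (frozen_partial (2 * n) zeta U) z.
Proof.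
unfold hfun, potential, frozen_partial. f_equal. f_equal. f_equal. apply sumR_ext; intros i Hi.
rewrite freeze_lt by lia. auto.
Qed.

Lemma potential_Ck n D : smooth_family (2 * n) D -> Ck (2 * n) 2 (potential n D).
Proof.
intros H. assert (HC := smooth_family_Ck _ _ H 2).
assert (I1 : forall i, (i < 2 * n)%nat -> indices (2 * n) (i :: nil)) by (intros; constructor; auto; constructor).
apply (Ck_ext _ _ (fun z => - / 2 * sumR n (fun i => z (n + i)%nat * D (i :: nil) z)
  + / 2 * sumR n (fun i => D ((n + i)%nat :: (n + i)%nat :: nil) z)
  + - / 4 * sumR n (fun i => D ((n + i)%nat :: nil) z * D ((n + i)%nat :: nil) z))).
- intros z. unfold potential. rewrite (sumR_ext n (fun i => D ((n + i)%nat :: nil) z ^ 2) (fun i => D ((n + i)%nat :: nil) z * D ((n + i)%nat :: nil) z)) by (intros; ring). ring.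
- apply Ck_plus; [apply Ck_plus|]; apply Ck_scal.
  + apply (Ck_sumR _ _ n (fun i z => z (n + i)%nat * D (i :: nil) z)). intros j Hj. apply Ck_mult; [apply Ck_coord; lia|apply HC, I1; lia].
  + apply (Ck_sumR _ _ n (fun i => D ((n + i)%nat :: (n + i)%nat :: nil))). intros j Hj. apply HC. constructor; [lia|apply I1; lia].
  + apply (Ck_sumR _ _ n (fun i z => D ((n + i)%nat :: nil) z * D ((n + i)%nat :: nil) z)). intros j Hj. apply Ck_mult; apply HC, I1; lia.
Qed.

(** * Ground-state transform and growth of the transformed solution *)

Definition ground_state (D : list nat -> (nat -> R) -> R) (z : nat -> R) := exp (- / 2 * D nil z).
Definition ground_d (D : list nat -> (nat -> R) -> R) i (z : nat -> R) := ground_state D z * (- / 2 * D (i :: nil) z).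
Definition ground_dd (D : list nat -> (nat -> R) -> R) i (z : nat -> R) :=
  ground_d D i z * (- / 2 * D (i :: nil) z) + ground_state D z * (- / 2 * D (i :: i :: nil) z).

Lemma ground_Dp m D i : smooth_family m D -> (i < m)%nat -> Dp i (ground_state D) (ground_d D i).
Proof. intros H Hi. apply Dp_exp, Dp_scal. apply (H nil); auto. constructor. Qed.

Lemma ground_Dp2 m D i : smooth_family m D -> (i < m)%nat -> Dp i (ground_d D i) (ground_dd D i).
Proof.
intros H Hi. apply Dp_mult; [eapply ground_Dp; eauto|]. apply Dp_scal. apply (H (i :: nil)); auto.
constructor; auto.
Qed.

Lemma ground_stationary n D : smooth_family (2 * n) D ->
  kinetic_stationary n (ground_state D) (ground_d D) (fun i => ground_d D (n + i)) (fun i => ground_dd D (n + i)) (potential n D).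
Proof.
intros H. split; [intros; apply exp_pos|]. split; [|split].
- apply scont_exp. apply (Ck_scont _ 0), Ck_scal, smooth_family_Ck; auto. constructor.
- intros i Hi. split; [|split].
  + apply (ground_Dp (2 * n)); auto; lia.
  + apply (ground_Dp (2 * n)); auto; lia.
  + apply (ground_Dp2 (2 * n)); auto; lia.
- intros z. unfold potential, ground_dd, ground_d.
  set (u := ground_state D z).
  rewrite (sumR_ext n (fun i => u * (- / 2 * D ((n + i)%nat :: nil) z) * (- / 2 * D ((n + i)%nat :: nil) z) + u * (- / 2 * D ((n + i)%nat :: (n + i)%nat :: nil) z))
    (fun i => u * / 4 * D ((n + i)%nat :: nil) z ^ 2 + (u * - / 2) * D ((n + i)%nat :: (n + i)%nat :: nil) z)) by (intros; field).
  rewrite (sumR_ext n (fun i => z (n + i)%nat * (u * (- / 2 * D (i :: nil) z))) (fun i => (u * - / 2) * (z (n + i)%nat * D (i :: nil) z))) by (intros; ring).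
  rewrite sumR_plus, !sumR_scal. ring.
Qed.

Lemma norms_sq n z : xnorm n z ^ 2 + vnorm n z ^ 2 = dot (2 * n) z z.
Proof.
unfold xnorm, vnorm. rewrite dot_double.
assert (S : forall m f, sqrt (sumR m (fun i => f i ^ 2)) ^ 2 = sumR m (fun i => f i ^ 2)).
{ intros m f. simpl. rewrite Rmult_1_r, sqrt_sqrt; auto. apply sumR_pos; intros i _. generalize (pow2_ge_0 (f i)). simpl. lra. }
rewrite (S n z), (S n (fun i => z (n + i)%nat)). auto.
Qed.

Lemma norms_freeze n zeta z : dot (2 * n) (freeze (2 * n) zeta z) (freeze (2 * n) zeta z) = dot (2 * n) z z.
Proof. apply dot_ext; intros; apply freeze_lt; auto. Qed.

(** As [ln u = - U / 2], the upper bound on Hess U is a lower bound here. For [|y| <= 1] one has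
    [|z + s y|^2 <= 2 |z|^2 + 2], hence the factor [exp (2 kap)] and the exponent [2 kap]; one half
    in [k0 / 4] is from [- U / 2], the other from Taylor. *)
Lemma ground_semiconvex n zeta U k0 kap : smooth_on (2 * n) (fun _ => True) U -> 0 <= k0 -> 0 <= kap ->
  (forall z xi,
     quad (2 * n) (hess U z) xi <=
     k0 * exp (kap * (xnorm n z ^ 2 + vnorm n z ^ 2)) * quad (2 * n) idm xi) ->
  locally_semiconvex (2 * n) (fun z => ln (ground_state (frozen_partial (2 * n) zeta U) z)) (k0 / 4 * exp (2 * kap)) (2 * kap).
Proof.
intros HU Hk0 Hkap HH z.
set (m := (2 * n)%nat) in *. set (D := frozen_partial m zeta U).
assert (HC := smooth_family_C2 m D (smooth_freeze m zeta U HU)).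
assert (HCn : C2_derivs m (fun z => - / 2 * D nil z) (fun i z => - / 2 * D (i :: nil) z) (fun i j z => - / 2 * D (i :: j :: nil) z)).
{ destruct HC as (C0 & C1 & C2). split; [|split].
  - apply scont_mult; auto. intros zk y L. apply is_lim_seq_const.
  - intros i Hi. destruct (C1 i Hi). split; [apply Dp_scal; auto|]. apply scont_mult; auto. intros zk y L. apply is_lim_seq_const.
  - intros i j Hi Hj. destruct (C2 i j Hi Hj). split; [apply Dp_scal; auto|]. apply scont_mult; auto. intros zk y L. apply is_lim_seq_const. }
exists (fun i => - / 2 * D (i :: nil) z). intros y Hy.
unfold ground_state. rewrite !ln_exp.
assert (T := taylor_lower m _ _ _ z y (k0 / 2 * exp (2 * kap) * exp (2 * kap * dot m z z) * dot m y y) HCn).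
cbv beta in T. eapply Rle_trans; [|apply T].
- right. field.
- intros s Hs. specialize (HH (freeze m zeta (vadd z y s)) y). rewrite norms_sq, quad_idm in HH. fold m in HH. unfold m in HH at 2 3. rewrite norms_freeze in HH. fold m in HH.
  rewrite (quad_ext m _ (fun i j => D (i :: j :: nil) (vadd z y s)) y y) in HH; auto.
  replace (quad m (fun i j => - / 2 * D (i :: j :: nil) (vadd z y s)) y) with (- / 2 * quad m (fun i j => D (i :: j :: nil) (vadd z y s)) y).
    2: { unfold quad. rewrite <- sumR_scal. apply sumR_ext; intros i _. rewrite <- sumR_scal. apply sumR_ext; intros; ring. }
    assert (G := dot_sq_add_le m z (fun i => s * y i)). rewrite dot_scal_l, (dot_comm m y), dot_scal_l in G.
    assert (Py := dot_self_ge0 m y).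
    assert (s * (s * dot m y y) <= 1 * 1) by (rewrite <- Rmult_assoc; apply Rmult_le_compat; nra).
    replace (vadd z (fun i => s * y i) 1) with (vadd z y s) in G by (apply functional_extensionality; intros i; unfold vadd; ring).
    assert (Ee : exp (kap * dot m (vadd z y s) (vadd z y s)) <= exp (2 * kap) * exp (2 * kap * dot m z z)).
    { rewrite <- exp_plus. apply exp_le. assert (kap * dot m (vadd z y s) (vadd z y s) <= kap * (2 * dot m z z + 2)) by (apply Rmult_le_compat_l; lra). lra. }
    assert (k0 * exp (kap * dot m (vadd z y s) (vadd z y s)) * dot m y y <= k0 * (exp (2 * kap) * exp (2 * kap * dot m z z)) * dot m y y).
    { apply Rmult_le_compat_r; auto. apply Rmult_le_compat_l; auto. }
    lra.
Qed.

Lemma potential_convexity n zeta U K : smooth_on (2 * n) (fun _ => True) U ->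
  (forall z xi, quad (2 * n) (hess (hfun n U) z) xi >= - quad (2 * n) K xi) ->
  exists f1 f2, C2_derivs (2 * n) (potential n (frozen_partial (2 * n) zeta U)) f1 f2 /\
   forall z xi, - quad (2 * n) K xi <= quad (2 * n) (fun i j => f2 i j z) xi.
Proof.
intros HU HH. set (m := (2 * n)%nat) in *. set (D := frozen_partial m zeta U).
destruct (Ck_derivs_2 m _ (potential_Ck n D (smooth_freeze m zeta U HU))) as [f1 [f2 HC]].
exists f1, f2. split; [exact HC|]. intros z xi. specialize (HH (freeze m zeta z) xi).
rewrite (quad_ext m _ (fun i j => f2 i j z) xi xi) in HH; auto; [lra|].
intros i j Hi Hj. apply (hess_freeze m zeta (hfun n U) f1 f2); auto.
replace (fun z0 => hfun n U (freeze m zeta z0)) with (potential n D); auto.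
apply functional_extensionality; intros y. symmetry. apply potential_freeze.
Qed.

Lemma potential_semiconvex n h f1 f2 K : C2_derivs (2 * n) h f1 f2 ->
  (forall z xi, - quad (2 * n) K xi <= quad (2 * n) (fun i j => f2 i j z) xi) ->
  (exists k, 0 <= k /\ semiconvex (2 * n) h k) /\
  forall z w, - quad (2 * n) K w <= h (vadd z w 1) + h (vadd z w (-1)) - 2 * h z.
Proof.
intros HC Hq. set (m := (2 * n)%nat) in *. split.
- destruct (mat_bounded m K) as [c [Hc HK]]. assert (Hm := pos_INR m).
  assert (Hk0 : 0 <= INR m * c) by (apply Rmult_le_pos; auto).
  exists (INR m * c). split; auto. intros z. exists (fun i => f1 i z). intros y.
  assert (T := taylor_lower m h f1 f2 z y (quad m K y) HC (fun s _ => Hq (vadd z y s) y)).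
  assert (B := quad_le m K y c HK). apply Rabs_le_between in B.
  assert (P := dot_self_ge0 m y). assert (0 <= INR m * c * dot m y y) by (apply Rmult_le_pos; auto). lra.
- intros z w.
  assert (T1 := taylor_lower m h f1 f2 z w (quad m K w) HC (fun s _ => Hq (vadd z w s) w)).
  set (w' := fun i => -1 * w i).
  assert (E : quad m K w' = quad m K w) by (unfold w'; rewrite quad_scal; ring).
  assert (T2 := taylor_lower m h f1 f2 z w' (quad m K w') HC (fun s _ => Hq (vadd z w' s) w')).
  rewrite E in T2. replace (vadd z w' 1) with (vadd z w (-1)) in T2 by (apply functional_extensionality; intros i; unfold vadd, w'; ring).
  unfold w' in T2. rewrite (dot_comm m _ (fun i => -1 * w i)), dot_scal_l, (dot_comm m w) in T2. lra.
Qed.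

Definition space_time_smooth m (F : list nat -> R -> (nat -> R) -> R) :=
  forall l, indices m l ->
   (forall t i, 0 < t -> (i < m)%nat -> Dp i (F l t) (F (i :: l) t)) /\
   (forall tk t (pk : nat -> nat -> R) (p : nat -> R), 0 < t -> is_lim_seq tk (Finite t) ->
     (forall i, (i < m)%nat -> is_lim_seq (fun k => pk k i) (p i)) ->
     is_lim_seq (fun k => F l (tk k) (pk k)) (F l t p)).

(** In the joint smoothness hypothesis time is coordinate 0, so space indices are shifted by one.
    The predicates passed to [epsilon] coincide, so the identity holds wherever or not the
    derivatives exist. *)
Lemma iter_partial_time (rho : R -> (nat -> R) -> R) l w :
  iter_partial (map S l) (fun w => rho (w O) (fun i => w (S i))) w = iter_partial l (rho (w O)) (fun i => w (S i)).
Proof.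
revert w. induction l as [|i l IH]; intros w; auto.
change (partial (S i) (iter_partial (map S l) (fun w => rho (w O) (fun i => w (S i)))) w =
  partial i (iter_partial l (rho (w O))) (fun i => w (S i))).
unfold partial. f_equal. apply functional_extensionality; intros d.
f_equal. apply functional_extensionality; intros s. rewrite IH.
replace (upd w (S i) s O) with (w O) by (rewrite upd_neq; auto; lia). f_equal.
apply functional_extensionality; intros j. unfold upd.
destruct (Nat.eq_dec (S j) (S i)), (Nat.eq_dec j i); auto; lia.
Qed.

Lemma space_time_smooth_freeze m zeta rho :
  smooth_on (m + 1) (fun w => 0 < w O) (fun w => rho (w O) (fun i => w (S i))) ->
  space_time_smooth m (fun l t => frozen_partial m zeta (rho t) l).
Proof.
intros H l Hl.
set (sp := fun t (z : nat -> R) j => match j with O => t | S j => freeze m zeta z j end).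
assert (HSl : Forall (fun i => (i < m + 1)%nat) (map S l)).
{ apply Forall_map. revert Hl. apply Forall_impl. intros; lia. }
split.
- intros t i Ht Hi. apply (Dp_partial m zeta i (iter_partial l (rho t)) Hi). intros z.
  destruct (proj1 (H (map S l) HSl (sp t z) Ht) (S i) ltac:(lia)) as [d Hd]. exists d.
  replace (fun s => iter_partial l (rho t) (upd (freeze m zeta z) i s)) with (fun s => iter_partial (map S l) (fun w => rho (w O) (fun i => w (S i))) (upd (sp t z) (S i) s)); auto.
  apply functional_extensionality; intros s. rewrite iter_partial_time.
  rewrite upd_neq by lia. unfold sp at 1. f_equal.
  apply functional_extensionality; intros j. unfold upd, sp.
  destruct (Nat.eq_dec (S j) (S i)), (Nat.eq_dec j i); auto; lia.
- intros tk t pk p Ht Lt Lp. apply is_lim_seq_spec. intros eps.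
  destruct (proj2 (H (map S l) HSl (sp t p) Ht) eps (cond_pos eps)) as [del [Hdel Hc]].
  assert (HN : forall j, (j <= m)%nat -> exists N, forall k, (N <= k)%nat -> forall i, (i < j)%nat -> Rabs (pk k i - p i) < del).
  { induction j as [|j IH]; intros Hj; [exists O; intros; lia|].
    destruct IH as [N HN]; [lia|]. assert (Lj := Lp j ltac:(lia)). apply is_lim_seq_spec in Lj.
    destruct (Lj (mkposreal del Hdel)) as [N' HN']. exists (max N N'). intros k Hk i Hi.
    destruct (Nat.eq_dec i j) as [->|]; [apply HN'; lia|apply HN; lia]. }
  destruct (HN m (Nat.le_refl _)) as [N HN']. apply is_lim_seq_spec in Lt.
  destruct (Lt (mkposreal del Hdel)) as [N' HN''].
  exists (max N N'). intros k Hk. specialize (Hc (sp (tk k) (pk k))). rewrite !iter_partial_time in Hc.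
  apply Hc.
  + intros [|i] Hi; simpl; [apply HN''; lia|]. rewrite !freeze_lt by lia. apply HN'; lia.
  + intros [|i] Hi; simpl; [lia|]. unfold freeze. rewrite (proj2 (Nat.ltb_ge i m)); auto. lia.
Qed.

(** The cross term [2 u_v rho_v] of the Laplacian equals [- u U_v rho_v], which is exactly the
    drift; stationarity of [u] supplies the remaining terms multiplying [rho + e]. *)
Lemma transformed_solution n (D : list nat -> (nat -> R) -> R) (F : list nat -> R -> (nat -> R) -> R) e :
  smooth_family (2 * n) D -> space_time_smooth (2 * n) F -> 0 < e ->
  (forall t z, 0 < t -> 0 <= F nil t z) ->
  (forall t z, 0 < t -> is_derive (fun s => F nil s z) t
     (sumR n (fun i => F ((n + i)%nat :: (n + i)%nat :: nil) t z)
      - sumR n (fun i => D ((n + i)%nat :: nil) z * F ((n + i)%nat :: nil) t z)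
      - sumR n (fun i => z (n + i)%nat * F (i :: nil) t z))) ->
  kinetic_solution n (fun t z => ground_state D z * (F nil t z + e))
    (fun i t z => ground_d D i z * (F nil t z + e) + ground_state D z * F (i :: nil) t z)
    (fun i t z => (ground_dd D (n + i) z * (F nil t z + e) + ground_d D (n + i) z * F ((n + i)%nat :: nil) t z)
      + (ground_d D (n + i) z * F ((n + i)%nat :: nil) t z + ground_state D z * F ((n + i)%nat :: (n + i)%nat :: nil) t z))
    (potential n D).
Proof.
intros HD HF He Hpos Heq. destruct (ground_stationary n D HD) as (Hu & Hcu & _ & Hst).
assert (I0 : indices (2 * n) nil) by constructor.
assert (I1 : forall i, (i < 2 * n)%nat -> indices (2 * n) (i :: nil)) by (intros; constructor; auto).
assert (Fe : forall t i, 0 < t -> (i < 2 * n)%nat -> Dp i (fun z => F nil t z + e) (F (i :: nil) t)).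
{ intros t i Ht Hi. apply (Dp_ext i (fun z => F nil t z + e) (fun z => F (i :: nil) t z + 0)); auto; [|intros; ring].
  apply Dp_plus; [apply HF; auto|apply Dp_const]. }
split; [|split; [|split; [|split]]].
- intros t z Ht. apply Rmult_lt_0_compat; auto. specialize (Hpos t z Ht). lra.
- intros tk t pk p Ht Lt Lp. apply is_lim_seq_mult'; [apply Hcu; auto|].
  apply is_lim_seq_plus'; [apply (HF nil I0); auto|apply is_lim_seq_const].
- intros t i Ht Hi. apply Dp_mult; [apply (ground_Dp (2 * n)); auto|apply Fe; auto].
- intros t i Ht Hi. assert (Hi' : (n + i < 2 * n)%nat) by lia.
  apply Dp_plus; apply Dp_mult.
  + apply (ground_Dp2 (2 * n)); auto.
  + apply Fe; auto.
  + apply (ground_Dp (2 * n)); auto.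
  + apply (HF (_ :: nil)); auto.
- intros t z Ht. specialize (Heq t z Ht). specialize (Hst z).
  eapply (der_ext (fun s => ground_state D z * (F nil s z + e))); [auto| |apply der_scal, (der_plus (fun s => F nil s z)); [exact Heq|apply der_const]].
  set (u := ground_state D z) in *. set (r := F nil t z).
  unfold kinetic_rhs.
  set (S1 := sumR n (fun i => F ((n + i)%nat :: (n + i)%nat :: nil) t z)).
  set (S2 := sumR n (fun i => D ((n + i)%nat :: nil) z * F ((n + i)%nat :: nil) t z)).
  set (S3 := sumR n (fun i => z (n + i)%nat * F (i :: nil) t z)).
  rewrite (sumR_ext n (fun i => _ + _ - _) (fun i => (r + e) * ground_dd D (n + i) z + (- u) * (D ((n + i)%nat :: nil) z * F ((n + i)%nat :: nil) t z)
    + u * F ((n + i)%nat :: (n + i)%nat :: nil) t z + (- (r + e)) * (z (n + i)%nat * ground_d D i z) + (- u) * (z (n + i)%nat * F (i :: nil) t z))).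
  2: { intros i _. unfold ground_d. fold u r. field. }
  rewrite !sumR_plus, !sumR_scal. fold S1 S2 S3.
  assert (Hst' : sumR n (fun i => ground_dd D (n + i) z) - sumR n (fun i => z (n + i)%nat * ground_d D i z) = - potential n D z * u) by lra.
  set (T1 := sumR n (fun i => ground_dd D (n + i) z)) in *. set (T2 := sumR n (fun i => z (n + i)%nat * ground_d D i z)) in *.
  replace T1 with (T2 - potential n D z * u) by lra. ring.
Qed.

(** The gradient bound is integrated along the ray from the origin, where [rho] is bounded on the
    compact time interval. One factor [exp (c X)] comes from [u] itself, a second from [u] in the
    gradient bound. *)
Lemma transformed_growth n D F e c c0 :
  space_time_smooth (2 * n) F -> 0 < e -> 0 <= c -> 0 <= c0 ->
  (forall t z, 0 < t -> 0 <= F nil t z) ->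
  (forall t z, 0 < t -> exists d, is_derive (fun s => F nil s z) t d) ->
  (forall z, ln (ground_state D z) <= c * (1 + dot (2 * n) z z)) ->
  (forall t z, 0 < t -> sqrt (sumR (2 * n) (fun i => F (i :: nil) t z ^ 2)) <= c0 * ground_state D z * (xnorm n z + vnorm n z)) ->
  forall s T, 0 < s -> exists G, 0 < G /\ forall t z, s <= t <= T ->
    ground_state D z * (F nil t z + e) <= G * exp ((2 * c + 1) * (1 + dot (2 * n) z z)).
Proof.
intros HF He Hc Hc0 Hpos Hder Hu Hgrad s T Hs. set (m := (2 * n)%nat) in *.
destruct (Rle_lt_dec s T) as [HsT|HsT]; [|exists 1; split; [lra|intros; lra]].
set (o := fun _ : nat => 0 : R).
assert (Hx : forall t, exists d, 0 < t -> is_derive (fun s => F nil s o) t d).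
{ intros t. destruct (Rlt_le_dec 0 t) as [L|L]; [|exists 0; lra]. destruct (Hder t o L) as [d Hd]. exists d; auto. }
destruct (choice _ Hx) as [dF HdF].
destruct (derivs_bounded 1 (fun t _ _ => F nil t o) (fun t _ _ => dF t) s T HsT) as [r0 [Hr0 Hr]].
{ intros; apply HdF; lra. }
exists (r0 + e + 2 * c0). split; [lra|]. intros t z Ht.
assert (Ht0 : 0 < t) by lra.
assert (Hr1 : F nil t o <= r0) by (eapply Rle_trans; [apply Rle_abs|]; apply (Hr t O O); auto).
set (X := 1 + dot m z z). assert (HX : 1 <= X) by (unfold X; generalize (dot_self_ge0 m z); lra).
assert (Hug : forall y, 0 < ground_state D y <= exp (c * (1 + dot m y y))).
{ intros y. assert (P : 0 < ground_state D y) by apply exp_pos. split; auto.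
  rewrite <- (exp_ln (ground_state D y)) by auto. apply exp_le, Hu. }
assert (Hline : F nil t z - F nil t o <= 2 * c0 * X * exp (c * X)).
{ assert (I0 : indices m nil) by constructor.
  assert (I1 : forall i, (i < m)%nat -> indices m (i :: nil)) by (intros; constructor; auto).
  assert (SC : forall l, indices m l -> scont m (F l t)).
  { intros l Hl zk y L. apply (HF l Hl); auto. apply is_lim_seq_const. }
  destruct (MVT_cor2 (fun r => F nil t (vadd o z r)) (fun r => sumR m (fun i => z i * F (i :: nil) t (vadd o z r))) 0 1 Rlt_0_1) as [r [Hr2 Hr3]].
  { intros r _. apply is_derive_Reals. apply (line_deriv m (F nil t) (fun i => F (i :: nil) t)); auto.
    intros i Hi; apply (HF nil I0); auto. }
  rewrite vadd_zero_r in Hr2. replace (vadd o z 1) with z in Hr2 by (symmetry; apply vadd_0).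
  rewrite Hr2. set (y := vadd o z r).
  assert (Ey : forall i, y i = r * z i) by (intros i; unfold y, vadd, o; ring).
  assert (Hyy : dot m y y <= dot m z z).
  { apply sumR_le; intros i _. rewrite Ey. assert (0 <= z i * z i) by nra. assert (r * r <= 1) by nra. nra. }
  assert (Hg := Hgrad t y Ht0). destruct (Hug y) as [U1 U2].
  assert (Hxy : xnorm n y + vnorm n y <= 2 * sqrt (dot m z z)).
  { assert (A1 : xnorm n y <= sqrt (dot m y y)) by (apply sqrt_le_1_alt; unfold m; rewrite dot_double; assert (0 <= sumR n (fun k => y (n + k)%nat ^ 2)) by (apply sumR_pos; intros; apply pow2_ge_0); lra).
    assert (A2 : vnorm n y <= sqrt (dot m y y)) by (apply sqrt_le_1_alt; unfold m; rewrite dot_double; assert (0 <= sumR n (fun k => y k ^ 2)) by (apply sumR_pos; intros; apply pow2_ge_0); lra).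
    assert (A3 : sqrt (dot m y y) <= sqrt (dot m z z)) by (apply sqrt_le_1_alt; auto). lra. }
  set (q := sqrt (dot m z z)) in *. assert (Hq : 0 <= q) by apply sqrt_pos.
  assert (Hqq : q * q = dot m z z) by (apply sqrt_sqrt, dot_self_ge0).
  set (gn := sqrt (sumR m (fun i => F (i :: nil) t y ^ 2))) in *.
  assert (Hgn : 0 <= gn) by apply sqrt_pos.
  assert (Hgg : gn * gn = dot m (fun i => F (i :: nil) t y) (fun i => F (i :: nil) t y)).
  { unfold gn. rewrite sqrt_sqrt; [apply sumR_ext; intros; ring|apply sumR_pos; intros; apply pow2_ge_0]. }
  assert (C := dot_cauchy m z (fun i => F (i :: nil) t y)). rewrite <- Hqq, <- Hgg in C.
  change (sumR m (fun i => z i * F (i :: nil) t y)) with (dot m z (fun i => F (i :: nil) t y)).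
  set (dd := dot m z (fun i => F (i :: nil) t y)) in *.
  assert (Hdd : dd <= q * gn).
  { apply Rnot_lt_le; intros Hlt. assert (0 <= q * gn) by (apply Rmult_le_pos; auto). nra. }
  assert (Hex : exp (c * (1 + dot m y y)) <= exp (c * X)) by (apply exp_le, Rmult_le_compat_l; unfold X; lra).
  assert (Hgn2 : gn <= c0 * exp (c * X) * (2 * q)).
  { eapply Rle_trans; [exact Hg|]. apply Rmult_le_compat; auto.
    - apply Rmult_le_pos; lra.
    - apply Rplus_le_le_0_compat; apply sqrt_pos.
    - apply Rmult_le_compat_l; lra. }
  assert (q * gn <= q * (c0 * exp (c * X) * (2 * q))) by (apply Rmult_le_compat_l; auto).
  assert (0 <= 2 * c0 * exp (c * X)) by (assert (0 < exp (c * X)) by apply exp_pos; nra).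
  replace (q * (c0 * exp (c * X) * (2 * q))) with (2 * c0 * exp (c * X) * (q * q)) in * by ring.
  assert (2 * c0 * exp (c * X) * (q * q) <= 2 * c0 * exp (c * X) * X) by (apply Rmult_le_compat_l; auto; rewrite Hqq; unfold X; lra). lra. }
(* The polynomial factor left by the integration is absorbed in one more exponential, whence
   [2 c + 1]. *)
assert (HXe : X <= exp X) by (generalize (exp_ineq1_le X); lra).
assert (E1 : 1 <= exp (c * X)) by (rewrite <- exp_0; apply exp_le, Rmult_le_pos; lra).
assert (E2 : 1 <= exp X) by lra.
destruct (Hug z) as [U1 U2]. fold X in U2.
replace ((2 * c + 1) * X) with (c * X + (c * X + X)) by ring.
rewrite !exp_plus. set (ec := exp (c * X)) in *. set (ex := exp X) in *.
assert (F1 : F nil t z + e <= (r0 + e + 2 * c0) * (ec * ex)).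
{ assert (1 <= ec * ex) by nra. assert (X * ec <= ex * ec) by (apply Rmult_le_compat_r; lra).
  assert (2 * c0 * (X * ec) <= 2 * c0 * (ex * ec)) by (apply Rmult_le_compat_l; lra).
  assert ((r0 + e) * 1 <= (r0 + e) * (ec * ex)) by (apply Rmult_le_compat_l; lra). lra. }
assert (F0 : 0 < F nil t z + e) by (specialize (Hpos t z Ht0); lra).
apply Rle_trans with (ec * ((r0 + e + 2 * c0) * (ec * ex))); [|right; ring].
apply Rmult_le_compat; lra.
Qed.

(** * From the two-point inequality to the Hessian of the logarithm *)

Lemma der_ln (f : R -> R) (x a : R) : 0 < f x -> is_derive f x a -> is_derive (fun s => ln (f s)) x (a / f x).
Proof.
intros Hp H. apply (der_ext (fun s => ln (f s)) _ _ (/ f x * a)); [auto|unfold Rdiv; ring|].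
apply der_comp; auto. apply is_derive_Reals, derivable_pt_lim_ln; auto.
Qed.

Lemma der_div (f g : R -> R) (x a b : R) : g x <> 0 -> is_derive f x a -> is_derive g x b ->
  is_derive (fun s => f s / g s) x ((a * g x - f x * b) / g x ^ 2).
Proof. intros Hg Hf Hg'. apply (is_derive_div f g x a b); auto. Qed.

Lemma der_pos_near (f : R -> R) (x a : R) : is_derive f x a -> 0 < f x ->
  exists d, 0 < d /\ forall s, Rabs (s - x) < d -> 0 < f s.
Proof.
intros H Hp. assert (C := der_cont f x a H). destruct (C (f x) Hp) as [d [Hd Hc]].
exists d. split; auto. intros s Hs. destruct (Req_dec s x) as [->|Hne]; auto.
specialize (Hc s). simpl in Hc. unfold Rdist in Hc.
assert (Rabs (f s - f x) < f x). { apply Hc. split; auto. split; [exact I|auto]. }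
apply Rabs_lt_between in H0. lra.
Qed.

(** The formula for the inner derivative holds only where [f] is positive; positivity persists on a
    neighbourhood along coordinate [i], so the outer derivative is computed locally. *)
Lemma hess_ln m zeta f f1 f2 z i j : C2_derivs m (fun z => f (freeze m zeta z)) f1 f2 ->
  0 < f (freeze m zeta z) -> (i < m)%nat -> (j < m)%nat ->
  hess (fun w => ln (f w)) (freeze m zeta z) i j =
  (f2 i j z * f (freeze m zeta z) - f1 j z * f1 i z) / f (freeze m zeta z) ^ 2.
Proof.
intros (_ & H1 & H2) Hp Hi Hj. unfold hess.
assert (P1 : forall y, 0 < f (freeze m zeta y) -> partial j (fun w => ln (f w)) (freeze m zeta y) = f1 j y / f (freeze m zeta y)).
{ intros y Hy. apply partial_eq. apply is_derive_Reals. rewrite freeze_lt; auto.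
  apply (der_ext (fun s => ln (f (freeze m zeta (upd y j s)))) _ _ (f1 j y / f (freeze m zeta (upd y j (y j))))).
  - intros s. rewrite freeze_upd; auto.
  - rewrite upd_same; auto.
  - apply (der_ln (fun s => f (freeze m zeta (upd y j s)))); [rewrite upd_same; auto|]. apply (proj1 (H1 j Hj)). }
assert (Di : is_derive (fun s => f (freeze m zeta (upd z i s))) (z i) (f1 i z)) by apply (proj1 (H1 i Hi)).
assert (Dij := proj1 (H2 i j Hi Hj) z).
destruct (der_pos_near _ _ _ Di) as [d [Hd Hpos]]; [rewrite upd_same; auto|].
apply partial_eq. apply is_derive_Reals. rewrite freeze_lt; auto.
apply (is_derive_ext_loc (fun s => f1 j (upd z i s) / f (freeze m zeta (upd z i s)))).
- exists (mkposreal d Hd). intros s Hs. rewrite <- freeze_upd, P1; auto.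
- apply (der_ext (fun s => f1 j (upd z i s) / f (freeze m zeta (upd z i s))) _ _
    ((f2 i j z * f (freeze m zeta (upd z i (z i))) - f1 j (upd z i (z i)) * f1 i z) / f (freeze m zeta (upd z i (z i))) ^ 2)).
  + auto.
  + rewrite upd_same. auto.
  + apply (der_div (fun s => f1 j (upd z i s)) (fun s => f (freeze m zeta (upd z i s)))); auto.
    rewrite upd_same. lra.
Qed.

(* Two-point log-convexity along a line, differentiated twice at coinciding points. *)
Lemma log_hessian_of_convexity m f f1 f2 p p1 p2 (N : mat) z xi :
  C2_derivs m f f1 f2 -> C2_derivs m p p1 p2 -> (forall y, 0 <= f y) -> 0 < f z ->
  (forall w, exp (/ 2 * quad m N w) * (exp (- / 2 * p z) * f z) <=
     sqrt ((exp (- / 2 * p (vadd z w 1)) * f (vadd z w 1)) * (exp (- / 2 * p (vadd z w (-1))) * f (vadd z w (-1))))) ->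
  quad m N xi <= (quad m (fun i j => f2 i j z) xi * f z - dot m xi (fun i => f1 i z) ^ 2) / f z ^ 2
    - / 2 * quad m (fun i j => p2 i j z) xi.
Proof.
intros Hf Hp Hf0 Hfz Hconv.
set (F := fun s => f (vadd z xi s)). set (P := fun s => p (vadd z xi s)).
set (F1 := fun s => dot m xi (fun i => f1 i (vadd z xi s))). set (P1 := fun s => dot m xi (fun i => p1 i (vadd z xi s))).
set (F2 := quad m (fun i j => f2 i j z) xi). set (P2 := quad m (fun i j => p2 i j z) xi).
set (q := quad m N xi).
assert (DF : forall s, is_derive F s (F1 s)) by (intros; apply (line_deriv2 m f f1 f2); auto).
assert (DP : forall s, is_derive P s (P1 s)) by (intros; apply (line_deriv2 m p p1 p2); auto).
assert (DF1 : is_derive F1 0 F2).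
{ assert (G := proj2 (line_deriv2 m f f1 f2 z xi 0 Hf)). rewrite vadd_zero_r in G. exact G. }
assert (DP1 : is_derive P1 0 P2).
{ assert (G := proj2 (line_deriv2 m p p1 p2 z xi 0 Hp)). rewrite vadd_zero_r in G. exact G. }
assert (F0 : F 0 = f z) by (unfold F; rewrite vadd_zero_r; auto).
assert (P0 : P 0 = p z) by (unfold P; rewrite vadd_zero_r; auto).
assert (F10 : F1 0 = dot m xi (fun i => f1 i z)) by (unfold F1; rewrite vadd_zero_r; auto).
destruct (der_pos_near F 0 (F1 0) (DF 0)) as [d [Hd Hpos]]; [lra|].
set (psi := fun s => ln (F s) - / 2 * P s). set (psi1 := fun s => F1 s / F s - / 2 * P1 s).
assert (Dpsi : forall s, Rabs (s - 0) < d -> is_derive psi s (psi1 s)).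
{ intros s Hs. apply der_minus; [apply der_ln; auto|apply der_scal; auto]. }
assert (Dpsi1 : is_derive psi1 0 ((F2 * F 0 - F1 0 * F1 0) / F 0 ^ 2 - / 2 * P2)).
{ apply der_minus; [apply der_div; auto; lra|apply der_scal; auto]. }
assert (Dneg : forall (g : R -> R) (s a : R), is_derive g (- s) a -> is_derive (fun r => g (- r)) s (- a)).
{ intros g s a H. apply (der_ext (fun r => g (- r)) _ _ (a * - 1)); [auto|ring|].
  apply der_comp; auto. apply (der_ext (fun r => -1 * r) _ _ (-1 * 1)); [intros; ring|ring|]. apply (der_scal (fun r => r)), der_id. }
assert (Habs : forall s, 0 - d < s < 0 + d -> Rabs (s - 0) < d /\ Rabs (- s - 0) < d).
{ intros s Hs. split; apply Rabs_lt_between; lra. }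
(* Along the line, the two-point inequality says that [psi s + psi (- s) - q s^2] has a minimum at
   0; its second derivative there is twice the desired difference. *)
assert (M : 0 <= ((F2 * F 0 - F1 0 * F1 0) / F 0 ^ 2 - / 2 * P2) - - ((F2 * F 0 - F1 0 * F1 0) / F 0 ^ 2 - / 2 * P2) - 2 * q * 1).
{ apply (min_deriv2 (fun s => psi s + psi (- s) - q * (s * s)) (fun s => psi1 s - psi1 (- s) - 2 * q * s) 0 _ d Hd).
  - intros s Hs. destruct (Habs s Hs).
    apply (der_ext (fun s => psi s + psi (- s) - q * (s * s)) _ _ (psi1 s + - psi1 (- s) - q * (1 * s + s * 1))); [auto|ring|].
    apply der_minus; [apply der_plus; auto|]. apply der_scal, der_mult; apply der_id.
  - apply der_minus; [apply der_minus; auto|apply der_scal, der_id].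
    apply Dneg. rewrite Ropp_0. auto.
  - intros s Hs. destruct (Habs s Hs) as [A1 A2].
    specialize (Hconv (fun i => s * xi i)). rewrite quad_scal in Hconv. fold q in Hconv.
    replace (vadd z (fun i => s * xi i) 1) with (vadd z xi s) in Hconv by (apply functional_extensionality; intros i; unfold vadd; ring).
    replace (vadd z (fun i => s * xi i) (-1)) with (vadd z xi (- s)) in Hconv by (apply functional_extensionality; intros i; unfold vadd; ring).
    fold (F s) (P s) (F (- s)) (P (- s)) in Hconv. rewrite <- F0, <- P0 in Hconv.
    assert (PF0 : 0 < F 0) by lra. assert (PFs := Hpos s A1). assert (PFm := Hpos (- s) A2).
    assert (E : forall r, 0 < F r -> exp (- / 2 * P r) * F r = exp (psi r)).
    { intros r Hr. unfold psi. replace (ln (F r) - / 2 * P r) with (- / 2 * P r + ln (F r)) by ring. rewrite exp_plus, exp_ln; auto. }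
    rewrite !E in Hconv by auto. rewrite <- !exp_plus in Hconv.
    replace (exp (psi s + psi (- s))) with (exp ((psi s + psi (- s)) / 2) * exp ((psi s + psi (- s)) / 2)) in Hconv by (rewrite <- exp_plus; f_equal; field).
    rewrite sqrt_square in Hconv by (left; apply exp_pos).
    assert (H1 : / 2 * (s ^ 2 * q) + psi 0 <= (psi s + psi (- s)) / 2).
    { apply Rnot_lt_le; intros Hlt. apply exp_increasing in Hlt. lra. }
    rewrite Ropp_0. lra. }
rewrite F0, F10 in M. replace (dot m xi (fun i => f1 i z) ^ 2) with (dot m xi (fun i => f1 i z) * dot m xi (fun i => f1 i z)) by ring. lra.
Qed.

Theorem theorem4p1 (n : nat) (U : (nat -> R) -> R) (rho : R -> (nat -> R) -> R)
  (c0 k0 kappa : R) (K : mat) (N : R -> mat) :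
  smooth_on (2 * n) (fun _ => True) U ->
  smooth_on (2 * n + 1) (fun w => 0 < w O) (fun w => rho (w O) (fun i => w (S i))) ->
  (forall t z, 0 < t -> 0 <= rho t z) ->
  (* kinetic Fokker-Planck equation *)
  (forall t z, 0 < t ->
     derivable_pt_lim (fun s => rho s z) t
       (sumR n (fun i => partial (n + i) (partial (n + i) (rho t)) z)
        - sumR n (fun i => partial (n + i) U z * partial (n + i) (rho t) z)
        - sumR n (fun i => z (n + i)%nat * partial i (rho t) z))) ->
  0 <= c0 -> 0 <= k0 -> 0 <= kappa ->
  (forall t z, 0 < t ->
     gradnorm (2 * n) (rho t) z <= c0 * exp (- / 2 * U z) * (xnorm n z + vnorm n z)) ->
  (forall t z xi, 0 < t ->
     quad (2 * n) (hess (rho t) z) xi >=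
     - (k0 * exp (kappa * (xnorm n z ^ 2 + vnorm n z ^ 2))) * quad (2 * n) idm xi) ->
  (forall z xi,
     quad (2 * n) (hess U z) xi <=
     k0 * exp (kappa * (xnorm n z ^ 2 + vnorm n z ^ 2)) * quad (2 * n) idm xi) ->
  (* K constant symmetric non-negative definite, Hess h >= -K *)
  (forall i j, (i < 2 * n)%nat -> (j < 2 * n)%nat -> K i j = K j i) ->
  (forall xi, 0 <= quad (2 * n) K xi) ->
  (forall z xi, quad (2 * n) (hess (hfun n U) z) xi >= - quad (2 * n) K xi) ->
  (* N solves the Riccati equation with lim_{t->0} N^{-1} = 0 *)
  (forall t i j, 0 < t -> (i < 2 * n)%nat -> (j < 2 * n)%nat ->
     derivable_pt_lim (fun s => N s i j) t (riccati_rhs n (N t) K i j)) ->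
  inv_tends_to_zero (2 * n) N ->
  forall t z xi, 0 < t -> 0 < rho t z ->
    quad (2 * n)
      (fun i j => hess (fun w => ln (rho t w)) z i j - / 2 * hess U z i j) xi
    >= quad (2 * n) (N t) xi.
Proof.
intros HU Hrho Hpos HFP Hc0 Hk0 Hkap Hgrad _ HhU HK HKp Hh HN Hinv t z xi Ht Hrz.
set (m := (2 * n)%nat) in *.
(* The coordinates beyond [m] are frozen at those of [z] itself, so that [freeze m z z = z] returns
   the claim at the requested point. *)
set (D := frozen_partial m z U). set (F := fun l t => frozen_partial m z (rho t) l).
assert (HD : smooth_family m D) by (apply smooth_freeze; auto).
assert (HF : space_time_smooth m F) by (apply space_time_smooth_freeze; auto).
assert (HNr : riccati_solution n K N) by (intros r i j Hr Hi Hj; apply is_derive_Reals, HN; auto).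
assert (Fpos : forall t y, 0 < t -> 0 <= F nil t y) by (intros; apply Hpos; auto).
assert (Fder : forall t y, 0 < t -> is_derive (fun s => F nil s y) t
     (sumR n (fun i => F ((n + i)%nat :: (n + i)%nat :: nil) t y)
      - sumR n (fun i => D ((n + i)%nat :: nil) y * F ((n + i)%nat :: nil) t y)
      - sumR n (fun i => y (n + i)%nat * F (i :: nil) t y))).
{ intros r y Hr. apply is_derive_Reals.
  replace (sumR n (fun i => y (n + i)%nat * F (i :: nil) r y)) with (sumR n (fun i => freeze m z y (n + i)%nat * partial i (rho r) (freeze m z y))).
  - apply (HFP r (freeze m z y) Hr).
  - apply sumR_ext; intros i Hi. rewrite freeze_lt by (unfold m; lia). auto. }
assert (Hst := ground_stationary n D HD).
destruct (potential_convexity n z U K HU Hh) as [h1 [h2 [Hh2 HhK]]].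
destruct (potential_semiconvex n _ h1 h2 K Hh2 HhK) as [[k [Hk Hsc]] Hgap].
assert (Hlsc := ground_semiconvex n z U k0 kappa HU Hk0 Hkap HhU).
assert (K1 : 0 <= k0 / 4 * exp (2 * kappa)) by (apply Rmult_le_pos; [lra|left; apply exp_pos]).
assert (K2 : 0 <= 2 * kappa) by lra.
destruct (potential_upper n _ _ _ _ _ _ _ _ Hst K1 K2 Hlsc Hk Hsc) as [c [Hc Hup]].
assert (Hconv : forall e w, 0 < e -> exp (/ 2 * quad m (N t) w) * (ground_state D z * (F nil t z + e)) <=
   sqrt ((ground_state D (vadd z w 1) * (F nil t (vadd z w 1) + e)) * (ground_state D (vadd z w (-1)) * (F nil t (vadd z w (-1)) + e)))).
{ intros e w He.
  apply (log_convexity n _ _ _ _ K N (2 * c + 1) c (transformed_solution n D F e HD HF He Fpos Fder)); auto; try lra.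
  - intros y; apply Hup.
  - apply (transformed_growth n D F e c c0); auto.
    + intros r y Hr. eexists. apply Fder; auto.
    + intros y; apply Hup.
    + intros r y Hr. specialize (Hgrad r (freeze m z y) Hr).
      replace (xnorm n y) with (xnorm n (freeze m z y)).
      2: { unfold xnorm. f_equal. apply sumR_ext; intros i Hi. rewrite freeze_lt; auto. unfold m; lia. }
      replace (vnorm n y) with (vnorm n (freeze m z y)).
      2: { unfold vnorm. f_equal. apply sumR_ext; intros i Hi. rewrite freeze_lt; auto. unfold m; lia. }
      exact Hgrad. }
(* The limit [e -> 0] along [1 / (k + 1)]. The square root is continuous at 0 too, so [rho] may
   vanish at the shifted points. *)
assert (Hconv0 : forall w, exp (/ 2 * quad m (N t) w) * (exp (- / 2 * D nil z) * F nil t z) <=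
   sqrt ((exp (- / 2 * D nil (vadd z w 1)) * F nil t (vadd z w 1)) * (exp (- / 2 * D nil (vadd z w (-1))) * F nil t (vadd z w (-1))))).
{ intros w.
  assert (Le : forall a b : R, is_lim_seq (fun k => a * (b + 1 * / (INR k + 1))) (a * b)).
  { intros a b. apply is_lim_seq_mult'; [apply is_lim_seq_const|apply lim_approach]. }
  refine (lim_le _ _ _ _ (fun k => Hconv (1 * / (INR k + 1)) w _) _ _).
  - generalize (inv_succ_bounds k). lra.
  - apply is_lim_seq_mult'; [apply is_lim_seq_const|apply Le].
  - apply lim_sqrt; [|apply is_lim_seq_mult'; apply Le].
    repeat apply Rmult_le_pos; auto; left; apply exp_pos. }
assert (HCU := smooth_family_C2 m D HD).
assert (HCF : C2_derivs m (fun y => rho t (freeze m z y)) (fun i => F (i :: nil) t) (fun i j => F (i :: j :: nil) t)).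
{ apply (smooth_family_C2 m (fun l => F l t)). intros l Hl. destruct (HF l Hl) as [A B]. split; [|intros; apply A; auto].
  intros yk y L. apply B; auto. apply is_lim_seq_const. }
assert (Hz : freeze m z z = z) by apply freeze_self.
assert (HL := log_hessian_of_convexity m _ _ _ _ _ _ (N t) z xi HCF HCU (fun y => Hpos t _ Ht)).
cbv beta in HL. rewrite Hz in HL. specialize (HL Hrz).
apply Rle_ge. eapply Rle_trans; [apply HL|].
- intros w. specialize (Hconv0 w). replace (rho t z) with (F nil t z); [exact Hconv0|]. unfold F, frozen_partial. rewrite Hz. reflexivity.
- right. symmetry.
  rewrite (quad_ext m _ (fun i j => (F (i :: j :: nil) t z * rho t z - F (j :: nil) t z * F (i :: nil) t z) / rho t z ^ 2 - / 2 * D (i :: j :: nil) z) xi xi); auto.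
  + unfold quad, dot. set (r := rho t z) in *.
    (* The double sum separates into Hess rho, the rank-one gradient term, which factors as a
       square, and Hess U. *)
    rewrite (sumR_ext m _ (fun i => / r * sumR m (fun j => xi i * F (i :: j :: nil) t z * xi j) + (- / r ^ 2 * (sumR m (fun j => xi j * F (j :: nil) t z))) * (xi i * F (i :: nil) t z) + - / 2 * sumR m (fun j => xi i * D (i :: j :: nil) z * xi j))).
    * rewrite !sumR_plus, !sumR_scal. field. lra.
    * intros i Hi.
      rewrite (sumR_ext m (fun j => xi i * _ * xi j) (fun j => / r * (xi i * F (i :: j :: nil) t z * xi j) + (- / r ^ 2 * (xi i * F (i :: nil) t z)) * (xi j * F (j :: nil) t z) + - / 2 * (xi i * D (i :: j :: nil) z * xi j))).
      -- rewrite !sumR_plus, !sumR_scal. ring.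
      -- intros j Hj. field. lra.
  + intros i j Hi Hj. f_equal.
    * assert (HH := hess_ln m z (rho t) _ _ z i j HCF). cbv beta in HH. rewrite Hz in HH. apply HH; auto.
    * f_equal. assert (HH := hess_freeze m z U _ _ HCU z i j Hi Hj). rewrite Hz in HH. exact HH.
Qed.
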